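(* Let $1\le m<\infty$, $\kappa\ge 0$, $0<\alpha_j<1$ for $1\le j\le m$, $\alpha=\min_{1\le j\le m}\alpha_j$, $0<T<\infty$, and let $A,B_1,\dots,B_m$ be operators in the Hilbert space $\mathbf H$ as described in the context. Let $u$ be the solution of $$u'(t)+Au(t)+\sum_{j=1}^m\int_0^t\beta_j(t-s)B_ju(s)\,ds=f(t),\quad t>0,\qquad u(0)=u_0,\qquad \beta_j(t)=\frac{e^{-\kappa t}t^{\alpha_j-1}}{\Gamma(\alpha_j)},$$ and put $g(t)=e^{\kappa t}f(t)$. Suppose that for some positive constant $C$ $$\|Au_0-g(0)\|+\|g(t)\|\le C,\qquad \|E'(t)(Au_0-g(0))\|+\|g'(t)\|+t\|g''(t)\|\le Ct^{\alpha-1},\qquad 0<t\le T,$$ where $E(t)=\exp(-At)$. Then there is a positive constant $C$, independent of $t$, such that $$\|u''(t)\|+\|Au'(t)\|\le Ce^{-\kappa t}t^{\alpha-1}\|u_0\|_2,\qquad 0<t\le T.$$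
   Context: $\mathbf H$ is a Hilbert space with inner product $(\cdot,\cdot)$ and norm $\|\cdot\|$ (in the setting considered, $\mathbf H=L_2(\Omega)$ with $\Omega\subseteq\mathbb R^d$ a Lipschitz domain). $A$ is a self-adjoint positive-definite linear operator, not necessarily bounded, with compact inverse, defined on a dense subspace $D(A)\subset\mathbf H$. Set $\|w\|_q=\|A^{q/2}w\|=(A^qw,w)^{1/2}$, so $\|w\|_2=\|Aw\|$. Each $B_j$ ($1\le j\le m$) is a self-adjoint linear operator in $\mathbf H$ with $D(B_j)\supset D(A)$, and $A$ dominates $B_j$ in the sense that $|(B_jw,v)|\le C\|w\|_q\|v\|_\vartheta$ for $\vartheta=0,1,2$ and $\vartheta+q=2$. $E(t)=\exp(-At)$ is the analytic semigroup generated by $-A$, and primes denote derivatives in $t$. $C$ denotes a generic positive constant, not necessarily the same at each occurrence.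
   Formalization: The initial value u_0 is assumed nonzero, since for u_0 = 0 the estimate fails (e.g. B_j = 0, Ae = λe, f(t) = t²e gives u'' ≠ 0 with zero right-hand side), and f is assumed continuous at 0+, so that g(0) is the limit of g(t). *)

(* Defs.v *)
From Stdlib Require Import Reals.
From Coquelicot Require Import Coquelicot.

Set Implicit Arguments.

Open Scope R_scope.

(* Real Hilbert space.  A complex one is covered by passing to the underlying
   real space with the inner product Re (.,.). *)
Record Hilbert := mkHilbert {
  hspace :> CompleteNormedModule R_AbsRing;
  inner : hspace -> hspace -> R;
  inner_sym : forall x y, inner x y = inner y x;
  inner_plus_l : forall x y z, inner (plus x y) z = inner x z + inner y z;
  inner_scal_l : forall (a : R) x y, inner (scal a x) y = a * inner x y;
  inner_pos : forall x, 0 <= inner x x;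
  norm_inner : forall x, norm x = sqrt (inner x x)
}.

Arguments inner {h} _ _.

(* A not necessarily bounded operator; the values of [app] outside [dom] are
   irrelevant. *)
Record operator (H : Hilbert) := mkOperator {
  dom : H -> Prop;
  app :> H -> H
}.

Definition opp_op (H : Hilbert) (L : operator H) : operator H :=
  @mkOperator H (dom L) (fun w => opp (L w)).

Definition linear_op (H : Hilbert) (L : operator H) : Prop :=
  dom L zero /\
  (forall w v, dom L w -> dom L v ->
     dom L (plus w v) /\ L (plus w v) = plus (L w) (L v)) /\
  (forall (a : R) w, dom L w -> dom L (scal a w) /\ L (scal a w) = scal a (L w)).

Definition dense (H : Hilbert) (D : H -> Prop) : Prop :=
  forall (x : H) (eps : R), 0 < eps -> exists y, D y /\ norm (minus x y) < eps.

(* (v, z) belongs to the graph of the adjoint of L. *)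
Definition adjoint_graph (H : Hilbert) (L : operator H) (v z : H) : Prop :=
  forall w, dom L w -> inner (L w) v = inner w z.

(* L = L^*, equality of domains included. *)
Definition self_adjoint (H : Hilbert) (L : operator H) : Prop :=
  linear_op L /\ dense H (dom L) /\
  forall v z, adjoint_graph L v z <-> dom L v /\ L v = z.

Definition positive_definite (H : Hilbert) (L : operator H) : Prop :=
  forall w, dom L w -> w <> zero -> 0 < inner (L w) w.

Definition compact_map (H : Hilbert) (K : H -> H) : Prop :=
  forall (x : nat -> H) (M : R), (forall n, norm (x n) <= M) ->
  exists (phi : nat -> nat) (l : H),
    (forall n, (phi n < phi (S n))%nat) /\
    filterlim (fun n => K (x (phi n))) eventually (locally l).

Definition has_compact_inverse (H : Hilbert) (L : operator H) : Prop :=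
  exists K : H -> H,
    (forall x, dom L (K x) /\ L (K x) = x) /\
    (forall w, dom L w -> K (L w) = w) /\
    compact_map H K.

(* ||w||_q = ||A^(q/2) w|| = (A^q w, w)^(1/2) for w in D(A); used only for
   q = 0, 1, 2, where it is ||w||, (Aw, w)^(1/2) and ||Aw||. *)
Definition qnorm (H : Hilbert) (A : operator H) (q : nat) (w : H) : R :=
  match q with
  | 0%nat => norm w
  | 1%nat => sqrt (inner (A w) w)
  | _ => norm (A w)
  end.

Definition dominates (H : Hilbert) (A B : operator H) : Prop :=
  exists C : R, 0 < C /\
  forall q theta : nat, (theta + q = 2)%nat ->
  forall w v, dom A w -> dom A v ->
    Rabs (inner (B w) v) <= C * qnorm A q w * qnorm A theta v.

(* E is the strongly continuous semigroup of bounded operators (on t >= 0)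
   whose infinitesimal generator, with its exact domain, is L; it is unique. *)
Definition semigroup_generated_by (H : Hilbert) (L : operator H)
    (E : R -> H -> H) : Prop :=
  (forall t, 0 <= t -> is_linear (E t)) /\
  (forall x, E 0 x = x) /\
  (forall s t x, 0 <= s -> 0 <= t -> E (s + t) x = E s (E t x)) /\
  (forall x, filterlim (fun t => E t x) (at_right 0) (locally x)) /\
  (forall x y,
     filterlim (fun h => scal (/ h) (minus (E h x) x)) (at_right 0) (locally y)
     <-> dom L x /\ L x = y).

Definition Gamma (a : R) : R :=
  RInt_gen (fun x => Rpower x (a - 1) * exp (- x))
           (at_right 0) (Rbar_locally p_infty).

Definition beta (kappa a t : R) : R :=
  exp (- (kappa * t)) * Rpower t (a - 1) / Gamma a.

(* Derivative relative to (0, T]: the usual derivative at 0 < t < T and the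
   left derivative at t = T. *)
Definition is_derive_on {V : NormedModule R_AbsRing} (T : R) (f : R -> V)
    (t : R) (l : V) : Prop :=
  filterdiff f (within (fun s : R => 0 < s <= T) (locally t)) (fun y : R => scal y l).

(* u'(t) + A u(t) + sum_{j=1}^m int_0^t beta_j(t-s) B_j u(s) ds = f(t) for all
   t > 0, u(0) = u0, with u continuous at 0; the integral is an improper
   Riemann integral in H, as beta_j is singular at 0. *)
Definition is_solution (H : Hilbert) (m : nat) (kappa : R) (alpha : nat -> R)
    (A : operator H) (B : nat -> operator H) (f : R -> H) (u0 : H)
    (u : R -> H) : Prop :=
  u 0 = u0 /\
  filterlim u (at_right 0) (locally u0) /\
  forall t : R, 0 < t ->
    dom A (u t) /\
    exists (du : H) (I : nat -> H),
      is_derive u t du /\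
      (forall j, (1 <= j <= m)%nat ->
         is_RInt_gen (fun s => scal (beta kappa (alpha j) (t - s)) (B j (u s)))
                     (at_right 0) (at_left t) (I j)) /\
      plus (plus du (A (u t))) (sum_n_m I 1 m) = f t.

(* Main.v *)
(* The factor exp (kappa t) is harmless on (0, T], so the exponential is kept
   in the kernels beta_j.  With K = A^-1, M_j = B_j K and N_j the bounded
   extension of K B_j, the function W = A u' satisfies the Volterra equation
   W = P - (sum_j S_j M_j) * W, where S_j = A (E * beta_j) and P = A (E(t) y0
   + E * h) with y0 = f(0) - A u0 and h = f' - sum_j beta_j B_j u0.  Both P and
   S_j are O(t^(alpha - 1)): a source h with |h| + t |h'| <= C t^(alpha - 1)
   gives |A (E * h)| <= C t^(alpha - 1), because |A E(t)| <= 1/t.  The weakly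
   singular Volterra equation is solvable in the same weighted space, and
   u0 + int_0^t K W solves the original problem.  Applying K to the equation
   turns the B_j into the bounded N_j, so that the difference of two solutions
   satisfies a homogeneous Volterra equation and vanishes.

   No interchange of integrals is needed: with R' = beta_j - S_j for
   R = K S_j = E * beta_j, one only differentiates convolutions R * phi. *)

(* Two obstacles shape the proof. The bound 1/t for A E(t) is not integrable, so A (E * h) cannot be
   estimated under the integral sign; the Lipschitz form of the source supplies a factor t - s that
   cancels the singularity at s = t ([dlt_lip]). And nothing is known in advance about the size of A
   u(s) near 0, so the equation for u cannot be differentiated directly: a solution is built from
   the differentiated equation, and u is identified with it by a uniqueness argument in which only u
   itself has to be bounded.

   Integrals are differences of primitives ([NI]), so that bounded operators pass through them at
   once and a limit under the integral only asks for a majorant with a known primitive. Derivatives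
   are taken from the right, because semigroup orbits and convolutions expand naturally forward in
   time; continuity of the derivative makes them two-sided at the end.

   The estimate is first proved with a constant that depends on the data; the factor |A u0| is then
   restored by dividing by it, which is where [u0 <> zero] enters. *)
Require Import Defs.
From Stdlib Require Import Reals Lra Lia ClassicalEpsilon.
From Coquelicot Require Import Coquelicot.

Open Scope R_scope.

(** * Hilbert spaces *)

(* Coquelicot's operations reach a Hilbert space along several, syntactically
   different, coercion paths; these copies fix one, so that rewriting works. *)
Definition vadd {H : Hilbert} (x y : H) : H := plus x y.
Definition vopp {H : Hilbert} (x : H) : H := opp x.
Definition vsub {H : Hilbert} (x y : H) : H := vadd x (vopp y).
Definition vscal {H : Hilbert} (a : R) (x : H) : H := scal a x.
Definition v0 {H : Hilbert} : H := zero.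
Definition vnorm {H : Hilbert} (x : H) : R := norm x.

Notation "x [+] y" := (vadd x y) (at level 50, left associativity).
Notation "x [-] y" := (vsub x y) (at level 50, left associativity).
Notation "a [*] x" := (vscal a x) (at level 40, no associativity).

Lemma inner_add_l (H : Hilbert) (x y z : H) : inner (x [+] y) z = inner x z + inner y z.
Proof. apply inner_plus_l. Qed.

Lemma inner_vscal_l (H : Hilbert) (a : R) (x z : H) : inner (a [*] x) z = a * inner x z.
Proof. apply inner_scal_l. Qed.

Lemma inner_v0_l (H : Hilbert) (x : H) : inner v0 x = 0.
Proof.
  assert (E := inner_add_l _ v0 v0 x).
  assert (Z : (v0 : H) [+] v0 = v0) by exact (plus_zero_l v0).
  rewrite Z in E; lra.
Qed.

Lemma inner_vopp_l (H : Hilbert) (x y : H) : inner (vopp x) y = - inner x y.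
Proof.
  assert (E := inner_add_l _ (vopp x) x y).
  assert (Z : vopp x [+] x = v0) by exact (plus_opp_l x).
  rewrite Z, inner_v0_l in E; lra.
Qed.

Lemma norm_sqr (H : Hilbert) (x : H) : vnorm x * vnorm x = inner x x.
Proof. unfold vnorm; rewrite norm_inner; apply sqrt_sqrt, inner_pos. Qed.

Lemma vnorm_0 (H : Hilbert) : vnorm (v0 : H) = 0.
Proof. exact norm_zero. Qed.

Lemma vnorm_eq0 (H : Hilbert) (x : H) : vnorm x = 0 -> x = v0.
Proof. exact (norm_eq_zero x). Qed.

Lemma vnorm_ge0 (H : Hilbert) (x : H) : 0 <= vnorm x.
Proof. exact (norm_ge_0 x). Qed.

Lemma vnorm_add (H : Hilbert) (x y : H) : vnorm (x [+] y) <= vnorm x + vnorm y.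
Proof. exact (norm_triangle x y). Qed.

Lemma vnorm_opp (H : Hilbert) (x : H) : vnorm (vopp x) = vnorm x.
Proof. exact (norm_opp x). Qed.

(** Testing against every [v] turns a vector identity into an identity of real numbers; [vring] and
    [vfield] rest on this. *)
Lemma inner_ext (H : Hilbert) (x y : H) : (forall v, inner x v = inner y v) -> x = y.
Proof.
  intros E.
  assert (Z : vnorm (x [-] y) = 0).
  { apply Rsqr_0_uniq; unfold Rsqr; rewrite norm_sqr; unfold vsub.
    rewrite inner_add_l, inner_vopp_l, E; ring. }
  apply vnorm_eq0 in Z; unfold vsub in Z.
  assert (Y : vopp y [+] y = v0) by exact (plus_opp_l y).
  transitivity (x [+] v0); [symmetry; exact (plus_zero_r x) |].
  rewrite <- Y; transitivity (x [+] vopp y [+] y); [exact (plus_assoc _ _ _) |].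
  rewrite Z; exact (plus_zero_l y).
Qed.

Ltac inner_expand :=
  unfold vsub;
  repeat first [rewrite inner_add_l | rewrite inner_vscal_l
               | rewrite inner_vopp_l | rewrite inner_v0_l].

Ltac vring := apply inner_ext; intro; inner_expand; ring.
Ltac vfield := apply inner_ext; intro; inner_expand; field.

Section HilbertBasics.
Context {H : Hilbert}.
Implicit Types x y z : H.

Lemma inner_add_r x y z : inner x (y [+] z) = inner x y + inner x z.
Proof. now rewrite inner_sym, inner_add_l, !(inner_sym _ x). Qed.

Lemma inner_vscal_r a x y : inner x (a [*] y) = a * inner x y.
Proof. now rewrite inner_sym, inner_vscal_l, inner_sym. Qed.

Lemma inner_vopp_r x y : inner x (vopp y) = - inner x y.
Proof. now rewrite inner_sym, inner_vopp_l, inner_sym. Qed.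

Lemma vnorm_scal (a : R) x : vnorm (a [*] x) = Rabs a * vnorm x.
Proof.
  unfold vnorm; rewrite !norm_inner, inner_vscal_l, inner_vscal_r, <- Rmult_assoc, sqrt_mult_alt.
  - now rewrite <- sqrt_Rsqr_abs.
  - apply Rle_0_sqr.
Qed.

Lemma vnorm_scal_pos (a : R) x : 0 <= a -> vnorm (a [*] x) = a * vnorm x.
Proof. intros; now rewrite vnorm_scal, Rabs_pos_eq. Qed.

Lemma vnorm_sub_sym x y : vnorm (x [-] y) = vnorm (y [-] x).
Proof. rewrite <- vnorm_opp; f_equal; vring. Qed.

Lemma vnorm_sub x y : vnorm (x [-] y) <= vnorm x + vnorm y.
Proof. rewrite <- (vnorm_opp _ y); apply vnorm_add. Qed.

Lemma vnorm_tri x y z : vnorm (x [-] z) <= vnorm (x [-] y) + vnorm (y [-] z).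
Proof.
  replace (x [-] z) with ((x [-] y) [+] (y [-] z)) by vring.
  apply vnorm_add.
Qed.

Lemma vnorm_le_sub x y : vnorm x <= vnorm y + vnorm (x [-] y).
Proof.
  replace x with (y [+] (x [-] y)) at 1 by vring; apply vnorm_add.
Qed.

Lemma vnorm_le0_eq x y : vnorm (x [-] y) <= 0 -> x = y.
Proof.
  intros E; assert (Z : vnorm (x [-] y) = 0) by (generalize (vnorm_ge0 _ (x [-] y)); lra).
  apply vnorm_eq0 in Z.
  replace x with ((x [-] y) [+] y) by vring; rewrite Z; vring.
Qed.

Lemma vnorm_small_eq x y : (forall eps, 0 < eps -> vnorm (x [-] y) <= eps) -> x = y.
Proof.
  intros E; apply vnorm_le0_eq, le_epsilon; intros e he; rewrite Rplus_0_l; auto.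
Qed.

Lemma cauchy_schwarz x y : Rabs (inner x y) <= vnorm x * vnorm y.
Proof.
  rewrite <- (Rabs_pos_eq (vnorm x * vnorm y))
    by (apply Rmult_le_pos; apply vnorm_ge0).
  apply Rsqr_le_abs_0.
  unfold Rsqr.
  replace (vnorm x * vnorm y * (vnorm x * vnorm y))
    with ((vnorm x * vnorm x) * (vnorm y * vnorm y)) by ring.
  rewrite !norm_sqr.
  set (c := inner x y); set (a := inner x x); set (b := inner y y).
  assert (P : forall s t : R, 0 <= s * s * a + 2 * s * t * c + t * t * b).
  { intros s t.
    replace (s * s * a + 2 * s * t * c + t * t * b)
      with (inner ((s [*] x) [+] (t [*] y)) ((s [*] x) [+] (t [*] y))).
    - apply inner_pos.
    - rewrite !inner_add_l, !inner_add_r, !inner_vscal_l, !inner_vscal_r.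
      rewrite (inner_sym _ y x); unfold a, b, c; ring. }
  assert (a0 : 0 <= a) by apply inner_pos.
  assert (b0 : 0 <= b) by apply inner_pos.
  destruct (Req_dec b 0) as [Eb | Nb].
  - rewrite Eb in P |- *.
    destruct (Req_dec c 0) as [-> | Nc]; [nra |].
    (* For b = 0 the form is affine in its second argument, and this argument gives it the value
       -1. *)
    assert (Pa := P 1 (- (a + 1) / (2 * c))).
    replace (1 * 1 * a + 2 * 1 * (- (a + 1) / (2 * c)) * c
      + - (a + 1) / (2 * c) * (- (a + 1) / (2 * c)) * 0) with (- 1) in Pa by (field; auto).
    lra.
  - assert (Pa := P b (- c)).
    assert (0 <= b * (a * b - c * c)) by nra.
    assert (0 < b) by lra.
    assert (0 <= a * b - c * c) by (apply (Rmult_le_reg_l b); lra). lra.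
Qed.

Lemma inner_le_norm x y : inner x y <= vnorm x * vnorm y.
Proof. eapply Rle_trans; [apply Rle_abs | apply cauchy_schwarz]. Qed.

End HilbertBasics.

(** * Right derivatives and the mean value inequality *)

Lemma pos_min (d d' : R) : 0 < d -> 0 < d' ->
  exists m, 0 < m /\ m <= d /\ m <= d'.
Proof.
  exists (Rmin d d'); repeat split; [apply Rmin_case; auto | apply Rmin_l | apply Rmin_r].
Qed.

(** The supremum of the [t] up to which [P] holds throughout satisfies [P] by the closure
    hypothesis, and cannot lie below [b] by the openness hypothesis. *)
Lemma real_induction (P : R -> Prop) (a b : R) :
  P a ->
  (forall t, a <= t < b -> P t -> exists d, 0 < d /\ forall s, t < s < t + d -> s <= b -> P s) ->
  (forall t, a < t <= b -> (forall s, a <= s < t -> P s) -> P t) ->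
  forall t, a <= t <= b -> P t.
Proof.
  intros Pa Pr Pl t0 ht0.
  set (E := fun t => a <= t <= b /\ forall s, a <= s <= t -> P s).
  assert (Ea : E a).
  { split; [lra |]; intros s hs; now replace s with a by lra. }
  destruct (completeness E) as [m [ub lub]].
  { exists b; intros t [ht _]; lra. }
  { now exists a. }
  assert (hm : a <= m <= b).
  { split; [now apply ub |]. apply lub; intros t [ht _]; lra. }
  assert (Pm' : forall s, a <= s < m -> P s).
  { intros s hs; apply NNPP; intros nP.
    assert (m <= s); [| lra].
    apply lub; intros t [ht Pt].
    destruct (Rle_dec t s); auto.
    destruct nP; apply Pt; lra. }
  assert (Em : E m).
  { split; auto; intros s hs.
    destruct (Req_dec s m) as [-> | ]; [| apply Pm'; lra].
    destruct (Req_dec m a) as [-> | ]; auto; apply Pl; auto; lra. }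
  destruct (Rlt_dec m b) as [hmb | ].
  - destruct (Pr m) as [d [hd Pd]]; [lra | apply Em; lra |].
    set (m' := Rmin b (m + d / 2)).
    assert (E m').
    { assert (m' <= b /\ m' <= m + d / 2) by (split; [apply Rmin_l | apply Rmin_r]).
      assert (m < m') by (apply Rmin_case; lra).
      split; [lra |]; intros s hs.
      destruct (Rle_dec s m); [apply Em; lra | apply Pd; lra]. }
    assert (m' <= m) by now apply ub.
    assert (m < m') by (unfold m'; apply Rmin_case; lra). lra.
  - apply Em; lra.
Qed.

Section Calculus.
Context {H : Hilbert}.
Implicit Types (f : R -> H) (D : R -> Prop) (G : R -> R).

Definition vcont D f t := forall e, 0 < e -> exists d, 0 < d /\
  forall s, D s -> Rabs (s - t) < d -> vnorm (f s [-] f t) <= e.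

Definition rcont D G t := forall e, 0 < e -> exists d, 0 < d /\
  forall s, D s -> Rabs (s - t) < d -> Rabs (G s - G t) <= e.

(** A derivative from the right only: at time t + h the semigroup law reduces everything to time t,
    whereas t - h would need separate arguments. Together with continuity of [f] this still suffices
    for the mean value inequality. *)
Definition rder f t (l : H) := forall e, 0 < e -> exists d, 0 < d /\
  forall h, 0 < h < d -> vnorm (f (t + h) [-] f t [-] (h [*] l)) <= e * h.

Definition rderR G t (l : R) := forall e, 0 < e -> exists d, 0 < d /\
  forall h, 0 < h < d -> Rabs (G (t + h) - G t - h * l) <= e * h.

Definition cc a b : R -> Prop := fun s => a <= s <= b.
Definition oc a b : R -> Prop := fun s => a < s <= b.
Definition oo a b : R -> Prop := fun s => a < s < b.

Lemma vcont_sub D D' f t : (forall s, D' s -> D s) -> vcont D f t -> vcont D' f t.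
Proof. intros i c e he; destruct (c e he) as [d [hd Hd]]; exists d; auto. Qed.

Lemma vcont_ext D f f' t : D t -> (forall s, D s -> f s = f' s) -> vcont D f t -> vcont D f' t.
Proof.
  intros Dt E c e he; destruct (c e he) as [d [hd Hd]]; exists d; split; auto.
  intros s hs h; rewrite <- !E; auto.
Qed.

Lemma vcont_local D D' f t r : 0 < r -> (forall s, D' s -> Rabs (s - t) < r -> D s) ->
  vcont D f t -> vcont D' f t.
Proof.
  intros hr i c e he; destruct (c e he) as [d [hd Hd]].
  destruct (pos_min d r) as [mu [hmu [? ?]]]; [lra | lra |]; exists mu; split; auto.
  intros s Ds hs.
  apply Hd; [apply i; auto; lra | lra].
Qed.

Lemma rcont_sub D D' G t : (forall s, D' s -> D s) -> rcont D G t -> rcont D' G t.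
Proof. intros i c e he; destruct (c e he) as [d [hd Hd]]; exists d; auto. Qed.

Lemma vcont_add D f g t : vcont D f t -> vcont D g t -> vcont D (fun s => f s [+] g s) t.
Proof.
  intros cf cg e he.
  destruct (cf (e / 2)) as [d [hd Hd]]; [lra |].
  destruct (cg (e / 2)) as [d' [hd' Hd']]; [lra |].
  destruct (pos_min d d') as [mu [hmu [? ?]]]; [lra | lra |]; exists mu; split; auto.
  intros s hs h.
  replace (f s [+] g s [-] (f t [+] g t)) with ((f s [-] f t) [+] (g s [-] g t)) by vring.
  eapply Rle_trans; [apply vnorm_add |].
  assert (vnorm (f s [-] f t) <= e / 2) by (apply Hd; auto; lra).
  assert (vnorm (g s [-] g t) <= e / 2) by (apply Hd'; auto; lra). lra.
Qed.

Lemma vcont_lip D f t (L : H -> H) C : 0 <= C ->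
  (forall x y, vnorm (L x [-] L y) <= C * vnorm (x [-] y)) ->
  vcont D f t -> vcont D (fun s => L (f s)) t.
Proof.
  intros hC hL c e he.
  destruct (c (e / (C + 1))) as [d [hd Hd]]; [apply Rdiv_lt_0_compat; lra |].
  exists d; split; auto; intros s Ds hs.
  eapply Rle_trans; [apply hL |].
  assert (A := Hd s Ds hs).
  apply Rle_trans with ((C + 1) * (e / (C + 1))).
  - apply Rmult_le_compat; auto using vnorm_ge0; lra.
  - right; field; lra.
Qed.

Lemma vcont_opp D f t : vcont D f t -> vcont D (fun s => vopp (f s)) t.
Proof.
  apply (vcont_lip D f t vopp 1); [lra |]; intros x y.
  replace (vopp x [-] vopp y) with (vopp (x [-] y)) by vring.
  rewrite vnorm_opp; lra.
Qed.

Lemma vcont_minus D f g t : vcont D f t -> vcont D g t -> vcont D (fun s => f s [-] g s) t.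
Proof. intros; apply vcont_add; auto; now apply vcont_opp. Qed.

Lemma vcont_const D x t : vcont D (fun _ => x) t.
Proof.
  intros e he; exists 1; split; [lra |]; intros s _ _.
  replace (x [-] x) with (v0 : H) by vring; rewrite vnorm_0; lra.
Qed.

Lemma vcont_scal D G f t : rcont D G t -> vcont D f t -> vcont D (fun s => G s [*] f s) t.
Proof.
  intros cG cf e he.
  set (A := Rabs (G t) + 1). set (B := vnorm (f t) + 1).
  assert (hA : 0 < A) by (unfold A; generalize (Rabs_pos (G t)); lra).
  assert (hB : 0 < B) by (unfold B; generalize (vnorm_ge0 _ (f t)); lra).
  destruct (cf (e / 2 / A)) as [d [hd Hd]]; [apply Rdiv_lt_0_compat; lra |].
  assert (he' : 0 < Rmin 1 (e / 2 / B)).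
  { apply Rmin_case; [lra | apply Rdiv_lt_0_compat; lra]. }
  destruct (cG _ he') as [d' [hd' Hd']].
  destruct (pos_min d d') as [mu [hmu [? ?]]]; [lra | lra |]; exists mu; split; auto.
  intros s hs h.
  assert (E1 : vnorm (f s [-] f t) <= e / 2 / A) by (apply Hd; auto; lra).
  assert (E2 : Rabs (G s - G t) <= Rmin 1 (e / 2 / B)) by (apply Hd'; auto; lra).
  assert (Rmin 1 (e / 2 / B) <= 1 /\ Rmin 1 (e / 2 / B) <= e / 2 / B)
    by (split; [apply Rmin_l | apply Rmin_r]).
  replace ((G s [*] f s) [-] (G t [*] f t))
    with ((G s [*] (f s [-] f t)) [+] ((G s - G t) [*] f t)) by vring.
  eapply Rle_trans; [apply vnorm_add |]; rewrite !vnorm_scal.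
  assert (Rabs (G s) <= A).
  { unfold A; replace (G s) with (G t + (G s - G t)) by ring.
    eapply Rle_trans; [apply Rabs_triang |]; lra. }
  assert (Rabs (G s) * vnorm (f s [-] f t) <= A * (e / 2 / A)).
  { apply Rmult_le_compat; auto using Rabs_pos, vnorm_ge0. }
  assert (Rabs (G s - G t) * vnorm (f t) <= (e / 2 / B) * B).
  { apply Rmult_le_compat; auto using Rabs_pos, vnorm_ge0; [lra | unfold B; lra]. }
  replace (A * (e / 2 / A)) with (e / 2) in * by (field; lra).
  replace (e / 2 / B * B) with (e / 2) in * by (field; lra). lra.
Qed.

Lemma rder_add f g t l k : rder f t l -> rder g t k -> rder (fun s => f s [+] g s) t (l [+] k).
Proof.
  intros cf cg e he.
  destruct (cf (e / 2)) as [d [hd Hd]]; [lra |].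
  destruct (cg (e / 2)) as [d' [hd' Hd']]; [lra |].
  destruct (pos_min d d') as [mu [hmu [? ?]]]; [lra | lra |]; exists mu; split; auto.
  intros h hh.
  assert (E1 := Hd h ltac:(lra)); assert (E2 := Hd' h ltac:(lra)).
  replace (f (t + h) [+] g (t + h) [-] (f t [+] g t) [-] (h [*] (l [+] k)))
    with ((f (t + h) [-] f t [-] (h [*] l)) [+] (g (t + h) [-] g t [-] (h [*] k))) by vring.
  eapply Rle_trans; [apply vnorm_add |]; lra.
Qed.

Definition lin (L : H -> H) :=
  (forall x y, L (x [+] y) = L x [+] L y) /\ (forall a x, L (a [*] x) = a [*] L x).

Lemma lin_sub L x y : lin L -> L (x [-] y) = L x [-] L y.
Proof.
  intros [la ls]; unfold vsub at 1.
  replace (vopp y) with ((-1) [*] y) by vring; rewrite la, ls; vring.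
Qed.

Lemma lin_0 L : lin L -> L v0 = v0.
Proof. intros h; replace (v0 : H) with (v0 [-] v0 : H) at 1 by vring; rewrite lin_sub; auto; vring. Qed.

Lemma lin_comb (L : H -> H) :
  (forall k x y, L (x [+] (k [*] y)) = L x [+] (k [*] L y)) -> lin L.
Proof.
  intros h; assert (h0 : L v0 = v0).
  { assert (E := h (-1) v0 v0); replace (v0 [+] ((-1) [*] v0)) with (v0 : H) in E by vring.
    rewrite E; vring. }
  split; intros.
  - replace (x [+] y) with (x [+] (1 [*] y)) by vring; rewrite h; vring.
  - replace (a [*] x) with (v0 [+] (a [*] x)) by vring; rewrite h, h0; vring.
Qed.

Definition bnd (L : H -> H) C := forall x, vnorm (L x) <= C * vnorm x.

Lemma rder_lin (L : H -> H) C f t l : lin L -> 0 <= C -> bnd L C ->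
  rder f t l -> rder (fun s => L (f s)) t (L l).
Proof.
  intros hL hC bL r e he.
  destruct (r (e / (C + 1))) as [d [hd Hd]]; [apply Rdiv_lt_0_compat; lra |].
  exists d; split; auto; intros h hh.
  assert (A := Hd h hh).
  rewrite <- (proj2 hL), <- !lin_sub by auto.
  eapply Rle_trans; [apply bL |].
  apply Rle_trans with ((C + 1) * (e / (C + 1) * h)).
  - apply Rmult_le_compat; auto using vnorm_ge0; lra.
  - right; field; lra.
Qed.

Lemma rder_opp f t l : rder f t l -> rder (fun s => vopp (f s)) t (vopp l).
Proof.
  apply (rder_lin vopp 1); [split; intros; vring | lra |].
  intros x; rewrite vnorm_opp; lra.
Qed.

Lemma rder_sub f g t l k : rder f t l -> rder g t k -> rder (fun s => f s [-] g s) t (l [-] k).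
Proof. intros; apply rder_add; auto; now apply rder_opp. Qed.

Lemma rder_const x t : rder (fun _ => x) t v0.
Proof.
  intros e he; exists 1; split; [lra |]; intros h hh.
  replace (x [-] x [-] (h [*] v0)) with (v0 : H) by vring; rewrite vnorm_0; nra.
Qed.

Lemma rder_ext_loc f g t l r : 0 < r -> (forall s, t <= s < t + r -> f s = g s) ->
  rder f t l -> rder g t l.
Proof.
  intros hr E c e he; destruct (c e he) as [d [hd Hd]].
  destruct (pos_min d r) as [mu [hmu [? ?]]]; [lra | lra |]; exists mu; split; auto.
  intros h hh.
  rewrite <- !E by lra; apply Hd; lra.
Qed.

(** Real induction on the inequality with an additional slack e (t - c), which absorbs the error of
    the right difference quotients. It starts at some c > a because the local hypothesis holds only
    inside the interval; then e tends to 0 and c tends to a by continuity. *)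
Lemma mean_value f G a b : a <= b ->
  (forall t, cc a b t -> vcont (cc a b) f t) ->
  (forall t, cc a b t -> rcont (cc a b) G t) ->
  (forall t, a < t < b -> forall e, 0 < e -> exists d, 0 < d /\
     forall h, 0 < h < d -> vnorm (f (t + h) [-] f t) <= G (t + h) - G t + e * h) ->
  vnorm (f b [-] f a) <= G b - G a.
Proof.
  intros hab cf cG hd.
  destruct (Req_dec a b) as [-> | nab].
  { replace (f b [-] f b) with (v0 : H) by vring; rewrite vnorm_0; lra. }
  assert (S1 : forall c e, 0 < e -> a < c <= b ->
     vnorm (f b [-] f c) <= G b - G c + e * (b - c)).
  { intros c e he hc.
    apply (real_induction (fun t => vnorm (f t [-] f c) <= G t - G c + e * (t - c)) c b);
      [| | | lra].
    - replace (f c [-] f c) with (v0 : H) by vring; rewrite vnorm_0; lra.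
    - intros t ht Pt.
      destruct (hd t ltac:(lra) e he) as [d [hd0 Hd]].
      exists d; split; auto; intros s hs hsb.
      assert (A := Hd (s - t) ltac:(lra)).
      replace (t + (s - t)) with s in A by ring.
      assert (B := vnorm_tri (f s) (f t) (f c)). lra.
    - intros t ht Pt; apply le_epsilon; intros e' he'.
      destruct (cf t) with (e := e' / 2) as [d1 [hd1 H1]]; [unfold cc; lra | lra |].
      destruct (cG t) with (e := e' / 2) as [d2 [hd2 H2]]; [unfold cc; lra | lra |].
      set (s := Rmax c (t - Rmin d1 d2 / 2)).
      assert (Rmin d1 d2 <= d1 /\ Rmin d1 d2 <= d2) by (split; [apply Rmin_l | apply Rmin_r]).
      assert (0 < Rmin d1 d2) by (apply Rmin_case; lra).
      assert (hs : c <= s < t /\ t - Rmin d1 d2 / 2 <= s).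
      { unfold s; split; [split |]; [apply Rmax_l | | apply Rmax_r].
        apply Rmax_case; lra. }
      assert (hst : Rabs (s - t) < d1 /\ Rabs (s - t) < d2).
      { rewrite Rabs_left by lra; lra. }
      assert (A1 := H1 s ltac:(unfold cc; lra) (proj1 hst)).
      assert (A2 := H2 s ltac:(unfold cc; lra) (proj2 hst)).
      apply Rabs_le_between in A2.
      assert (B := vnorm_tri (f t) (f s) (f c)).
      rewrite (vnorm_sub_sym (f t) (f s)) in B.
      assert (Ps := Pt s ltac:(lra)).
      assert (e * (s - c) <= e * (t - c)) by (apply Rmult_le_compat_l; lra). lra. }
  assert (S2 : forall c, a < c <= b -> vnorm (f b [-] f c) <= G b - G c).
  { intros c hc; apply le_epsilon; intros e he.
    assert (A := S1 c (e / (b - a)) ltac:(apply Rdiv_lt_0_compat; lra) hc).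
    assert (e / (b - a) * (b - c) <= e / (b - a) * (b - a)).
    { apply Rmult_le_compat_l; [| lra]. left; apply Rdiv_lt_0_compat; lra. }
    replace (e / (b - a) * (b - a)) with e in * by (field; lra). lra. }
  apply le_epsilon; intros e he.
  destruct (cf a) with (e := e / 2) as [d1 [hd1 H1]]; [unfold cc; lra | lra |].
  destruct (cG a) with (e := e / 2) as [d2 [hd2 H2]]; [unfold cc; lra | lra |].
  set (s := Rmin b (a + Rmin d1 d2 / 2)).
  assert (Rmin d1 d2 <= d1 /\ Rmin d1 d2 <= d2) by (split; [apply Rmin_l | apply Rmin_r]).
  assert (0 < Rmin d1 d2) by (apply Rmin_case; lra).
  assert (hs : a < s <= b /\ s <= a + Rmin d1 d2 / 2).
  { unfold s; split; [split |]; [apply Rmin_case; lra | apply Rmin_l | apply Rmin_r]. }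
  assert (hst : Rabs (s - a) < d1 /\ Rabs (s - a) < d2).
  { rewrite Rabs_pos_eq by lra; lra. }
  assert (A1 := H1 s ltac:(unfold cc; lra) (proj1 hst)).
  assert (A2 := H2 s ltac:(unfold cc; lra) (proj2 hst)).
  apply Rabs_le_between in A2.
  assert (B := vnorm_tri (f b) (f s) (f a)).
  assert (Ps := S2 s ltac:(lra)). lra.
Qed.

Lemma mean_value_rder f f' G g a b : a <= b ->
  (forall t, cc a b t -> vcont (cc a b) f t) ->
  (forall t, cc a b t -> rcont (cc a b) G t) ->
  (forall t, oo a b t -> rder f t (f' t)) ->
  (forall t, oo a b t -> rderR G t (g t)) ->
  (forall t, oo a b t -> vnorm (f' t) <= g t) ->
  vnorm (f b [-] f a) <= G b - G a.
Proof.
  intros hab cf cG df dG le; apply mean_value; auto.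
  intros t ht e he.
  destruct (df t ht (e / 2)) as [d [hd Hd]]; [lra |].
  destruct (dG t ht (e / 2)) as [d' [hd' Hd']]; [lra |].
  destruct (pos_min d d') as [mu [hmu [? ?]]]; [lra | lra |]; exists mu; split; auto.
  intros h hh.
  assert (E1 := Hd h ltac:(lra)); assert (E2 := Hd' h ltac:(lra)).
  apply Rabs_le_between in E2.
  assert (B := vnorm_le_sub (f (t + h) [-] f t) (h [*] f' t)).
  rewrite vnorm_scal_pos in B by lra.
  assert (h * vnorm (f' t) <= h * g t) by (apply Rmult_le_compat_l; auto; lra).
  lra.
Qed.

Lemma rcont_affine D c k t : rcont D (fun s => c * s + k) t.
Proof.
  intros e he; exists (e / (Rabs c + 1)).
  assert (0 < Rabs c + 1) by (generalize (Rabs_pos c); lra).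
  split; [apply Rdiv_lt_0_compat; lra |].
  intros s _ hs; replace (c * s + k - (c * t + k)) with (c * (s - t)) by ring.
  rewrite Rabs_mult.
  apply Rle_trans with ((Rabs c + 1) * (e / (Rabs c + 1))).
  - apply Rmult_le_compat; try apply Rabs_pos; lra.
  - right; field; lra.
Qed.

Lemma rderR_affine c k t : rderR (fun s => c * s + k) t c.
Proof.
  intros e he; exists 1; split; [lra |]; intros h hh.
  replace (c * (t + h) + k - (c * t + k) - h * c) with 0 by ring.
  rewrite Rabs_R0; nra.
Qed.

Lemma rder_line x t : rder (fun s => s [*] x) t x.
Proof.
  intros e he; exists 1; split; [lra |]; intros h hh.
  replace (((t + h) [*] x) [-] (t [*] x) [-] (h [*] x)) with (v0 : H) by vring.
  rewrite vnorm_0; nra.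
Qed.

Lemma vcont_line D x t : vcont D (fun s => s [*] x) t.
Proof.
  apply vcont_scal; [| apply vcont_const].
  intros e he; exists e; split; auto; intros; lra.
Qed.

Lemma mean_value_lin f f' l M a b : a <= b ->
  (forall t, cc a b t -> vcont (cc a b) f t) ->
  (forall t, oo a b t -> rder f t (f' t)) ->
  (forall t, oo a b t -> vnorm (f' t [-] l) <= M) ->
  vnorm (f b [-] f a [-] ((b - a) [*] l)) <= M * (b - a).
Proof.
  intros hab cf df le.
  replace (f b [-] f a [-] ((b - a) [*] l))
    with ((f b [-] (b [*] l)) [-] (f a [-] (a [*] l))) by vring.
  replace (M * (b - a)) with ((M * b + 0) - (M * a + 0)) by ring.
  apply (mean_value_rder (fun s => f s [-] (s [*] l)) (fun s => f' s [-] l)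
           (fun s => M * s + 0) (fun _ => M)); auto.
  - intros t ht; apply vcont_minus; auto; apply vcont_line.
  - intros; apply rcont_affine.
  - intros t ht; apply rder_sub; auto; apply rder_line.
  - intros; apply rderR_affine.
Qed.

(** The mean value inequality for the zero function, whose increment is dominated by that of any [G]
    with nonnegative derivative. *)
Lemma monotone_rder G g a b : a <= b ->
  (forall t, cc a b t -> rcont (cc a b) G t) ->
  (forall t, oo a b t -> rderR G t (g t)) ->
  (forall t, oo a b t -> 0 <= g t) -> G a <= G b.
Proof.
  intros hab cG dG g0.
  assert (A := mean_value_rder (fun _ => v0 : H) (fun _ => v0) G g a b hab).
  assert (vnorm ((v0 : H) [-] v0) <= G b - G a).
  { apply A; auto.
    - intros; apply vcont_const.
    - intros; apply rder_const.
    - intros; rewrite vnorm_0; auto. }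
  assert (B := vnorm_ge0 _ ((v0 : H) [-] v0)). lra.
Qed.

Lemma zero_rder f a b : a <= b ->
  (forall t, cc a b t -> vcont (cc a b) f t) ->
  (forall t, oo a b t -> rder f t v0) -> f b = f a.
Proof.
  intros hab cf df; apply vnorm_le0_eq.
  replace 0 with ((0 * b + 0) - (0 * a + 0)) by ring.
  apply (mean_value_rder f (fun _ => v0) (fun s => 0 * s + 0) (fun _ => 0)); auto.
  - intros; apply rcont_affine.
  - intros; apply rderR_affine.
  - intros; rewrite vnorm_0; lra.
Qed.

(** On each side of [t], [f] is compared with the line of fixed slope [f' t]; continuity of [f']
    keeps the deviation of the slopes below [e]. *)
Lemma two_sided_rder f f' a b t :
  (forall s, cc a b s -> vcont (cc a b) f s) ->
  (forall s, oo a b s -> rder f s (f' s)) ->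
  cc a b t -> vcont (cc a b) f' t ->
  forall e, 0 < e -> exists d, 0 < d /\ forall s, cc a b s -> Rabs (s - t) < d ->
    vnorm (f s [-] f t [-] ((s - t) [*] f' t)) <= e * Rabs (s - t).
Proof.
  intros cf df ht cf' e he.
  destruct (cf' e he) as [d [hd Hd]].
  exists d; split; auto; intros s hs hst; unfold cc in *.
  destruct (Rle_dec t s) as [hts | hts].
  - rewrite Rabs_pos_eq in * by lra.
    apply (mean_value_lin f f'); auto.
    + intros r hr; apply (vcont_sub (cc a b)); [unfold cc in *; intros; lra |].
      apply cf; unfold cc in *; lra.
    + intros r hr; apply df; unfold oo in *; lra.
    + intros r hr; unfold oo in *; apply Hd; [lra |]. rewrite Rabs_pos_eq; lra.
  - rewrite Rabs_left in * by lra.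
    replace (f s [-] f t [-] ((s - t) [*] f' t))
      with (vopp (f t [-] f s [-] ((t - s) [*] f' t))) by vring.
    rewrite vnorm_opp.
    replace (- (s - t)) with (t - s) by ring.
    apply (mean_value_lin f f'); auto; [lra | | |].
    + intros r hr; apply (vcont_sub (cc a b)); [unfold cc in *; intros; lra |].
      apply cf; unfold cc in *; lra.
    + intros r hr; apply df; unfold oo in *; lra.
    + intros r hr; unfold oo in *; apply Hd; [lra |]. rewrite Rabs_left; lra.
Qed.

(** Stated for an arbitrary proper filter so that limits of sequences and limits from the right are
    both instances. *)
Lemma vcomplete {T : Type} (F : (T -> Prop) -> Prop) {FF : ProperFilter F} (f : T -> H) :
  (forall e, 0 < e -> exists P, F P /\ forall u v, P u -> P v -> vnorm (f u [-] f v) <= e) ->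
  exists l, forall e, 0 < e -> F (fun u => vnorm (f u [-] l) <= e).
Proof.
  intros h.
  assert (E : exists l, filterlim f F (locally l)).
  { refine (proj1 (filterlim_locally_cauchy (F := F) (f : T -> hspace H)) _); intros e.
    destruct (h (e / 2)) as [P [FP hP]]; [destruct e; simpl; lra |].
    exists P; split; auto; intros u v Pu Pv.
    apply (norm_compat1 (V := H)).
    assert (A := hP v u Pv Pu). change (norm (minus (f v) (f u))) with (vnorm (f v [-] f u)).
    destruct e; simpl in *; lra. }
  destruct E as [l Hl]; exists l; intros e he.
  assert (A := proj1 (filterlim_locally_ball_norm (F := F) f l) Hl (mkposreal e he)).
  revert A; apply filter_imp; intros u hu; left; exact hu.
Qed.

Lemma vlim_seq (x : nat -> H) :
  (forall e, 0 < e -> exists N, forall n m, (N <= n)%nat -> (N <= m)%nat ->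
     vnorm (x n [-] x m) <= e) ->
  exists l, forall e, 0 < e -> exists N, forall n, (N <= n)%nat -> vnorm (x n [-] l) <= e.
Proof.
  intros h; destruct (vcomplete eventually x) as [l Hl]; [| now exists l].
  intros e he; destruct (h e he) as [N HN].
  exists (fun n => (N <= n)%nat); split; auto; now exists N.
Qed.

Lemma vlim_right (f : R -> H) :
  (forall e, 0 < e -> exists d, 0 < d /\ forall h k, 0 < h < d -> 0 < k < d ->
     vnorm (f h [-] f k) <= e) ->
  exists l, forall e, 0 < e -> exists d, 0 < d /\ forall h, 0 < h < d ->
     vnorm (f h [-] l) <= e.
Proof.
  assert (I : forall h d, 0 < h < d -> ball 0 d h).
  { intros h d hh; change (Rabs (h - 0) < d); rewrite Rabs_pos_eq; lra. }
  intros h; destruct (vcomplete (at_right 0) f) as [l Hl].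
  - intros e he; destruct (h e he) as [d [hd Hd]].
    exists (fun h => 0 < h < d); split.
    + exists (mkposreal d hd); intros y hy hy0; split; auto.
      change (Rabs (y - 0) < d) in hy; rewrite Rabs_pos_eq in hy; lra.
    + intros; apply Hd; auto.
  - exists l; intros e he; destruct (Hl e he) as [d Hd].
    exists d; split; [apply cond_pos |]; intros k hk; apply Hd; [now apply I | lra].
Qed.

End Calculus.

(** * Powers and Newton integrals *)

(* [Rpower] takes the value 1 at 0; [rp] is continuous at 0 for [a > 0]. *)
Definition rp (t a : R) : R := if Rlt_dec 0 t then Rpower t a else 0.

Lemma rp_eq t a : 0 < t -> rp t a = Rpower t a.
Proof. intros; unfold rp; now destruct (Rlt_dec 0 t). Qed.

Lemma rp_pos t a : 0 < t -> 0 < rp t a.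
Proof. intros; rewrite rp_eq by auto; apply exp_pos. Qed.

Lemma rp_ge0 t a : 0 <= rp t a.
Proof. unfold rp; destruct (Rlt_dec 0 t); [left; apply exp_pos | lra]. Qed.

Lemma rp_zero a : rp 0 a = 0.
Proof. unfold rp; destruct (Rlt_dec 0 0); lra. Qed.

Lemma rp_add t a b : 0 < t -> rp t (a + b) = rp t a * rp t b.
Proof. intros; rewrite !rp_eq by auto; apply Rpower_plus. Qed.

Lemma rp_1 t : 0 < t -> rp t 1 = t.
Proof. intros; rewrite rp_eq by auto; now apply Rpower_1. Qed.

Lemma rp_0 t : 0 < t -> rp t 0 = 1.
Proof. intros; rewrite rp_eq by auto; now apply Rpower_O. Qed.

Lemma rp_mult s t a : 0 < s -> 0 < t -> rp (s * t) a = rp s a * rp t a.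
Proof.
  intros; rewrite !rp_eq by (auto using Rmult_lt_0_compat).
  now rewrite Rpower_mult_distr.
Qed.

Lemma rp_incr s t a : 0 < s <= t -> 0 <= a -> rp s a <= rp t a.
Proof. intros; rewrite !rp_eq by lra; apply Rle_Rpower_l; lra. Qed.

Lemma rp_opp t a : 0 < t -> rp t (- a) = / rp t a.
Proof. intros; rewrite !rp_eq by auto; apply Rpower_Ropp. Qed.

Lemma rp_decr s t a : 0 < s <= t -> a <= 0 -> rp t a <= rp s a.
Proof.
  intros; replace a with (- - a) by ring; rewrite (rp_opp t (- a)), (rp_opp s (- a)) by lra.
  apply Rinv_le_contravar; [apply rp_pos; lra | apply rp_incr; lra].
Qed.

Lemma derivable_rp a t : 0 < t -> derivable_pt_lim (fun s => rp s a) t (a * rp t (a - 1)).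
Proof.
  intros ht; rewrite rp_eq by auto.
  intros e he; destruct (derivable_pt_lim_power t a ht e he) as [d Hd].
  assert (hd : 0 < Rmin d t) by (apply Rmin_case; [apply cond_pos | auto]).
  exists (mkposreal _ hd); intros h hn hh; simpl in hh.
  assert (Rmin d t <= d /\ Rmin d t <= t) by (split; [apply Rmin_l | apply Rmin_r]).
  assert (0 < t + h) by (apply Rabs_def2 in hh; lra).
  rewrite !rp_eq by auto; apply Hd; auto; lra.
Qed.

Lemma rp_lip s t a : 0 < s <= t -> a <= 1 ->
  Rabs (rp t a - rp s a) <= Rabs a * rp s (a - 1) * (t - s).
Proof.
  intros hs ha; destruct (Req_dec s t) as [-> | ne].
  { rewrite !Rminus_diag, Rabs_R0; lra. }
  destruct (MVT_cor2 (fun s => rp s a) (fun t => a * rp t (a - 1)) s t) as [c [E hc]];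
    [lra | intros; apply derivable_rp; lra |].
  rewrite E, !Rabs_mult, (Rabs_pos_eq (t - s)), (Rabs_pos_eq (rp c _)) by (try apply rp_ge0; lra).
  apply Rmult_le_compat_r; [lra |]; apply Rmult_le_compat_l; [apply Rabs_pos |].
  apply rp_decr; lra.
Qed.

Lemma rcont_of_continuity D G t : continuity_pt G t -> rcont D G t.
Proof.
  intros c e he; destruct (c e he) as [d [hd Hd]]; exists d; split; auto.
  intros s _ hs; destruct (Req_dec s t) as [-> | ne].
  - rewrite Rminus_diag, Rabs_R0; lra.
  - left; apply (Hd s); split; [split; [exact I | auto] | exact hs].
Qed.

Lemma rderR_of_derivable G t l : derivable_pt_lim G t l -> rderR G t l.
Proof.
  intros D e he; destruct (D e he) as [d Hd]; exists d; split; [apply cond_pos |].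
  intros h hh; assert (A := Hd h ltac:(lra) ltac:(rewrite Rabs_pos_eq; lra)).
  replace (G (t + h) - G t - h * l) with (((G (t + h) - G t) / h - l) * h) by (field; lra).
  rewrite Rabs_mult, (Rabs_pos_eq h) by lra.
  apply Rmult_le_compat_r; lra.
Qed.

Lemma rcont_rp_pos D a t : 0 < t -> rcont D (fun s => rp s a) t.
Proof.
  intros ht; apply rcont_of_continuity, derivable_continuous_pt.
  exists (a * rp t (a - 1)); now apply derivable_rp.
Qed.

Lemma rcont_rp D a t : 0 < a -> 0 <= t -> rcont D (fun s => rp s a) t.
Proof.
  intros ha ht; destruct (Req_dec t 0) as [-> | nt]; [| apply rcont_rp_pos; lra].
  intros e he; exists (rp e (/ a)); split; [now apply rp_pos |].
  intros s _ hs; rewrite Rminus_0_r in hs.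
  rewrite rp_zero, Rminus_0_r, Rabs_pos_eq by apply rp_ge0.
  unfold rp at 1; destruct (Rlt_dec 0 s) as [h | h]; [| lra].
  rewrite <- rp_eq by auto.
  apply Rle_trans with (rp (rp e (/ a)) a).
  - apply rp_incr; [| lra]. rewrite Rabs_pos_eq in hs; lra.
  - rewrite (rp_eq _ a) by now apply rp_pos.
    rewrite rp_eq, Rpower_mult, Rinv_l, Rpower_1 by lra; lra.
Qed.

Lemma rcont_reflect D G c t :
  rcont (fun _ => True) G (c - t) -> rcont D (fun s => G (c - s)) t.
Proof.
  intros cG e he; destruct (cG e he) as [d [hd Hd]]; exists d; split; auto.
  intros s _ hs; apply Hd; auto.
  replace (c - s - (c - t)) with (- (s - t)) by ring; now rewrite Rabs_Ropp.
Qed.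

Lemma rcont_lincomb D F G A B t : rcont D F t -> rcont D G t ->
  rcont D (fun s => A * F s - B * G s) t.
Proof.
  intros cF cG e he.
  assert (hA : 0 < Rabs A + 1) by (generalize (Rabs_pos A); lra).
  assert (hB : 0 < Rabs B + 1) by (generalize (Rabs_pos B); lra).
  destruct (cF (e / 2 / (Rabs A + 1))) as [d [hd Hd]]; [apply Rdiv_lt_0_compat; lra |].
  destruct (cG (e / 2 / (Rabs B + 1))) as [d' [hd' Hd']]; [apply Rdiv_lt_0_compat; lra |].
  destruct (pos_min d d') as [mu [hmu [? ?]]]; [lra | lra |]; exists mu; split; auto.
  intros s hs h.
  assert (E1 := Hd s hs ltac:(lra)); assert (E2 := Hd' s hs ltac:(lra)).
  replace (A * F s - B * G s - (A * F t - B * G t))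
    with (A * (F s - F t) + - (B * (G s - G t))) by ring.
  eapply Rle_trans; [apply Rabs_triang |]; rewrite Rabs_Ropp, !Rabs_mult.
  assert (Rabs A * Rabs (F s - F t) <= (Rabs A + 1) * (e / 2 / (Rabs A + 1)))
    by (apply Rmult_le_compat; try apply Rabs_pos; lra).
  assert (Rabs B * Rabs (G s - G t) <= (Rabs B + 1) * (e / 2 / (Rabs B + 1)))
    by (apply Rmult_le_compat; try apply Rabs_pos; lra).
  replace ((Rabs A + 1) * (e / 2 / (Rabs A + 1))) with (e / 2) in * by (field; lra).
  replace ((Rabs B + 1) * (e / 2 / (Rabs B + 1))) with (e / 2) in * by (field; lra). lra.
Qed.

(* Primitive of [A s^(a-1) + B (c-s)^(b-1)], the majorant of a convolution
   whose two factors are singular at 0. *)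
Definition beta_prim A a B b c s := A / a * rp s a - B / b * rp (c - s) b.

Lemma beta_prim_cont D A a B b c t : 0 < a -> 0 < b -> 0 <= t <= c ->
  rcont D (beta_prim A a B b c) t.
Proof.
  intros ha hb ht; apply rcont_lincomb; [apply rcont_rp; lra |].
  apply (rcont_reflect D (fun s => rp s b)), rcont_rp; lra.
Qed.

Lemma beta_prim_der A a B b c t : a <> 0 -> b <> 0 -> 0 < t < c ->
  rderR (beta_prim A a B b c) t (A * rp t (a - 1) + B * rp (c - t) (b - 1)).
Proof.
  intros ha hb ht; apply rderR_of_derivable.
  replace (A * rp t (a - 1) + B * rp (c - t) (b - 1))
    with (A / a * (a * rp t (a - 1)) - B / b * (b * rp (c - t) (b - 1) * (0 - 1)))
    by (field; auto).
  apply (derivable_pt_lim_minus (fun s => A / a * rp s a) (fun s => B / b * rp (c - s) b)).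
  - apply (derivable_pt_lim_scal (fun s => rp s a)); apply derivable_rp; lra.
  - apply (derivable_pt_lim_scal (fun s => rp (c - s) b)).
    apply (derivable_pt_lim_comp (fun s => c - s) (fun s => rp s b)).
    + apply (derivable_pt_lim_minus (fun _ => c) (fun s => s)).
      * apply derivable_pt_lim_const.
      * apply derivable_pt_lim_id.
    + apply derivable_rp; lra.
Qed.

(** One of [s] and [t - s] is at least t/2, and its nonpositive power is bounded by that of t/2; the
    sum covers both cases. The product of two singular powers is thus replaced by a sum with an
    elementary primitive. *)
Lemma rp_prod_le s t a b : 0 < s < t -> a <= 1 -> b <= 1 ->
  rp s (a - 1) * rp (t - s) (b - 1)
    <= rp (t / 2) (b - 1) * rp s (a - 1) + rp (t / 2) (a - 1) * rp (t - s) (b - 1).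
Proof.
  intros hs ha hb.
  assert (0 <= rp (t / 2) (b - 1) * rp s (a - 1)) by (apply Rmult_le_pos; apply rp_ge0).
  assert (0 <= rp (t / 2) (a - 1) * rp (t - s) (b - 1)) by (apply Rmult_le_pos; apply rp_ge0).
  destruct (Rle_dec s (t / 2)).
  - assert (rp (t - s) (b - 1) <= rp (t / 2) (b - 1)) by (apply rp_decr; lra).
    assert (rp s (a - 1) * rp (t - s) (b - 1) <= rp s (a - 1) * rp (t / 2) (b - 1))
      by (apply Rmult_le_compat_l; auto; apply rp_ge0). lra.
  - assert (rp s (a - 1) <= rp (t / 2) (a - 1)) by (apply rp_decr; lra).
    assert (rp s (a - 1) * rp (t - s) (b - 1) <= rp (t / 2) (a - 1) * rp (t - s) (b - 1))
      by (apply Rmult_le_compat_r; auto; apply rp_ge0). lra.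
Qed.

(** The tube lemma: a neighbourhood of [t0] that may depend on [s] becomes uniform over the compact
    interval. Real induction on the right end point replaces a finite subcover. *)
Lemma compact_uniform (Q : R -> R -> Prop) (D : R -> Prop) (t0 a b : R) :
  (forall s, a <= s <= b -> exists d, 0 < d /\ forall t s', D t -> Rabs (t - t0) < d ->
     Rabs (s' - s) < d -> a <= s' <= b -> Q t s') ->
  exists d, 0 < d /\ forall t s, D t -> Rabs (t - t0) < d -> a <= s <= b -> Q t s.
Proof.
  intros hQ.
  destruct (Rle_dec a b) as [hab |]; [| exists 1; split; [lra |]; intros; lra].
  apply (real_induction (fun r => exists d, 0 < d /\ forall t s, D t -> Rabs (t - t0) < d ->
    a <= s <= r -> Q t s) a b); [| | | lra].
  - destruct (hQ a) as [d [hd Hd]]; [lra |]; exists d; split; auto.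
    intros t s Dt ht hs; apply Hd; auto; [rewrite Rabs_pos_eq; lra | lra].
  - intros r hr [d [hd Hd]]; destruct (hQ r) as [d' [hd' Hd']]; [lra |].
    exists d'; split; auto; intros r' hr' hb.
    destruct (pos_min d d') as [mu [hmu [? ?]]]; [lra | lra |]; exists mu; split; auto.
    intros t s Dt ht hs; destruct (Rle_dec s r).
    + apply Hd; auto; lra.
    + apply Hd'; auto; [lra | rewrite Rabs_pos_eq; lra | lra].
  - intros r hr IH; destruct (hQ r) as [d' [hd' Hd']]; [lra |].
    (* The induction hypothesis covers [a, r'], and what remains up to [r] lies within the local
       radius [d'] of [r]. *)
    set (r' := Rmax a (r - d' / 2)).
    assert (hr' : a <= r' < r /\ r - d' / 2 <= r').
    { unfold r'; split; [split |]; [apply Rmax_l | | apply Rmax_r]. apply Rmax_case; lra. }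
    destruct (IH r') as [d [hd Hd]]; [lra |].
    destruct (pos_min d d') as [mu [hmu [? ?]]]; [lra | lra |]; exists mu; split; auto.
    intros t s Dt ht hs; destruct (Rle_dec s r').
    + apply Hd; auto; lra.
    + apply Hd'; auto; [lra | | lra].
      destruct (Req_dec s r) as [-> | ]; [rewrite Rminus_diag, Rabs_R0; lra |].
      rewrite Rabs_left; lra.
Qed.

Section Newton.
Context {H : Hilbert}.
Implicit Types (f q : R -> H) (D : R -> Prop) (G : R -> R).

(** An instance of [compact_uniform] in which the parameter [t] near 0 encodes the candidate bound
    1/t. *)
Lemma vcont_bounded f a b : (forall t, cc a b t -> vcont (cc a b) f t) ->
  exists M, 0 < M /\ forall t, cc a b t -> vnorm (f t) <= M.
Proof.
  intros cf.
  destruct (compact_uniform (fun t s => vnorm (f s) <= / t) (fun t => 0 < t) 0 a b)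
    as [d [hd Hd]].
  - intros s hs; destruct (cf s hs 1) as [d [hd Hd]]; [lra |].
    assert (0 < vnorm (f s) + 1) by (generalize (vnorm_ge0 _ (f s)); lra).
    exists (Rmin d (/ (vnorm (f s) + 1))); split.
    { apply Rmin_case; auto; now apply Rinv_0_lt_compat. }
    set (m := Rmin _ _).
    assert (m <= d /\ m <= / (vnorm (f s) + 1)) by (split; [apply Rmin_l | apply Rmin_r]).
    intros t s' ht htt hss hs'.
    assert (A := Hd s' hs' ltac:(lra)).
    assert (B := vnorm_le_sub (f s') (f s)).
    rewrite Rminus_0_r, Rabs_pos_eq in htt by lra.
    apply Rle_trans with (vnorm (f s) + 1); [lra |].
    rewrite <- (Rinv_inv (vnorm (f s) + 1)).
    apply Rinv_le_contravar; lra.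
  - exists (/ (d / 2)); split; [apply Rinv_0_lt_compat; lra |].
    intros t ht; apply (Hd (d / 2) t); auto; [lra | rewrite Rminus_0_r, Rabs_pos_eq; lra].
Qed.

(* Newton integral: [F] is continuous up to the end points, [q] need not be
   bounded there. *)
Definition NI q a b (I : H) := exists F, (forall t, cc a b t -> vcont (cc a b) F t) /\
  (forall t, oo a b t -> rder F t (q t)) /\ F b [-] F a = I.

Lemma NI_unique q a b I J : a <= b -> NI q a b I -> NI q a b J -> I = J.
Proof.
  intros hab [F [cF [dF <-]]] [G [cG [dG <-]]].
  assert (E : F b [-] G b = F a [-] G a).
  { apply (zero_rder (fun s => F s [-] G s) a b hab).
    - intros; apply vcont_minus; auto.
    - intros t ht; replace (v0 : H) with (q t [-] q t) by vring; apply rder_sub; auto. }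
  replace (F b) with ((F b [-] G b) [+] G b) by vring; rewrite E; vring.
Qed.

Lemma NI_bound q g G a b I : a <= b ->
  (forall t, cc a b t -> rcont (cc a b) G t) ->
  (forall t, oo a b t -> rderR G t (g t)) ->
  (forall t, oo a b t -> vnorm (q t) <= g t) ->
  NI q a b I -> vnorm I <= G b - G a.
Proof. intros hab cG dG le [F [cF [dF <-]]]; now apply (mean_value_rder F q G g). Qed.

Lemma NI_near q l M a b I : a <= b -> (forall t, oo a b t -> vnorm (q t [-] l) <= M) ->
  NI q a b I -> vnorm (I [-] ((b - a) [*] l)) <= M * (b - a).
Proof. intros hab le [F [cF [dF <-]]]; now apply (mean_value_lin F q). Qed.

Lemma NI_ext q q' a b I : (forall t, oo a b t -> q t = q' t) -> NI q a b I -> NI q' a b I.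
Proof. intros E [F [cF [dF eF]]]; exists F; repeat split; auto; intros; rewrite <- E; auto. Qed.

Lemma NI_add q q' a b I I' : NI q a b I -> NI q' a b I' ->
  NI (fun t => q t [+] q' t) a b (I [+] I').
Proof.
  intros [F [cF [dF <-]]] [G [cG [dG <-]]]; exists (fun s => F s [+] G s); repeat split.
  - intros; apply vcont_add; auto.
  - intros; apply rder_add; auto.
  - vring.
Qed.

Lemma lin_lip (L : H -> H) C : lin L -> bnd L C ->
  forall x y, vnorm (L x [-] L y) <= C * vnorm (x [-] y).
Proof. intros hL bL x y; rewrite <- lin_sub; auto. Qed.

Lemma NI_lin (L : H -> H) C q a b I : lin L -> 0 <= C -> bnd L C -> NI q a b I ->
  NI (fun t => L (q t)) a b (L I).
Proof.
  intros hL hC bL [F [cF [dF <-]]]; exists (fun s => L (F s)); repeat split.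
  - intros; apply (vcont_lip _ _ _ _ C); auto; now apply lin_lip.
  - intros; apply (rder_lin _ C); auto.
  - now rewrite lin_sub.
Qed.

Lemma NI_scal c q a b I : NI q a b I -> NI (fun t => c [*] q t) a b (c [*] I).
Proof.
  apply (NI_lin (vscal c) (Rabs c)); [split; intros; vring | apply Rabs_pos |].
  intros x; rewrite vnorm_scal; lra.
Qed.

Lemma NI_sub q q' a b I I' : NI q a b I -> NI q' a b I' ->
  NI (fun t => q t [-] q' t) a b (I [-] I').
Proof.
  intros h h'; apply (NI_scal (-1)) in h'.
  assert (A := NI_add _ _ _ _ _ _ h h').
  replace (I [-] I') with (I [+] ((-1) [*] I')) by vring.
  revert A; apply NI_ext; intros; vring.
Qed.

Lemma NI_split q a c b I : a <= c <= b -> NI q a b I ->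
  exists I1 I2, NI q a c I1 /\ NI q c b I2 /\ I = I1 [+] I2.
Proof.
  intros hc [F [cF [dF <-]]]; exists (F c [-] F a), (F b [-] F c); repeat split; [| | vring].
  - exists F; repeat split; unfold cc, oo in *.
    + intros t ht; apply (vcont_sub (cc a b)); [unfold cc; intros; lra |]; apply cF; lra.
    + intros; apply dF; lra.
  - exists F; repeat split; unfold cc, oo in *.
    + intros t ht; apply (vcont_sub (cc a b)); [unfold cc; intros; lra |]; apply cF; lra.
    + intros; apply dF; lra.
Qed.

Lemma vcont_affine D D' f c k t : 0 < c -> (forall s, D' s -> D (c * s + k)) ->
  vcont D f (c * t + k) -> vcont D' (fun s => f (c * s + k)) t.
Proof.
  intros hc i cf e he; destruct (cf e he) as [d [hd Hd]].
  exists (d / c); split; [now apply Rdiv_lt_0_compat |].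
  intros s Ds hs; apply Hd; auto.
  replace (c * s + k - (c * t + k)) with (c * (s - t)) by ring.
  rewrite Rabs_mult, (Rabs_pos_eq c) by lra.
  apply Rmult_lt_compat_l with (r := c) in hs; auto.
  replace (c * (d / c)) with d in hs by (field; lra); auto.
Qed.

Lemma rder_affine f c k t l : 0 < c -> rder f (c * t + k) l ->
  rder (fun s => f (c * s + k)) t (c [*] l).
Proof.
  intros hc df e he; destruct (df (e / c)) as [d [hd Hd]]; [now apply Rdiv_lt_0_compat |].
  exists (d / c); split; [now apply Rdiv_lt_0_compat |].
  intros h hh.
  assert (0 < c * h < d).
  { split; [apply Rmult_lt_0_compat; lra |].
    replace d with (c * (d / c)) by (field; lra); apply Rmult_lt_compat_l; lra. }
  assert (A := Hd (c * h) ltac:(auto)).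
  replace (c * (t + h) + k) with (c * t + k + c * h) by ring.
  replace (h [*] (c [*] l)) with ((c * h) [*] l) by vring.
  replace (e * h) with (e / c * (c * h)) by (field; lra); auto.
Qed.

Lemma NI_affine q c k a b a' b' I : 0 < c -> c * a' + k = a -> c * b' + k = b ->
  NI q a b I -> NI (fun s => c [*] q (c * s + k)) a' b' I.
Proof.
  intros hc ea eb [F [cF [dF <-]]].
  assert (hm : forall s, a' <= s -> c * a' + k <= c * s + k)
    by (intros; apply Rplus_le_compat_r, Rmult_le_compat_l; lra).
  assert (hM : forall s, s <= b' -> c * s + k <= c * b' + k)
    by (intros; apply Rplus_le_compat_r, Rmult_le_compat_l; lra).
  exists (fun s => F (c * s + k)); repeat split.
  - intros t ht; apply (vcont_affine (cc a b)); auto; unfold cc in *.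
    + intros s hs; specialize (hm s); specialize (hM s); lra.
    + apply cF; unfold cc; specialize (hm t); specialize (hM t); lra.
  - intros t ht; apply rder_affine; auto; apply dF; unfold oo in *.
    rewrite <- ea, <- eb; split; apply Rplus_lt_compat_r, Rmult_lt_compat_l; lra.
  - now rewrite ea, eb.
Qed.

Lemma is_derive_two_sided f t (l : H) : is_derive f t l ->
  forall e, 0 < e -> exists d, 0 < d /\ forall s, Rabs (s - t) < d ->
    vnorm (f s [-] f t [-] ((s - t) [*] l)) <= e * Rabs (s - t).
Proof.
  intros [_ h] e he.
  destruct (h t (fun P HP => HP) (mkposreal e he)) as [d Hd].
  exists d; split; [apply cond_pos |]; intros s hs; apply (Hd s); exact hs.
Qed.

Lemma is_derive_rder f t (l : H) : is_derive f t l -> rder f t l.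
Proof.
  intros h e he; destruct (is_derive_two_sided f t l h e he) as [d [hd Hd]].
  exists d; split; auto; intros k hk.
  assert (A := Hd (t + k)); replace (t + k - t) with k in A by ring.
  rewrite Rabs_pos_eq in A by lra; apply A; lra.
Qed.

Lemma two_sided_vcont D f t (l : H) :
  (forall e, 0 < e -> exists d, 0 < d /\ forall s, D s -> Rabs (s - t) < d ->
    vnorm (f s [-] f t [-] ((s - t) [*] l)) <= e * Rabs (s - t)) -> vcont D f t.
Proof.
  intros h e he; destruct (h 1) as [d [hd Hd]]; [lra |].
  assert (hn := vnorm_ge0 _ l).
  exists (Rmin d (e / (1 + vnorm l))); split.
  { apply Rmin_case; auto; apply Rdiv_lt_0_compat; lra. }
  set (m := Rmin _ _).
  assert (m <= d /\ m <= e / (1 + vnorm l)) by (split; [apply Rmin_l | apply Rmin_r]).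
  intros s Ds hs; assert (A := Hd s Ds ltac:(lra)).
  assert (B := vnorm_le_sub (f s [-] f t) ((s - t) [*] l)).
  rewrite vnorm_scal in B.
  apply Rle_trans with ((1 + vnorm l) * (e / (1 + vnorm l))); [| right; field; lra].
  apply Rle_trans with ((1 + vnorm l) * Rabs (s - t)); [lra |].
  apply Rmult_le_compat_l; lra.
Qed.

Lemma is_derive_vcont D f t (l : H) : is_derive f t l -> vcont D f t.
Proof.
  intros h; apply (two_sided_vcont _ _ _ l); intros e he.
  destruct (is_derive_two_sided f t l h e he) as [d [hd Hd]]; exists d; auto.
Qed.

Lemma vcont_continuous q a b t : oo a b t -> vcont (oo a b) q t -> continuous q t.
Proof.
  intros ht cq.
  refine (proj2 (filterlim_locally_ball_norm (F := locally t) (q : R -> hspace H) (q t)) _).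
  intros e.
  destruct (cq (e / 2)) as [d [hd Hd]]; [destruct e; simpl; lra |].
  assert (hr : 0 < Rmin d (Rmin (t - a) (b - t)))
    by (unfold oo in ht; repeat apply Rmin_case; lra).
  set (m := Rmin _ _) in *.
  assert (m <= d /\ m <= t - a /\ m <= b - t).
  { assert (m <= d /\ m <= Rmin (t - a) (b - t)) by (split; [apply Rmin_l | apply Rmin_r]).
    assert (Rmin (t - a) (b - t) <= t - a /\ Rmin (t - a) (b - t) <= b - t)
      by (split; [apply Rmin_l | apply Rmin_r]). lra. }
  exists (mkposreal m hr); intros s hs; change (Rabs (s - t) < m) in hs.
  assert (hs' := hs); apply Rabs_def2 in hs'.
  assert (A := Hd s ltac:(unfold oo in *; lra) ltac:(lra)).
  unfold ball_norm; change (norm (minus (q s) (q t))) with (vnorm (q s [-] q t)).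
  destruct e; simpl in *; lra.
Qed.

Lemma continuous_primitive q a b : (forall t, oo a b t -> vcont (oo a b) q t) -> a < b ->
  exists F, forall t, oo a b t -> is_derive F t (q t).
Proof.
  intros cq hab.
  assert (cq' : forall t, oo a b t -> continuous q t)
    by (intros; apply (vcont_continuous q a b); auto).
  set (c := (a + b) / 2).
  assert (hc : oo a b c) by (unfold oo, c; lra).
  exists (fun t => RInt q c t); intros t ht.
  apply (is_derive_RInt q (fun t => RInt q c t) c t); [| apply cq'; auto].
  assert (hr : 0 < Rmin (t - a) (b - t)) by (unfold oo in ht; apply Rmin_case; lra).
  exists (mkposreal _ hr); intros s hs; change (Rabs (s - t) < Rmin (t - a) (b - t)) in hs.
  assert (Rmin (t - a) (b - t) <= t - a /\ Rmin (t - a) (b - t) <= b - t)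
    by (split; [apply Rmin_l | apply Rmin_r]).
  apply Rabs_def2 in hs.
  apply (RInt_correct (V := H)), (ex_RInt_continuous (V := H)).
  intros z hz; apply cq'; unfold oo in *.
  assert (a < Rmin c s) by (apply Rmin_case; lra).
  assert (Rmax c s < b) by (apply Rmax_case; lra). lra.
Qed.

(** Dominated integrability: inside the interval [q] has a primitive by continuity, its increments
    are at most those of [G], and continuity of [G] at the end points makes it Cauchy there, so it
    extends continuously. *)
Lemma NI_exists q g G a b : a < b ->
  (forall t, oo a b t -> vcont (oo a b) q t) ->
  (forall t, cc a b t -> rcont (cc a b) G t) ->
  (forall t, oo a b t -> rderR G t (g t)) ->
  (forall t, oo a b t -> vnorm (q t) <= g t) ->
  exists I, NI q a b I.
Proof.
  intros hab cq cG dG le.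
  destruct (continuous_primitive q a b cq hab) as [F0 dF0].
  assert (inc : forall s t, a < s <= t -> t < b -> vnorm (F0 t [-] F0 s) <= G t - G s).
  { intros s t hs ht; apply (mean_value_rder F0 q G g); unfold cc, oo in *.
    - lra.
    - intros r hr; apply (is_derive_vcont _ _ _ (q r)); apply dF0; lra.
    - intros r hr; apply (rcont_sub (cc a b)); [unfold cc; intros; lra |]; apply cG; lra.
    - intros r hr; apply is_derive_rder, dF0; lra.
    - intros; apply dG; lra.
    - intros; apply le; lra. }
  destruct (vlim_right (fun h => F0 (a + h))) as [Fa HFa].
  { intros e he; destruct (cG a ltac:(unfold cc; lra) (e / 2)) as [d [hd Hd]]; [lra |].
    destruct (pos_min d (b - a)) as [mu [hmu [? ?]]]; [lra | lra |]; exists mu; split; auto.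
    assert (K : forall h k, 0 < h <= k -> k < mu ->
      vnorm (F0 (a + k) [-] F0 (a + h)) <= e).
    { intros h k hh hk.
      assert (A := inc (a + h) (a + k) ltac:(lra) ltac:(lra)).
      assert (A1 := Hd (a + h) ltac:(unfold cc; lra) ltac:(rewrite Rabs_pos_eq; lra)).
      assert (A2 := Hd (a + k) ltac:(unfold cc; lra) ltac:(rewrite Rabs_pos_eq; lra)).
      apply Rabs_le_between in A1; apply Rabs_le_between in A2; lra. }
    intros h k hh hk; destruct (Rle_dec h k); [rewrite vnorm_sub_sym |]; apply K; lra. }
  destruct (vlim_right (fun h => F0 (b - h))) as [Fb HFb].
  { intros e he; destruct (cG b ltac:(unfold cc; lra) (e / 2)) as [d [hd Hd]]; [lra |].
    destruct (pos_min d (b - a)) as [mu [hmu [? ?]]]; [lra | lra |]; exists mu; split; auto.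
    assert (K : forall h k, 0 < h <= k -> k < mu ->
      vnorm (F0 (b - h) [-] F0 (b - k)) <= e).
    { intros h k hh hk.
      assert (A := inc (b - k) (b - h) ltac:(lra) ltac:(lra)).
      assert (A1 := Hd (b - h) ltac:(unfold cc; lra) ltac:(rewrite Rabs_left; lra)).
      assert (A2 := Hd (b - k) ltac:(unfold cc; lra) ltac:(rewrite Rabs_left; lra)).
      apply Rabs_le_between in A1; apply Rabs_le_between in A2; lra. }
    intros h k hh hk; destruct (Rle_dec h k); [| rewrite vnorm_sub_sym]; apply K; lra. }
  set (F := fun t => if Rle_dec t a then Fa else if Rle_dec b t then Fb else F0 t).
  assert (EF : forall t, oo a b t -> F t = F0 t).
  { intros t ht; unfold F, oo in *; destruct (Rle_dec t a); [lra |].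
    destruct (Rle_dec b t); [lra | auto]. }
  assert (Ea : F a = Fa) by (unfold F; destruct (Rle_dec a a); [auto | lra]).
  assert (Eb : F b = Fb).
  { unfold F; destruct (Rle_dec b a); [lra |]; destruct (Rle_dec b b); [auto | lra]. }
  exists (F b [-] F a); exists F; repeat split.
  - intros t ht.
    destruct (Req_dec t a) as [-> | na]; [| destruct (Req_dec t b) as [-> | nb]].
    + intros e he; destruct (HFa e he) as [d [hd Hd]].
      destruct (pos_min d (b - a)) as [mu [hmu [? ?]]]; [lra | lra |]; exists mu; split; auto.
      intros s hs hsa; unfold cc in *; rewrite Rabs_pos_eq in hsa by lra.
      destruct (Req_dec s a) as [-> | ns].
      * replace (F a [-] F a) with (v0 : H) by vring; rewrite vnorm_0; lra.
      * rewrite EF, Ea by (unfold oo; lra).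
        replace s with (a + (s - a)) by ring; apply Hd; lra.
    + intros e he; destruct (HFb e he) as [d [hd Hd]].
      destruct (pos_min d (b - a)) as [mu [hmu [? ?]]]; [lra | lra |]; exists mu; split; auto.
      intros s hs hsb; unfold cc in *.
      destruct (Req_dec s b) as [-> | ns].
      * replace (F b [-] F b) with (v0 : H) by vring; rewrite vnorm_0; lra.
      * rewrite Rabs_left in hsb by lra. rewrite EF, Eb by (unfold oo; lra).
        replace s with (b - (b - s)) by ring; apply Hd; lra.
    + assert (ht' : oo a b t) by (unfold oo, cc in *; lra).
      apply (vcont_local (oo a b) _ _ _ (Rmin (t - a) (b - t))).
      * unfold oo in ht'; apply Rmin_case; lra.
      * intros s hs hst.
        assert (Rmin (t - a) (b - t) <= t - a /\ Rmin (t - a) (b - t) <= b - t)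
          by (split; [apply Rmin_l | apply Rmin_r]).
        apply Rabs_def2 in hst; unfold oo; lra.
      * apply (vcont_ext _ F0); auto.
        -- intros; symmetry; auto.
        -- apply (is_derive_vcont _ _ _ (q t)); auto.
  - intros t ht; apply (rder_ext_loc F0 _ _ _ (b - t)); [unfold oo in ht; lra | |].
    + intros s hs; rewrite EF; auto; unfold oo in *; lra.
    + apply is_derive_rder, dF0; auto.
Qed.

(** Dominated convergence in quantitative form. Near the ends both integrals are small by the
    majorant, in the middle the integrands are uniformly close. Since [r] and [k] depend on [e] and
    the majorant alone, the lemma applies to families of integrands without any limit theorem. *)
Lemma NI_dominated g G a b : a < b ->
  (forall t, cc a b t -> rcont (cc a b) G t) ->
  (forall t, oo a b t -> rderR G t (g t)) ->
  forall e, 0 < e -> exists r k, 0 < r /\ 0 < k /\ forall q q' I I',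
    (forall t, oo a b t -> vnorm (q t) <= g t) ->
    (forall t, oo a b t -> vnorm (q' t) <= g t) ->
    (forall t, a + r <= t <= b - r -> vnorm (q t [-] q' t) <= k) ->
    NI q a b I -> NI q' a b I' -> vnorm (I [-] I') <= e.
Proof.
  intros hab cG dG e he.
  destruct (cG a ltac:(unfold cc; lra) (e / 6)) as [d1 [hd1 H1]]; [lra |].
  destruct (cG b ltac:(unfold cc; lra) (e / 6)) as [d2 [hd2 H2]]; [lra |].
  (* Within distance [r] of either end [G] varies by at most e/6; as [q - q'] has majorant 2 [g],
     each end costs e/3 and leaves e/3 for the middle. *)
  set (r := Rmin (Rmin d1 d2 / 2) ((b - a) / 2)).
  assert (0 < Rmin d1 d2) by (apply Rmin_case; lra).
  assert (Rmin d1 d2 <= d1 /\ Rmin d1 d2 <= d2) by (split; [apply Rmin_l | apply Rmin_r]).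
  assert (hr : 0 < r) by (apply Rmin_case; lra).
  assert (hr' : r <= Rmin d1 d2 / 2 /\ r <= (b - a) / 2)
    by (split; [apply Rmin_l | apply Rmin_r]).
  exists r, (e / 3 / (b - a)).
  assert (hk : 0 < e / 3 / (b - a)) by (repeat apply Rdiv_lt_0_compat; lra).
  repeat split; auto.
  intros q q' I I' le le' near hI hI'.
  assert (hD := NI_sub _ _ _ _ _ _ hI hI').
  destruct (NI_split _ a (a + r) b _ ltac:(lra) hD) as [J1 [J' [hJ1 [hJ' ->]]]].
  destruct (NI_split _ (a + r) (b - r) b _ ltac:(lra) hJ') as [J2 [J3 [hJ2 [hJ3 ->]]]].
  assert (bound : forall c d J, a <= c <= d -> d <= b ->
    NI (fun t => q t [-] q' t) c d J -> vnorm J <= 2 * (G d - G c)).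
  { intros c d J hc hd hJ.
    replace (2 * (G d - G c)) with ((2 * G d - 0 * G d) - (2 * G c - 0 * G c)) by ring.
    apply (NI_bound (fun t => q t [-] q' t) (fun t => 2 * g t) (fun t => 2 * G t - 0 * G t) c d);
      auto; unfold cc, oo in *; [lra | | |].
    - intros t ht; apply rcont_lincomb; apply (rcont_sub (cc a b));
        try (unfold cc; intros; lra); apply cG; lra.
    - intros t ht e' he'; destruct (dG t ltac:(lra) (e' / 2)) as [dd [hdd Hdd]]; [lra |].
      exists dd; split; auto; intros h hh; assert (A := Hdd h hh).
      replace (2 * G (t + h) - 0 * G (t + h) - (2 * G t - 0 * G t) - h * (2 * g t))
        with (2 * (G (t + h) - G t - h * g t)) by ring.
      rewrite Rabs_mult, (Rabs_pos_eq 2) by lra; lra.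
    - intros t ht; eapply Rle_trans; [apply vnorm_sub |].
      assert (vnorm (q t) <= g t) by (apply le; lra).
      assert (vnorm (q' t) <= g t) by (apply le'; lra). lra. }
  assert (B1 := bound a (a + r) J1 ltac:(lra) ltac:(lra) hJ1).
  assert (B3 := bound (b - r) b J3 ltac:(lra) ltac:(lra) hJ3).
  assert (B2 : vnorm J2 <= e / 3).
  { assert (near' : forall t, oo (a + r) (b - r) t ->
      vnorm (q t [-] q' t [-] v0) <= e / 3 / (b - a)).
    { intros t ht; replace (q t [-] q' t [-] v0) with (q t [-] q' t) by vring.
      apply near; unfold oo in ht; lra. }
    assert (A := NI_near _ v0 _ (a + r) (b - r) _ ltac:(lra) near' hJ2).
    replace (J2 [-] ((b - r - (a + r)) [*] v0)) with J2 in A by vring.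
    apply Rle_trans with (e / 3 / (b - a) * (b - a)); [| right; field; lra].
    eapply Rle_trans; [exact A |]; apply Rmult_le_compat_l; lra. }
  assert (A1 := H1 (a + r) ltac:(unfold cc; lra) ltac:(rewrite Rabs_pos_eq; lra)).
  assert (A2 := H2 (b - r) ltac:(unfold cc; lra) ltac:(rewrite Rabs_left; lra)).
  apply Rabs_le_between in A1; apply Rabs_le_between in A2.
  assert (C1 := vnorm_add _ J1 (J2 [+] J3)). assert (C2 := vnorm_add _ J2 J3). lra.
Qed.

End Newton.

(** * Convolutions with weakly singular kernels *)

Section Convolution.
Context {H : Hilbert} (T : R).
Implicit Types (r : R -> H -> H) (phi : R -> H).

(** Continuity is only strong, that is, for each fixed [x]: the semigroup, itself a kernel with a =
    1 ([sg_ker]), is used in this sense. The shifted exponent makes a = 1 the bounded case. *)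
Definition ker a C r :=
  (forall t, oc 0 T t -> lin (r t)) /\
  (forall t x, oc 0 T t -> vnorm (r t x) <= C * rp t (a - 1) * vnorm x) /\
  (forall x t, oc 0 T t -> vcont (oc 0 T) (fun s => r s x) t).

Definition src b N phi :=
  (forall t, oc 0 T t -> vnorm (phi t) <= N * rp t (b - 1)) /\
  (forall t, oc 0 T t -> vcont (oc 0 T) phi t).

(** Strong continuity at the fixed vector [x], together with the uniform bound of the operators on
    [t/2, T] applied to x' - x. *)
Lemma ker_joint a C r t x : a <= 1 -> 0 <= C -> ker a C r -> oc 0 T t ->
  forall e, 0 < e -> exists d, 0 < d /\ forall t' x', oc 0 T t' -> Rabs (t' - t) < d ->
    vnorm (x' [-] x) <= d -> vnorm (r t' x' [-] r t x) <= e.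
Proof.
  intros ha hC [rl [rb rc]] ht e he; unfold oc in *.
  destruct (rc x t ht (e / 2)) as [d [hd Hd]]; [lra |].
  set (M := C * rp (t / 2) (a - 1)).
  assert (hM : 0 <= M) by (apply Rmult_le_pos; auto using rp_ge0).
  destruct (pos_min d (t / 2)) as [m1 [hm1 [hm2 hm3]]]; [auto | lra |].
  destruct (pos_min m1 (e / 2 / (M + 1))) as [m [hm [hm4 hm5]]];
    [auto | apply Rdiv_lt_0_compat; lra |].
  exists m; split; auto; intros t' x' ht' htt hx.
  replace (r t' x' [-] r t x) with (r t' (x' [-] x) [+] (r t' x [-] r t x))
    by (rewrite (lin_sub (r t')) by auto; vring).
  eapply Rle_trans; [apply vnorm_add |].
  assert (A := Hd t' ht' ltac:(lra)); simpl in A.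
  assert (B := rb t' (x' [-] x) ht').
  assert (C * rp t' (a - 1) <= M).
  { apply Rmult_le_compat_l; auto; apply rp_decr; [| lra].
    apply Rabs_def2 in htt; lra. }
  assert (C * rp t' (a - 1) * vnorm (x' [-] x) <= (M + 1) * (e / 2 / (M + 1))).
  { apply Rmult_le_compat; auto using vnorm_ge0; try lra.
    apply Rmult_le_pos; auto using rp_ge0. }
  replace ((M + 1) * (e / 2 / (M + 1))) with (e / 2) in * by (field; lra). lra.
Qed.

Lemma conv_integrand_cont a C b N r phi t : a <= 1 -> 0 <= C -> ker a C r -> src b N phi ->
  oc 0 T t -> forall s, oo 0 t s -> vcont (oo 0 t) (fun s => r (t - s) (phi s)) s.
Proof.
  intros ha hC hr [_ pc] ht s hs e he; unfold oo, oc in *.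
  destruct (ker_joint a C r (t - s) (phi s) ha hC hr ltac:(unfold oc; lra) e he) as [d [hd Hd]].
  destruct (pc s ltac:(lra) d hd) as [d' [hd' Hd']].
  destruct (pos_min d d' hd hd') as [m [hm [hm1 hm2]]].
  exists m; split; auto; intros s' hs' hss; apply Hd.
  - unfold oc; lra.
  - replace (t - s' - (t - s)) with (- (s' - s)) by ring; rewrite Rabs_Ropp; lra.
  - apply Hd'; lra.
Qed.

(** An upper bound for Euler's beta function B(a, b) with 0 < a, b <= 1: the integral over (0, 1) of
    the majorant in [rp_prod_le]. *)
Definition beta_const a b := rp (1 / 2) (a - 1) / b + rp (1 / 2) (b - 1) / a.

Lemma beta_const_pos a b : 0 < a -> 0 < b -> 0 < beta_const a b.
Proof.
  intros; apply Rplus_lt_0_compat; apply Rdiv_lt_0_compat; auto; apply rp_pos; lra.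
Qed.

Definition beta_maj M a b t s :=
  M * rp (t / 2) (a - 1) * rp s (b - 1) + M * rp (t / 2) (b - 1) * rp (t - s) (a - 1).

Definition beta_maj_prim M a b t :=
  beta_prim (M * rp (t / 2) (a - 1)) b (M * rp (t / 2) (b - 1)) a t.

Lemma beta_maj_cont D M a b t s : 0 < a -> 0 < b -> 0 <= s <= t ->
  rcont D (beta_maj_prim M a b t) s.
Proof. intros; now apply beta_prim_cont. Qed.

Lemma beta_maj_der M a b t s : 0 < a -> 0 < b -> 0 < s < t ->
  rderR (beta_maj_prim M a b t) s (beta_maj M a b t s).
Proof. intros; apply beta_prim_der; auto; lra. Qed.

Lemma beta_maj_ge M a b t s : 0 < a <= 1 -> 0 < b <= 1 -> 0 <= M -> 0 < s < t ->
  M * (rp (t - s) (a - 1) * rp s (b - 1)) <= beta_maj M a b t s.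
Proof.
  intros ha hb hM hs; unfold beta_maj.
  assert (A := rp_prod_le s t b a hs ltac:(lra) ltac:(lra)).
  apply Rmult_le_compat_l with (r := M) in A; auto. lra.
Qed.

Lemma beta_maj_total M a b t : 0 < a -> 0 < b -> 0 < t ->
  beta_maj_prim M a b t t - beta_maj_prim M a b t 0 = M * beta_const a b * rp t (a + b - 1).
Proof.
  intros ha hb ht; unfold beta_maj_prim, beta_prim, beta_const.
  rewrite Rminus_diag, Rminus_0_r, !rp_zero.
  replace (t / 2) with (1 / 2 * t) by field; rewrite !rp_mult by lra.
  replace (a + b - 1) with (a - 1 + b) at 1 by ring.
  assert (E1 : rp t (a + b - 1) = rp t (a - 1) * rp t b) by (rewrite <- rp_add by auto; f_equal; ring).
  assert (E2 : rp t (a + b - 1) = rp t (b - 1) * rp t a) by (rewrite <- rp_add by auto; f_equal; ring).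
  replace (a - 1 + b) with (a + b - 1) by ring.
  transitivity (M * (rp (1 / 2) (a - 1) / b) * rp t (a + b - 1)
                + M * (rp (1 / 2) (b - 1) / a) * rp t (a + b - 1)); [| ring].
  rewrite E1 at 1; rewrite E2; field; lra.
Qed.

Lemma NI_beta_bound q M a b t I : 0 < a <= 1 -> 0 < b <= 1 -> 0 <= M -> 0 < t ->
  (forall s, oo 0 t s -> vnorm (q s) <= M * (rp (t - s) (a - 1) * rp s (b - 1))) ->
  NI (H := H) q 0 t I -> vnorm I <= M * beta_const a b * rp t (a + b - 1).
Proof.
  intros ha hb hM ht le hI; rewrite <- beta_maj_total by lra.
  apply (NI_bound q (beta_maj M a b t) (beta_maj_prim M a b t) 0 t); unfold cc, oo in *; auto.
  - lra.
  - intros; apply beta_maj_cont; lra.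
  - intros; apply beta_maj_der; lra.
  - intros; eapply Rle_trans; [apply le; auto | apply beta_maj_ge; auto].
Qed.

Lemma conv_integrand_le a C b N r phi t : 0 <= C -> ker a C r -> src b N phi -> oc 0 T t ->
  forall s, oo 0 t s ->
  vnorm (r (t - s) (phi s)) <= C * N * (rp (t - s) (a - 1) * rp s (b - 1)).
Proof.
  intros hC [_ [rb _]] [pb _] ht s hs; unfold oc, oo in *.
  eapply Rle_trans; [apply rb; lra |].
  replace (C * N * (rp (t - s) (a - 1) * rp s (b - 1)))
    with (C * rp (t - s) (a - 1) * (N * rp s (b - 1))) by ring.
  apply Rmult_le_compat_l; [apply Rmult_le_pos; auto using rp_ge0 | apply pb; lra].
Qed.

(** A choice operator makes the convolution total; it carries information exactly where the integral
    exists ([conv_spec]), and there the value is unique ([conv_unique]). *)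
Definition conv r phi t : H :=
  epsilon (inhabits v0) (fun I => NI (fun s => r (t - s) (phi s)) 0 t I).

Lemma conv_spec a C b N r phi t : 0 < a <= 1 -> 0 < b <= 1 -> 0 <= C -> 0 <= N ->
  ker a C r -> src b N phi -> oc 0 T t ->
  NI (fun s => r (t - s) (phi s)) 0 t (conv r phi t).
Proof.
  intros ha hb hC hN hr hp ht; unfold conv; apply epsilon_spec.
  apply (NI_exists _ (beta_maj (C * N) a b t) (beta_maj_prim (C * N) a b t));
    unfold cc, oo, oc in *.
  - lra.
  - intros; apply (conv_integrand_cont a C b N); auto; lra.
  - intros; apply beta_maj_cont; lra.
  - intros; apply beta_maj_der; lra.
  - intros; eapply Rle_trans; [apply (conv_integrand_le a C b N); auto |
      apply beta_maj_ge; auto using Rmult_le_pos].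
Qed.

Lemma conv_unique r phi t I : 0 <= t -> NI (fun s => r (t - s) (phi s)) 0 t I ->
  conv r phi t = I.
Proof.
  intros ht hI; apply (NI_unique (fun s => r (t - s) (phi s)) 0 t); auto.
  unfold conv; apply epsilon_spec; now exists I.
Qed.

Lemma conv_bound a C b N r phi t : 0 < a <= 1 -> 0 < b <= 1 -> 0 <= C -> 0 <= N ->
  ker a C r -> src b N phi -> oc 0 T t ->
  vnorm (conv r phi t) <= C * N * beta_const a b * rp t (a + b - 1).
Proof.
  intros ha hb hC hN hr hp ht.
  apply (NI_beta_bound (fun s => r (t - s) (phi s))); auto using Rmult_le_pos.
  - unfold oc in ht; lra.
  - intros; apply (conv_integrand_le a C b N); auto.
  - apply (conv_spec a C b N); auto.
Qed.

(** The integrand after the substitution of [t * s] for [s], which moves the convolutions at all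
    times to the interval (0, 1). The form [t * s + 0] is the one produced by [NI_affine]. *)
Lemma conv_integrand_joint a C b N r phi t0 s0 : 0 < a <= 1 -> 0 <= C ->
  ker a C r -> src b N phi -> oc 0 T t0 -> 0 < s0 < 1 ->
  forall e, 0 < e -> exists d, 0 < d /\ forall t s, oc 0 T t -> 0 < s < 1 ->
    Rabs (t - t0) < d -> Rabs (s - s0) < d ->
    vnorm ((t [*] r (t - (t * s + 0)) (phi (t * s + 0)))
      [-] (t0 [*] r (t0 - (t0 * s0 + 0)) (phi (t0 * s0 + 0)))) <= e.
Proof.
  intros ha hC hr hp ht0 hs0 e he; unfold oc in *.
  assert (hts : forall t s, 0 < t <= T -> 0 < s < 1 -> 0 < t * s < t).
  { intros t s ht hs; split; [apply Rmult_lt_0_compat; lra |].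
    rewrite <- (Rmult_1_r t) at 2; apply Rmult_lt_compat_l; lra. }
  assert (P0 := hts t0 s0 ht0 hs0).
  set (y0 := r (t0 - (t0 * s0 + 0)) (phi (t0 * s0 + 0))).
  assert (hT : 0 < T) by lra.
  assert (hy := vnorm_ge0 _ y0).
  destruct (ker_joint a C r (t0 - (t0 * s0 + 0)) (phi (t0 * s0 + 0)) ltac:(lra) hC hr
    ltac:(unfold oc; lra) (e / 2 / T) ltac:(repeat apply Rdiv_lt_0_compat; lra))
    as [d [hd Hd]].
  destruct (proj2 hp (t0 * s0 + 0) ltac:(unfold oc; lra) d hd) as [d' [hd' Hd']].
  destruct (pos_min d d' hd hd') as [m1 [hm1 [hm2 hm3]]].
  destruct (pos_min (m1 / (1 + T)) (e / 2 / (vnorm y0 + 1))) as [m [hm [hm4 hm5]]];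
    try (repeat apply Rdiv_lt_0_compat; lra).
  exists m; split; auto; intros t s ht hs htt hss.
  assert (P := hts t s ht hs).
  assert (D1 : Rabs (t * s - t0 * s0) <= Rabs (t - t0) + T * Rabs (s - s0)).
  { replace (t * s - t0 * s0) with ((t - t0) * s0 + t * (s - s0)) by ring.
    eapply Rle_trans; [apply Rabs_triang |]; rewrite !Rabs_mult, (Rabs_pos_eq s0), (Rabs_pos_eq t) by lra.
    apply Rplus_le_compat.
    - rewrite <- (Rmult_1_r (Rabs (t - t0))) at 2; apply Rmult_le_compat_l; [apply Rabs_pos | lra].
    - apply Rmult_le_compat_r; [apply Rabs_pos | lra]. }
  assert (D2 : Rabs (t - t0 - (t * s - t0 * s0)) <= Rabs (t - t0) + T * Rabs (s - s0)).
  { replace (t - t0 - (t * s - t0 * s0)) with ((t - t0) * (1 - s0) + - (t * (s - s0))) by ring.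
    eapply Rle_trans; [apply Rabs_triang |]; rewrite Rabs_Ropp, !Rabs_mult, (Rabs_pos_eq (1 - s0)), (Rabs_pos_eq t) by lra.
    apply Rplus_le_compat.
    - rewrite <- (Rmult_1_r (Rabs (t - t0))) at 2; apply Rmult_le_compat_l; [apply Rabs_pos | lra].
    - apply Rmult_le_compat_r; [apply Rabs_pos | lra]. }
  assert (D3 : Rabs (t - t0) + T * Rabs (s - s0) < m1).
  { apply Rlt_le_trans with (m + T * m).
    - apply Rplus_lt_le_compat; auto; apply Rmult_le_compat_l; lra.
    - apply Rle_trans with ((1 + T) * (m1 / (1 + T))); [| right; field; lra].
      replace (m + T * m) with ((1 + T) * m) by ring; apply Rmult_le_compat_l; lra. }
  set (y := r (t - (t * s + 0)) (phi (t * s + 0))).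
  assert (Y : vnorm (y [-] y0) <= e / 2 / T).
  { apply Hd.
    - unfold oc; lra.
    - replace (t - (t * s + 0) - (t0 - (t0 * s0 + 0))) with (t - t0 - (t * s - t0 * s0)) by ring; lra.
    - apply Hd'; [unfold oc; lra |].
      replace (t * s + 0 - (t0 * s0 + 0)) with (t * s - t0 * s0) by ring; lra. }
  replace ((t [*] y) [-] (t0 [*] y0)) with ((t [*] (y [-] y0)) [+] ((t - t0) [*] y0)) by vring.
  eapply Rle_trans; [apply vnorm_add |]; rewrite !vnorm_scal, (Rabs_pos_eq t) by lra.
  assert (t * vnorm (y [-] y0) <= T * (e / 2 / T)).
  { apply Rmult_le_compat; auto using vnorm_ge0; lra. }
  assert (Rabs (t - t0) * vnorm y0 <= (e / 2 / (vnorm y0 + 1)) * (vnorm y0 + 1)).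
  { apply Rmult_le_compat; auto using Rabs_pos; lra. }
  replace (T * (e / 2 / T)) with (e / 2) in * by (field; lra).
  replace (e / 2 / (vnorm y0 + 1) * (vnorm y0 + 1)) with (e / 2) in * by (field; lra). lra.
Qed.

Lemma conv_cont a C b N r phi t0 : 0 < a <= 1 -> 0 < b <= 1 -> 0 <= C -> 0 <= N ->
  ker a C r -> src b N phi -> oc 0 T t0 -> vcont (oc 0 T) (conv r phi) t0.
Proof.
  intros ha hb hC hN hr hp ht0 e he; assert (ht0' := ht0); unfold oc in ht0'.
  (* On the fixed interval (0,1) the integrand depends continuously on t. *)
  set (q := fun t s => t [*] r (t - (t * s + 0)) (phi (t * s + 0))).
  assert (hq : forall t, oc 0 T t -> NI (q t) 0 1 (conv r phi t)).
  { intros t ht; unfold oc in ht.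
    apply (NI_affine (fun s => r (t - s) (phi s)) t 0 0 t); try ring; [lra |].
    apply (conv_spec a C b N); auto. }
  (* For t in [t0/2, T] every power of [t] from the scaling is bounded by its counterpart here, so
     one beta majorant on (0, 1) serves all these [t]. *)
  set (M := C * N * (T * (rp (t0 / 2) (a - 1) * rp (t0 / 2) (b - 1)))).
  assert (hCN : 0 <= C * N) by now apply Rmult_le_pos.
  assert (hM : 0 <= M).
  { apply Rmult_le_pos; auto; repeat apply Rmult_le_pos; try apply rp_ge0; lra. }
  assert (dom : forall t, oc 0 T t -> t0 / 2 <= t -> forall s, oo 0 1 s ->
    vnorm (q t s) <= beta_maj M a b 1 s).
  { intros t ht htt s hs; assert (ht' := ht); unfold oc, oo in hs, ht'.
    assert (hts : 0 < t * s < t).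
    { split; [apply Rmult_lt_0_compat; lra |].
      rewrite <- (Rmult_1_r t) at 2; apply Rmult_lt_compat_l; lra. }
    eapply Rle_trans; [| apply beta_maj_ge; auto].
    unfold q; rewrite Rplus_0_r, vnorm_scal_pos by lra.
    assert (A := conv_integrand_le a C b N r phi t hC hr hp ht (t * s) ltac:(unfold oo; lra)).
    apply Rle_trans with (t * (C * N * (rp (t - t * s) (a - 1) * rp (t * s) (b - 1)))).
    { apply Rmult_le_compat_l; lra. }
    replace (t - t * s) with (t * (1 - s)) by ring; rewrite !rp_mult by lra.
    replace (t * (C * N * (rp t (a - 1) * rp (1 - s) (a - 1) * (rp t (b - 1) * rp s (b - 1)))))
      with (C * N * (t * (rp t (a - 1) * rp t (b - 1))) * (rp (1 - s) (a - 1) * rp s (b - 1))) by ring.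
    apply Rmult_le_compat_r; [apply Rmult_le_pos; apply rp_ge0 |].
    apply Rmult_le_compat_l; auto.
    apply Rmult_le_compat; [lra | apply Rmult_le_pos; apply rp_ge0 | lra |].
    apply Rmult_le_compat; try apply rp_ge0; apply rp_decr; lra. }
  destruct (NI_dominated (H := H) (beta_maj M a b 1) (beta_maj_prim M a b 1) 0 1)
    with (e := e) as [r0 [k [hr0 [hk near]]]]; auto; [lra | | |].
  { intros; apply beta_maj_cont; unfold cc in *; lra. }
  { intros; apply beta_maj_der; unfold oo in *; lra. }
  destruct (compact_uniform (fun t s => vnorm (q t s [-] q t0 s) <= k)
    (fun t => oc 0 T t /\ t0 / 2 <= t) t0 (0 + r0) (1 - r0)) as [d [hd Hd]].
  { intros s hs.
    destruct (conv_integrand_joint a C b N r phi t0 s ha hC hr hp ht0 ltac:(lra) (k / 2) ltac:(lra))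
      as [d [hd Hd]].
    exists d; split; auto; intros t s' [ht htt] hd1 hd2 hs'.
    assert (A1 := Hd t s' ht ltac:(lra) hd1 hd2).
    assert (A2 := Hd t0 s' ht0 ltac:(lra) ltac:(rewrite Rminus_diag, Rabs_R0; lra) hd2).
    fold (q t s') (q t0 s) (q t0 s') in A1, A2.
    assert (B := vnorm_tri (q t s') (q t0 s) (q t0 s')).
    rewrite (vnorm_sub_sym (q t0 s)) in B; lra. }
  destruct (pos_min d (t0 / 2)) as [m [hm [hm1 hm2]]]; [auto | lra |].
  exists m; split; auto; intros t ht htt.
  assert (t0 / 2 <= t) by (apply Rabs_def2 in htt; lra).
  apply (near (q t) (q t0)); auto.
  - apply dom; auto; lra.
  - intros s hs; apply Hd; auto; lra.
Qed.

Lemma ker_sub a C C' r r' : ker a C r -> ker a C' r' ->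
  ker a (C + C') (fun t x => r t x [-] r' t x).
Proof.
  intros [rl [rb rc]] [rl' [rb' rc']]; split; [| split].
  - intros t ht; split; intros.
    + rewrite (proj1 (rl t ht)), (proj1 (rl' t ht)); vring.
    + rewrite (proj2 (rl t ht)), (proj2 (rl' t ht)); vring.
  - intros t x ht; eapply Rle_trans; [apply vnorm_sub |].
    assert (A := rb t x ht); assert (B := rb' t x ht). lra.
  - intros x t ht; apply vcont_minus; auto.
Qed.

Lemma conv_ker_sub a C C' b N r r' phi t : 0 < a <= 1 -> 0 < b <= 1 ->
  0 <= C -> 0 <= C' -> 0 <= N -> ker a C r -> ker a C' r' -> src b N phi -> oc 0 T t ->
  conv (fun s x => r s x [-] r' s x) phi t = conv r phi t [-] conv r' phi t.
Proof.
  intros ha hb hC hC' hN hr hr' hp ht; apply conv_unique; [unfold oc in ht; lra |].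
  apply (NI_sub (fun s => r (t - s) (phi s)) (fun s => r' (t - s) (phi s)));
    [apply (conv_spec a C b N) | apply (conv_spec a C' b N)]; auto.
Qed.

Lemma conv_lin (L : H -> H) CL a C b N r phi t : lin L -> 0 <= CL -> bnd L CL ->
  0 < a <= 1 -> 0 < b <= 1 -> 0 <= C -> 0 <= N -> ker a C r -> src b N phi -> oc 0 T t ->
  conv (fun s x => L (r s x)) phi t = L (conv r phi t).
Proof.
  intros hL hCL bL ha hb hC hN hr hp ht; apply conv_unique; [unfold oc in ht; lra |].
  apply (NI_lin L CL (fun s => r (t - s) (phi s))); auto.
  apply (conv_spec a C b N); auto.
Qed.

Lemma conv_src_sub a C b N N' r phi psi t : 0 < a <= 1 -> 0 < b <= 1 ->
  0 <= C -> 0 <= N -> 0 <= N' -> ker a C r -> src b N phi -> src b N' psi -> oc 0 T t ->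
  conv r (fun s => phi s [-] psi s) t = conv r phi t [-] conv r psi t.
Proof.
  intros ha hb hC hN hN' hr hp hp' ht; unfold oc in ht; apply conv_unique; [lra |].
  apply (NI_ext (fun s => r (t - s) (phi s) [-] r (t - s) (psi s))).
  - intros s hs; unfold oo in hs; rewrite (lin_sub (r (t - s))); auto; apply hr; unfold oc; lra.
  - apply (NI_sub (fun s => r (t - s) (phi s)) (fun s => r (t - s) (psi s)));
    [apply (conv_spec a C b N) | apply (conv_spec a C b N')]; auto.
Qed.

(* [R'] is the primitive of [r] vanishing at 0. *)
Definition prim a C (R' r : R -> H -> H) :=
  ker 1 C R' /\
  (forall t x, oc 0 T t -> vnorm (R' t x) <= C * rp t a * vnorm x) /\
  (forall t x, oo 0 T t -> rder (fun s => R' s x) t (r t x)).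

Lemma prim_increment a C R' r x l M s t : prim a C R' r -> 0 < s <= t -> t <= T ->
  (forall tau, oo s t tau -> vnorm (r tau x [-] l) <= M) ->
  vnorm (R' t x [-] R' s x [-] ((t - s) [*] l)) <= M * (t - s).
Proof.
  intros [[_ [_ Rc]] [_ Rd]] hs ht le.
  apply (mean_value_lin (fun s => R' s x) (fun s => r s x)); auto; [lra | |].
  - intros u hu; apply (vcont_sub (oc 0 T)); [unfold cc, oc; intros; lra |].
    apply Rc; unfold cc, oc in *; lra.
  - intros u hu; apply Rd; unfold oo in *; lra.
Qed.

(** The increment over a step h splits at [t0]. On (0, t0) the difference quotients of [R'] inherit
    the majorant of [r] through the mean value inequality, so [NI_dominated] applies. The piece over
    (t0, t0 + h) is of order h^(1 + a), since [R'] is of order t^a, and contributes nothing to the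
    derivative. *)
Lemma conv_prim_rder a C C' b N R' r phi t0 : 0 < a <= 1 -> 0 < b <= 1 ->
  0 <= C -> 0 <= C' -> 0 <= N -> ker a C r -> prim a C' R' r -> src b N phi ->
  oo 0 T t0 -> rder (conv R' phi) t0 (conv r phi t0).
Proof.
  intros ha hb hC hC' hN hr hR hp ht0 e he.
  assert (hT0 := ht0); unfold oo in hT0.
  assert (t0T : oc 0 T t0) by (unfold oc; lra).
  assert (hCN : 0 <= C * N) by now apply Rmult_le_pos.
  destruct (NI_dominated (H := H) (beta_maj (C * N) a b t0) (beta_maj_prim (C * N) a b t0) 0 t0)
    with (e := e / 2) as [r0 [k [hr0 [hk near]]]]; [lra | | | lra |].
  { intros; apply beta_maj_cont; unfold cc in *; lra. }
  { intros; apply beta_maj_der; unfold oo in *; lra. }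
  set (q := fun h s => (/ h) [*] (R' (t0 + h - s) (phi s) [-] R' (t0 - s) (phi s))).
  set (q0 := fun s => r (t0 - s) (phi s)).
  (* Used twice: with [l] zero to dominate the quotient, and with [l] the limiting integrand to
     prove convergence. *)
  assert (qle : forall h s l M, 0 < h -> t0 + h <= T -> 0 < s < t0 ->
    (forall tau, oo (t0 - s) (t0 + h - s) tau -> vnorm (r tau (phi s) [-] l) <= M) ->
    vnorm (q h s [-] l) <= M).
  { intros h s l M hh hhT hs le.
    assert (A := prim_increment a C' R' r (phi s) l M (t0 - s) (t0 + h - s) hR
      ltac:(lra) ltac:(lra) le).
    replace (t0 + h - s - (t0 - s)) with h in A by ring.
    unfold q; set (y := R' (t0 + h - s) (phi s) [-] R' (t0 - s) (phi s)) in *.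
    replace (((/ h) [*] y) [-] l) with ((/ h) [*] (y [-] (h [*] l))) by (vfield; lra).
    rewrite vnorm_scal_pos by (left; apply Rinv_0_lt_compat; lra).
    apply Rmult_le_reg_l with h; auto; rewrite <- Rmult_assoc, Rinv_r, Rmult_1_l by lra; lra. }
  assert (dom0 : forall s, oo 0 t0 s -> vnorm (q0 s) <= beta_maj (C * N) a b t0 s).
  { intros s hs; eapply Rle_trans; [apply (conv_integrand_le a C b N); auto |].
    apply beta_maj_ge; auto. }
  assert (domq : forall h, 0 < h -> t0 + h <= T -> forall s, oo 0 t0 s ->
    vnorm (q h s) <= beta_maj (C * N) a b t0 s).
  { intros h hh hhT s hs; eapply Rle_trans; [| apply beta_maj_ge; auto].
    assert (hs' := hs); unfold oo in hs'.
    replace (q h s) with (q h s [-] v0) by vring; apply qle; auto.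
    intros tau htau; unfold oo in htau.
    replace (r tau (phi s) [-] v0) with (r tau (phi s)) by vring.
    destruct hr as [_ [rb _]]; destruct hp as [pb _].
    eapply Rle_trans; [apply rb; unfold oc; lra |].
    replace (C * N * (rp (t0 - s) (a - 1) * rp s (b - 1)))
      with (C * rp (t0 - s) (a - 1) * (N * rp s (b - 1))) by ring.
    apply Rmult_le_compat; auto using vnorm_ge0, Rmult_le_pos, rp_ge0.
    - apply Rmult_le_compat_l; auto; apply rp_decr; lra.
    - apply pb; unfold oc; lra. }
  destruct (compact_uniform (fun h s => vnorm (q h s [-] q0 s) <= k)
    (fun h => 0 < h /\ t0 + h <= T) 0 (0 + r0) (t0 - r0)) as [d [hd Hd]].
  { intros s hs.
    destruct (ker_joint a C r (t0 - s) (phi s) ltac:(lra) hC hr ltac:(unfold oc; lra) (k / 2) ltac:(lra))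
      as [d [hd Hd]].
    destruct (proj2 hp s ltac:(unfold oc; lra) d hd) as [d' [hd' Hd']].
    destruct (pos_min (d / 2) d') as [m [hm [hm1 hm2]]]; [lra | auto |].
    exists m; split; auto; intros h s' [hh hhT] hhm hss hs'.
    rewrite Rminus_0_r, Rabs_pos_eq in hhm by lra.
    assert (hss' := hss); apply Rabs_def2 in hss'.
    apply qle; auto; [lra |]; intros tau htau; unfold oo in htau.
    assert (X : vnorm (phi s' [-] phi s) <= d) by (apply Hd'; [unfold oc |]; lra).
    assert (A1 : vnorm (r tau (phi s') [-] r (t0 - s) (phi s)) <= k / 2).
    { apply Hd; auto; [unfold oc; lra |]; apply Rabs_def1; lra. }
    assert (A2 : vnorm (q0 s' [-] r (t0 - s) (phi s)) <= k / 2).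
    { apply Hd; auto; [unfold oc; lra |]; apply Rabs_def1; lra. }
    assert (B := vnorm_tri (r tau (phi s')) (r (t0 - s) (phi s)) (q0 s')).
    rewrite (vnorm_sub_sym (r (t0 - s) (phi s)) (q0 s')) in B; lra. }
  assert (hP : 0 <= N * rp t0 (b - 1)) by (apply Rmult_le_pos; auto using rp_ge0).
  (* Since b <= 1, the source is at most [N * rp t0 (b - 1)] beyond [t0]; [P] collects the constants
     of the boundary piece. *)
  set (P := C' * (N * rp t0 (b - 1))).
  assert (hP' : 0 <= P) by (apply Rmult_le_pos; auto).
  destruct (rcont_rp (fun _ => True) a 0 ltac:(lra) ltac:(lra) (e / 2 / (P + 1)))
    as [d2 [hd2 Hd2]]; [apply Rdiv_lt_0_compat; lra |].
  destruct (pos_min d d2) as [m1 [hm1 [hm2 hm3]]]; auto.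
  destruct (pos_min m1 (T - t0)) as [m [hm [hm4 hm5]]]; [auto | lra |].
  exists m; split; auto; intros h hh.
  assert (hhT : t0 + h <= T) by lra.
  assert (hRk : ker 1 C' R') by apply hR.
  assert (I1 := conv_spec 1 C' b N R' phi (t0 + h) ltac:(lra) hb hC' hN hRk hp
    ltac:(unfold oc; lra)).
  destruct (NI_split _ 0 t0 (t0 + h) _ ltac:(lra) I1) as [J1 [J2 [hJ1 [hJ2 E]]]].
  assert (I0 := conv_spec 1 C' b N R' phi t0 ltac:(lra) hb hC' hN hRk hp t0T).
  assert (Ir := conv_spec a C b N r phi t0 ha hb hC hN hr hp t0T).
  assert (Iq := NI_scal (/ h) _ _ _ _ (NI_sub _ _ _ _ _ _ hJ1 I0)).
  assert (B1 : vnorm (((/ h) [*] (J1 [-] conv R' phi t0)) [-] conv r phi t0) <= e / 2).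
  { apply (near (q h) q0); auto.
    - apply domq; auto; lra.
    - intros s hs; apply Hd; [lra | rewrite Rminus_0_r, Rabs_pos_eq; lra | lra]. }
  assert (B2 : vnorm J2 <= e / 2 * h).
  { assert (le : forall s, oo t0 (t0 + h) s ->
      vnorm (R' (t0 + h - s) (phi s) [-] v0) <= P * rp h a).
    { intros s hs; unfold oo in hs.
      replace (R' (t0 + h - s) (phi s) [-] v0) with (R' (t0 + h - s) (phi s)) by vring.
      eapply Rle_trans; [apply (proj1 (proj2 hR)); unfold oc; lra |].
      replace (P * rp h a) with (C' * rp h a * (N * rp t0 (b - 1))) by (unfold P; ring).
      apply Rmult_le_compat; auto using vnorm_ge0, Rmult_le_pos, rp_ge0.
      - apply Rmult_le_compat_l; auto; apply rp_incr; lra.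
      - eapply Rle_trans; [apply (proj1 hp); unfold oc; lra |].
        apply Rmult_le_compat_l; auto; apply rp_decr; lra. }
    assert (A := NI_near _ v0 _ t0 (t0 + h) _ ltac:(lra) le hJ2).
    replace (J2 [-] ((t0 + h - t0) [*] v0)) with J2 in A by vring.
    replace (t0 + h - t0) with h in A by ring.
    eapply Rle_trans; [exact A |]; apply Rmult_le_compat_r; [lra |].
    assert (A' := Hd2 h I ltac:(rewrite Rminus_0_r, Rabs_pos_eq; lra)).
    rewrite rp_zero, Rminus_0_r, Rabs_pos_eq in A' by apply rp_ge0.
    apply Rle_trans with ((P + 1) * (e / 2 / (P + 1))); [| right; field; lra].
    apply Rmult_le_compat; auto using rp_ge0; lra. }
  replace (conv R' phi (t0 + h) [-] conv R' phi t0 [-] (h [*] conv r phi t0))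
    with (J2 [+] (h [*] (((/ h) [*] (J1 [-] conv R' phi t0)) [-] conv r phi t0)))
    by (rewrite E; vfield; lra).
  eapply Rle_trans; [apply vnorm_add |]; rewrite vnorm_scal_pos by lra.
  assert (h * vnorm (((/ h) [*] (J1 [-] conv R' phi t0)) [-] conv r phi t0) <= h * (e / 2))
    by (apply Rmult_le_compat_l; lra).
  lra.
Qed.

(** The function R'(t - s) psi(s) of s is a primitive of R'(t - s) phi(s) - r(t - s) psi(s), and it
    tends to 0 at s = t because [R'] is of order t^a. *)
Lemma conv_by_parts a C C' b N N' R' r phi psi t : 0 < a <= 1 -> 0 < b <= 1 ->
  0 <= C -> 0 <= C' -> 0 <= N -> 0 <= N' -> ker a C r -> prim a C' R' r ->
  src b N phi -> src 1 N' psi ->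
  (forall s, cc 0 T s -> vcont (cc 0 T) psi s) ->
  (forall s, oo 0 T s -> rder psi s (phi s)) ->
  oc 0 T t -> conv r psi t = R' t (psi 0) [+] conv R' phi t.
Proof.
  intros ha hb hC hC' hN hN' hr hR hp hps cps dps ht.
  assert (ht' := ht); unfold oc in ht'.
  assert (hRk : ker 1 C' R') by apply hR.
  assert (I1 := conv_spec 1 C' b N R' phi t ltac:(lra) hb hC' hN hRk hp ht).
  assert (I2 := conv_spec a C 1 N' r psi t ha ltac:(lra) hC hN' hr hps ht).
  assert (I12 := NI_sub _ _ _ _ _ _ I1 I2); cbv beta in I12.
  assert (I3 : NI (fun s => R' (t - s) (phi s) [-] r (t - s) (psi s)) 0 t (v0 [-] R' t (psi 0))).
  2: { assert (E := NI_unique _ 0 t _ _ ltac:(lra) I12 I3).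
       replace (conv r psi t)
         with (conv R' phi t [-] (conv R' phi t [-] conv r psi t)) by vring.
       rewrite E; vring. }
  (* [prim] says nothing about [R'] at time 0, so the limit value at s = t is put in by hand. *)
  set (F := fun s => if Rlt_dec s t then R' (t - s) (psi s) else v0).
  assert (Flt : forall s, s < t -> F s = R' (t - s) (psi s))
    by (intros s hs; unfold F; destruct (Rlt_dec s t); [auto | lra]).
  assert (Ft : F t = v0) by (unfold F; destruct (Rlt_dec t t); [lra | auto]).
  exists F; split; [| split].
  - intros s hs e he; unfold cc in hs; destruct (Req_dec s t) as [-> | ns].
    + destruct (vcont_bounded psi 0 T cps) as [M [hM psiM]].
      destruct (rcont_rp (fun _ => True) a 0 ltac:(lra) ltac:(lra) (e / (C' * M + 1)))
        as [d [hd Hd]].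
      { apply Rdiv_lt_0_compat; auto.
        assert (0 <= C' * M) by (apply Rmult_le_pos; lra); lra. }
      assert (0 <= C' * M) by (apply Rmult_le_pos; lra).
      exists d; split; auto; intros s hs' hst; unfold cc in hs'; rewrite Ft.
      replace (F s [-] v0) with (F s) by vring.
      destruct (Req_dec s t) as [-> | ns]; [rewrite Ft, vnorm_0; lra |].
      rewrite Rabs_left in hst by lra.
      rewrite Flt by lra; eapply Rle_trans; [apply (proj1 (proj2 hR)); unfold oc; lra |].
      assert (A := Hd (t - s) I ltac:(rewrite Rminus_0_r, Rabs_pos_eq; lra)).
      rewrite rp_zero, Rminus_0_r, Rabs_pos_eq in A by apply rp_ge0.
      assert (B := psiM s ltac:(unfold cc; lra)).
      apply Rle_trans with ((C' * M + 1) * (e / (C' * M + 1))); [| right; field; lra].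
      apply Rle_trans with (C' * M * rp (t - s) a).
      * replace (C' * M * rp (t - s) a) with (C' * rp (t - s) a * M) by ring.
        apply Rmult_le_compat_l; auto; apply Rmult_le_pos; auto using rp_ge0.
      * apply Rmult_le_compat; auto using rp_ge0; lra.
    + destruct (ker_joint 1 C' R' (t - s) (psi s) ltac:(lra) hC' hRk ltac:(unfold oc; lra) e he)
        as [d [hd Hd]].
      destruct (cps s ltac:(unfold cc; lra) d hd) as [d' [hd' Hd']].
      destruct (pos_min d d' hd hd') as [m1 [hm1 [hm2 hm3]]].
      destruct (pos_min m1 (t - s) hm1) as [m [hm [hm4 hm5]]]; [lra |].
      exists m; split; auto; intros s' hs' hss; unfold cc in hs'.
      assert (hss' := hss); apply Rabs_def2 in hss'.
      rewrite !Flt by lra; apply Hd; [unfold oc; lra | apply Rabs_def1; lra |].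
      apply Hd'; [unfold cc |]; lra.
  - intros s hs e he; unfold oo in hs.
    destruct (dps s ltac:(unfold oo; lra) (e / 3 / (C' + 1))) as [d1 [hd1 Hd1]].
    { apply Rdiv_lt_0_compat; lra. }
    destruct (proj2 (proj2 hRk) (phi s) (t - s) ltac:(unfold oc; lra) (e / 3)) as [d2 [hd2 Hd2]];
      [lra |].
    destruct (proj2 (proj2 hr) (psi s) (t - s) ltac:(unfold oc; lra) (e / 3)) as [d3 [hd3 Hd3]];
      [lra |].
    destruct (pos_min d1 d2 hd1 hd2) as [m1 [hm1 [hm2 hm3]]].
    destruct (pos_min d3 (t - s) hd3) as [m2 [hm2' [hm4 hm5]]]; [lra |].
    destruct (pos_min m1 m2 hm1 hm2') as [m [hm [hm6 hm7]]].
    exists m; split; auto; intros h hh.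
    rewrite !Flt by lra.
    replace (t - (s + h)) with (t - s - h) by ring.
    assert (lR : lin (R' (t - s - h))) by (apply hRk; unfold oc; lra).
    (* Product rule with three errors: the remainder of [psi], the variation of [R'] over the step,
       and the remainder of [R'] at the fixed vector [psi s]. Each costs at most e/3 times h. *)
    replace (R' (t - s - h) (psi (s + h)) [-] R' (t - s) (psi s)
       [-] (h [*] (R' (t - s) (phi s) [-] r (t - s) (psi s))))
      with (R' (t - s - h) (psi (s + h) [-] psi s [-] (h [*] phi s))
         [+] (h [*] (R' (t - s - h) (phi s) [-] R' (t - s) (phi s)))
         [-] (R' (t - s) (psi s) [-] R' (t - s - h) (psi s)
               [-] ((t - s - (t - s - h)) [*] r (t - s) (psi s)))).
    2: { rewrite !(lin_sub (R' (t - s - h))), (proj2 lR) by auto.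
         replace (t - s - (t - s - h)) with h by ring; vring. }
    eapply Rle_trans; [apply vnorm_sub |].
    assert (A0 := vnorm_add _ (R' (t - s - h) (psi (s + h) [-] psi s [-] (h [*] phi s)))
      (h [*] (R' (t - s - h) (phi s) [-] R' (t - s) (phi s)))).
    assert (A1 : vnorm (R' (t - s - h) (psi (s + h) [-] psi s [-] (h [*] phi s))) <= e / 3 * h).
    { eapply Rle_trans; [apply (proj1 (proj2 hRk)); unfold oc; lra |].
      rewrite Rminus_diag, rp_0, Rmult_1_r by lra.
      apply Rle_trans with ((C' + 1) * (e / 3 / (C' + 1) * h)); [| right; field; lra].
      apply Rmult_le_compat; auto using vnorm_ge0; [lra | apply Hd1; lra]. }
    assert (A2 : vnorm (h [*] (R' (t - s - h) (phi s) [-] R' (t - s) (phi s))) <= e / 3 * h).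
    { rewrite vnorm_scal_pos, Rmult_comm by lra; apply Rmult_le_compat_r; [lra |].
      apply Hd2; [unfold oc; lra |]. rewrite Rabs_left; lra. }
    assert (A3 := prim_increment a C' R' r (psi s) (r (t - s) (psi s)) (e / 3) (t - s - h) (t - s)
      hR ltac:(lra) ltac:(lra)
      ltac:(intros tau htau; unfold oo in htau; apply Hd3; [unfold oc; lra |];
            rewrite Rabs_left; lra)).
    replace (t - s - (t - s - h)) with h in * by ring. lra.
  - rewrite Ft, Flt, Rminus_0_r by lra; auto.
Qed.

End Convolution.

(** * Calculus of inner products and uniform boundedness *)

Section InnerCalculus.
Context {H : Hilbert}.
Implicit Types (f g : R -> H).

Lemma rcont_inner D f g t : vcont D f t -> vcont D g t -> rcont D (fun s => inner (f s) (g s)) t.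
Proof.
  intros cf cg e he.
  assert (nf := vnorm_ge0 _ (f t)); assert (ng := vnorm_ge0 _ (g t)).
  destruct (cf (Rmin 1 (e / 2 / (vnorm (g t) + 1)))) as [d [hd Hd]].
  { apply Rmin_case; [lra | repeat apply Rdiv_lt_0_compat; lra]. }
  destruct (cg (e / 2 / (vnorm (f t) + 1))) as [d' [hd' Hd']].
  { repeat apply Rdiv_lt_0_compat; lra. }
  destruct (pos_min d d' hd hd') as [m [hm [hm1 hm2]]].
  exists m; split; auto; intros s Ds hs.
  assert (A := Hd s Ds ltac:(lra)); assert (B := Hd' s Ds ltac:(lra)).
  assert (A1 := Rle_trans _ _ _ A (Rmin_l _ _)); assert (A2 := Rle_trans _ _ _ A (Rmin_r _ _)).
  replace (inner (f s) (g s) - inner (f t) (g t))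
    with (inner (f s) (g s [-] g t) + inner (f s [-] f t) (g t)).
  2: { unfold vsub; rewrite inner_add_l, inner_add_r, inner_vopp_l, inner_vopp_r; ring. }
  eapply Rle_trans; [apply Rabs_triang |].
  assert (C1 := cauchy_schwarz (f s) (g s [-] g t)).
  assert (C2 := cauchy_schwarz (f s [-] f t) (g t)).
  assert (F := vnorm_le_sub (f s) (f t)).
  assert (vnorm (f s) * vnorm (g s [-] g t) <= (vnorm (f t) + 1) * (e / 2 / (vnorm (f t) + 1))).
  { apply Rmult_le_compat; auto using vnorm_ge0; lra. }
  assert (vnorm (f s [-] f t) * vnorm (g t) <= (e / 2 / (vnorm (g t) + 1)) * (vnorm (g t) + 1)).
  { apply Rmult_le_compat; auto using vnorm_ge0; lra. }
  replace ((vnorm (f t) + 1) * (e / 2 / (vnorm (f t) + 1))) with (e / 2) in * by (field; lra).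
  replace ((e / 2 / (vnorm (g t) + 1)) * (vnorm (g t) + 1)) with (e / 2) in * by (field; lra).
  lra.
Qed.

Lemma rder_increment f t l : rder f t l -> exists d, 0 < d /\
  forall h, 0 < h < d -> vnorm (f (t + h) [-] f t) <= (vnorm l + 1) * h.
Proof.
  intros df; destruct (df 1) as [d [hd Hd]]; [lra |].
  exists d; split; auto; intros h hh; assert (A := Hd h hh).
  assert (B := vnorm_le_sub (f (t + h) [-] f t) (h [*] l)).
  rewrite vnorm_scal_pos in B by lra. lra.
Qed.

Lemma rderR_inner f g t l k : rder f t l -> rder g t k ->
  rderR (fun s => inner (f s) (g s)) t (inner l (g t) + inner (f t) k).
Proof.
  intros df dg e he.
  assert (nf := vnorm_ge0 _ (f t)); assert (ng := vnorm_ge0 _ (g t)).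
  assert (nl := vnorm_ge0 _ l); assert (nk := vnorm_ge0 _ k).
  destruct (rder_increment g t k dg) as [d1 [hd1 H1]].
  destruct (df (e / 3 / (vnorm (g t) + 1))) as [d2 [hd2 H2]].
  { repeat apply Rdiv_lt_0_compat; lra. }
  destruct (dg (e / 3 / (vnorm (f t) + 1))) as [d3 [hd3 H3]].
  { repeat apply Rdiv_lt_0_compat; lra. }
  set (d4 := Rmin (1 / (vnorm k + 1)) (e / 3 / ((vnorm l + 1) * (vnorm k + 1)))).
  assert (hd4 : 0 < d4).
  { apply Rmin_case; repeat apply Rdiv_lt_0_compat; try lra. apply Rmult_lt_0_compat; lra. }
  destruct (pos_min d1 d2 hd1 hd2) as [m1 [hm1 [? ?]]].
  destruct (pos_min d3 d4 hd3 hd4) as [m2 [hm2 [? ?]]].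
  destruct (pos_min m1 m2 hm1 hm2) as [m [hm [? ?]]].
  exists m; split; auto; intros h hh.
  assert (A1 := H1 h ltac:(lra)); assert (A2 := H2 h ltac:(lra)); assert (A3 := H3 h ltac:(lra)).
  assert (d4 <= 1 / (vnorm k + 1) /\ d4 <= e / 3 / ((vnorm l + 1) * (vnorm k + 1)))
    by (split; [apply Rmin_l | apply Rmin_r]).
  set (Df := f (t + h) [-] f t [-] (h [*] l)) in *.
  set (Dg := g (t + h) [-] g t [-] (h [*] k)) in *.
  replace (inner (f (t + h)) (g (t + h)) - inner (f t) (g t) - h * (inner l (g t) + inner (f t) k))
    with (inner Df (g (t + h)) + inner (f t) Dg + h * inner l (g (t + h) [-] g t)).
  2: { unfold Df, Dg, vsub.
       rewrite ?inner_add_l, ?inner_add_r, ?inner_vopp_l, ?inner_vopp_r, ?inner_add_l, ?inner_add_r,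
         ?inner_vopp_l, ?inner_vopp_r, ?inner_vscal_l, ?inner_vscal_r; ring. }
  eapply Rle_trans; [apply Rabs_triang |].
  assert (B0 := Rabs_triang (inner Df (g (t + h))) (inner (f t) Dg)).
  assert (hk1 : (vnorm k + 1) * h <= 1).
  { apply Rle_trans with ((vnorm k + 1) * (1 / (vnorm k + 1))); [| right; field; lra].
    apply Rmult_le_compat_l; lra. }
  assert (G := vnorm_le_sub (g (t + h)) (g t)).
  assert (B1 : Rabs (inner Df (g (t + h))) <= e / 3 * h).
  { eapply Rle_trans; [apply cauchy_schwarz |].
    apply Rle_trans with (e / 3 / (vnorm (g t) + 1) * h * (vnorm (g t) + 1));
      [| right; field; lra].
    apply Rmult_le_compat; auto using vnorm_ge0; lra. }
  assert (B2 : Rabs (inner (f t) Dg) <= e / 3 * h).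
  { eapply Rle_trans; [apply cauchy_schwarz |].
    apply Rle_trans with ((vnorm (f t) + 1) * (e / 3 / (vnorm (f t) + 1) * h));
      [| right; field; lra].
    apply Rmult_le_compat; auto using vnorm_ge0; lra. }
  assert (B3 : Rabs (h * inner l (g (t + h) [-] g t)) <= e / 3 * h).
  { rewrite Rabs_mult, (Rabs_pos_eq h), Rmult_comm by lra; apply Rmult_le_compat_r; [lra |].
    eapply Rle_trans; [apply cauchy_schwarz |].
    apply Rle_trans with ((vnorm l + 1) * ((vnorm k + 1) * h)).
    - apply Rmult_le_compat; auto using vnorm_ge0; lra.
    - rewrite <- Rmult_assoc.
      apply Rle_trans with ((vnorm l + 1) * (vnorm k + 1)
        * (e / 3 / ((vnorm l + 1) * (vnorm k + 1)))); [| right; field; lra].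
      apply Rmult_le_compat_l; [apply Rmult_le_pos |]; lra. }
  lra.
Qed.

Lemma rder_scal_fun phi f t p (l : H) : rderR phi t p -> rder f t l ->
  rder (fun s => phi s [*] f s) t ((p [*] f t) [+] (phi t [*] l)).
Proof.
  intros dp df e he.
  assert (nl := vnorm_ge0 _ l); assert (nf := vnorm_ge0 _ (f t)).
  assert (np := Rabs_pos p); assert (nq := Rabs_pos (phi t)).
  destruct (rder_increment f t l df) as [d1 [hd1 H1]].
  destruct (df (e / 3 / (Rabs (phi t) + 1))) as [d2 [hd2 H2]]; [repeat apply Rdiv_lt_0_compat; lra |].
  destruct (dp (e / 3 / (vnorm (f t) + 1))) as [d3 [hd3 H3]]; [repeat apply Rdiv_lt_0_compat; lra |].
  assert (h4 : 0 < 1 / (vnorm l + 1)) by (apply Rdiv_lt_0_compat; lra).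
  assert (h5 : 0 < e / 3 / ((Rabs p + 1) * (vnorm l + 1))).
  { repeat apply Rdiv_lt_0_compat; try lra; apply Rmult_lt_0_compat; lra. }
  destruct (pos_min d1 d2 hd1 hd2) as [m1 [hm1 [? ?]]].
  destruct (pos_min _ _ h4 h5) as [m2 [hm2 [? ?]]].
  destruct (pos_min m1 m2 hm1 hm2) as [m3 [hm3 [? ?]]].
  destruct (pos_min m3 d3 hm3 hd3) as [m [hm [? ?]]].
  exists m; split; auto; intros h hh.
  assert (A1 := H1 h ltac:(lra)); assert (A2 := H2 h ltac:(lra)); assert (A3 := H3 h ltac:(lra)).
  replace ((phi (t + h) [*] f (t + h)) [-] (phi t [*] f t)
      [-] (h [*] ((p [*] f t) [+] (phi t [*] l))))
    with ((phi t [*] (f (t + h) [-] f t [-] (h [*] l)))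
      [+] ((phi (t + h) - phi t - h * p) [*] f (t + h))
      [+] ((h * p) [*] (f (t + h) [-] f t))) by vring.
  assert (n1 : (vnorm l + 1) * h <= 1).
  { apply Rle_trans with ((vnorm l + 1) * (1 / (vnorm l + 1))); [| right; field; lra].
    apply Rmult_le_compat_l; lra. }
  assert (F := vnorm_le_sub (f (t + h)) (f t)).
  assert (B0 := vnorm_add _ ((phi t [*] (f (t + h) [-] f t [-] (h [*] l)))
      [+] ((phi (t + h) - phi t - h * p) [*] f (t + h))) ((h * p) [*] (f (t + h) [-] f t))).
  assert (B1 := vnorm_add _ (phi t [*] (f (t + h) [-] f t [-] (h [*] l)))
    ((phi (t + h) - phi t - h * p) [*] f (t + h))).
  rewrite !vnorm_scal, Rabs_mult, (Rabs_pos_eq h) in * by lra.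
  assert (C1 : Rabs (phi t) * vnorm (f (t + h) [-] f t [-] (h [*] l)) <= e / 3 * h).
  { apply Rle_trans with ((Rabs (phi t) + 1) * (e / 3 / (Rabs (phi t) + 1) * h));
      [| right; field; lra].
    apply Rmult_le_compat; auto using vnorm_ge0; lra. }
  assert (C2 : Rabs (phi (t + h) - phi t - h * p) * vnorm (f (t + h)) <= e / 3 * h).
  { apply Rle_trans with (e / 3 / (vnorm (f t) + 1) * h * (vnorm (f t) + 1));
      [| right; field; lra].
    apply Rmult_le_compat; auto using vnorm_ge0, Rabs_pos; lra. }
  assert (C3 : h * Rabs p * vnorm (f (t + h) [-] f t) <= e / 3 * h).
  { replace (e / 3 * h) with (h * (Rabs p + 1) * ((vnorm l + 1) * (e / 3 / ((Rabs p + 1) * (vnorm l + 1)))))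
      by (field; lra).
    apply Rmult_le_compat; auto using vnorm_ge0.
    - apply Rmult_le_pos; lra.
    - apply Rmult_le_compat_l; lra.
    - eapply Rle_trans; [exact A1 |]; apply Rmult_le_compat_l; lra. }
  lra.
Qed.

Lemma rder_smul f t l : rder f t l -> rder (fun s => s [*] f s) t (f t [+] (t [*] l)).
Proof.
  intros df; replace (f t) with (1 [*] f t) by vring.
  apply (rder_scal_fun (fun s => s)); auto; intros e he; exists 1; split; [lra |]; intros h hh.
  replace (t + h - t - h * 1) with 0 by ring; rewrite Rabs_R0; nra.
Qed.

Lemma rderR_add F G t p q : rderR F t p -> rderR G t q -> rderR (fun s => F s + G s) t (p + q).
Proof.
  intros dF dG e he; destruct (dF (e / 2)) as [d [hd Hd]]; [lra |].
  destruct (dG (e / 2)) as [d' [hd' Hd']]; [lra |].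
  destruct (pos_min d d' hd hd') as [m [hm [? ?]]].
  exists m; split; auto; intros h hh.
  assert (A := Hd h ltac:(lra)); assert (B := Hd' h ltac:(lra)).
  replace (F (t + h) + G (t + h) - (F t + G t) - h * (p + q))
    with ((F (t + h) - F t - h * p) + (G (t + h) - G t - h * q)) by ring.
  eapply Rle_trans; [apply Rabs_triang |]; lra.
Qed.

Lemma rderR_scal c F t p : rderR F t p -> rderR (fun s => c * F s) t (c * p).
Proof.
  intros dF e he; assert (hc := Rabs_pos c).
  destruct (dF (e / (Rabs c + 1))) as [d [hd Hd]]; [apply Rdiv_lt_0_compat; lra |].
  exists d; split; auto; intros h hh; assert (A := Hd h hh).
  replace (c * F (t + h) - c * F t - h * (c * p)) with (c * (F (t + h) - F t - h * p)) by ring.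
  rewrite Rabs_mult.
  apply Rle_trans with ((Rabs c + 1) * (e / (Rabs c + 1) * h)); [| right; field; lra].
  apply Rmult_le_compat; try apply Rabs_pos; lra.
Qed.

Lemma rcont_add D F G t : rcont D F t -> rcont D G t -> rcont D (fun s => F s + G s) t.
Proof.
  intros cF cG e he.
  destruct (rcont_lincomb D F G 1 (-1) t cF cG e he) as [d [hd Hd]].
  exists d; split; auto; intros s Ds hs; assert (A := Hd s Ds hs).
  replace (F s + G s - (F t + G t)) with (1 * F s - -1 * G s - (1 * F t - -1 * G t)) by ring; auto.
Qed.

Lemma rcont_scal D c F t : rcont D F t -> rcont D (fun s => c * F s) t.
Proof.
  intros cF e he.
  destruct (rcont_lincomb D F F c 0 t cF cF e he) as [d [hd Hd]].
  exists d; split; auto; intros s Ds hs; assert (A := Hd s Ds hs).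
  replace (c * F s - c * F t) with (c * F s - 0 * F s - (c * F t - 0 * F t)) by ring; auto.
Qed.

End InnerCalculus.

(** * Uniform boundedness without Baire category *)

Section GlidingHump.
Context {H : Hilbert}.

(** The vectors L (x + r e) and L (x - r e) differ by 2 r L e, so one of them has norm at least r |L
    e|. *)
Lemma lin_hump (L : H -> H) x e r : lin L -> 0 < r ->
  exists x', vnorm (x' [-] x) <= r * vnorm e /\ r * vnorm (L e) <= vnorm (L x').
Proof.
  intros hL hr.
  assert (E : 2 * (r * vnorm (L e))
    <= vnorm (L (x [+] (r [*] e))) + vnorm (L (x [-] (r [*] e)))).
  { replace (2 * (r * vnorm (L e)))
      with (vnorm (L (x [+] (r [*] e)) [-] L (x [-] (r [*] e)))); [apply vnorm_sub |].
    rewrite (lin_sub L), (proj1 hL), (proj2 hL) by auto.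
    replace (L x [+] (r [*] L e) [-] (L x [-] (r [*] L e))) with ((2 * r) [*] L e) by vring.
    rewrite vnorm_scal_pos by lra; ring. }
  destruct (Rle_dec (r * vnorm (L e)) (vnorm (L (x [+] (r [*] e))))) as [h | h].
  - exists (x [+] (r [*] e)); split; auto.
    replace (x [+] (r [*] e) [-] x) with (r [*] e) by vring; rewrite vnorm_scal_pos; lra.
  - exists (x [-] (r [*] e)); split; [| lra].
    replace (x [-] (r [*] e) [-] x) with (vopp (r [*] e)) by vring.
    rewrite vnorm_opp, vnorm_scal_pos; lra.
Qed.

(** Stage k moves the current point by at most the current radius so that the image under the k-th
    operator has norm at least k. The next radius is then so small that all later moves together
    change this image by at most 1; the limit point keeps the norm k - 1. *)
Lemma gliding_hump (F : nat -> (H -> H) -> Prop) :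
  (forall k L, F k L -> lin L /\ exists C, 0 < C /\ bnd L C) ->
  (forall k M, exists L e, F k L /\ vnorm e <= 1 /\ M < vnorm (L e)) ->
  exists (Ls : nat -> H -> H) (x : H), forall k, F k (Ls k) /\ INR k - 1 <= vnorm (Ls k x).
Proof.
  intros hF unb.
  assert (step : forall k (p : H * R), exists q : (H -> H) * (H * R), 0 < snd p ->
    F k (fst q) /\ vnorm (fst (snd q) [-] fst p) <= snd p /\
    INR k <= vnorm (fst q (fst (snd q))) /\
    0 < snd (snd q) <= snd p / 2 /\
    forall y, vnorm y <= 2 * snd (snd q) -> vnorm (fst q y) <= 1).
  { intros k [x r]; simpl; destruct (Rlt_dec 0 r) as [hr |]; [| now exists (fun y => y, (x, r))].
    destruct (unb k (INR k / r)) as [L [e [hL [he hM]]]].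
    destruct (hF k L hL) as [lL [C [hC bC]]].
    destruct (lin_hump L x e r lL hr) as [x' [h1 h2]].
    (* Halving makes the sum of all later radii at most twice the new radius; the bound 1/(2C) makes
       [L] at most 1 on the ball of that doubled radius. *)
    exists (L, (x', Rmin (r / 2) (1 / (2 * C)))); simpl; intros _.
    assert (hC' : 0 < 1 / (2 * C)) by (apply Rdiv_lt_0_compat; lra).
    repeat split; auto.
    - apply Rle_trans with (r * vnorm e); auto.
      rewrite <- (Rmult_1_r r) at 2; apply Rmult_le_compat_l; lra.
    - apply Rle_trans with (r * vnorm (L e)); auto.
      apply Rle_trans with (r * (INR k / r)); [right; field; lra |].
      apply Rmult_le_compat_l; lra.
    - apply Rmin_case; lra.
    - apply Rmin_l.
    - intros y hy; eapply Rle_trans; [apply bC |].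
      apply Rle_trans with (C * (2 * (1 / (2 * C)))); [| right; field; lra].
      apply Rmult_le_compat_l; [lra |].
      assert (A := Rmin_r (r / 2) (1 / (2 * C))). lra. }
  set (st := fun k p => proj1_sig (constructive_indefinite_description _ (step k p))).
  assert (hst : forall k p, 0 < snd p ->
    F k (fst (st k p)) /\ vnorm (fst (snd (st k p)) [-] fst p) <= snd p /\
    INR k <= vnorm (fst (st k p) (fst (snd (st k p)))) /\
    0 < snd (snd (st k p)) <= snd p / 2 /\
    forall y, vnorm y <= 2 * snd (snd (st k p)) -> vnorm (fst (st k p) y) <= 1).
  { intros k p; unfold st; destruct (constructive_indefinite_description _ _); auto. }
  set (p := nat_rect (fun _ => (H * R)%type) (v0, 1) (fun k p => snd (st k p))).
  assert (pS : forall k, p (S k) = snd (st k (p k))) by reflexivity.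
  assert (rpos : forall k, 0 < snd (p k)).
  { induction k; [simpl; lra |]; rewrite pS; apply (hst k (p k) IHk). }
  (* Telescoping: a radius that is at least halved is at most twice its own decrease. *)
  assert (dist : forall k j, vnorm (fst (p (k + j)%nat) [-] fst (p k))
    <= 2 * (snd (p k) - snd (p (k + j)%nat))).
  { intros k; induction j.
    - rewrite Nat.add_0_r; replace (fst (p k) [-] fst (p k)) with (v0 : H) by vring.
      rewrite vnorm_0; lra.
    - rewrite Nat.add_succ_r, pS.
      destruct (hst (k + j)%nat (p (k + j)%nat) (rpos _)) as [_ [h1 [_ [h2 _]]]].
      assert (A := vnorm_tri (fst (snd (st (k + j)%nat (p (k + j)%nat))))
        (fst (p (k + j)%nat)) (fst (p k))). lra. }
  assert (rsmall : forall k, snd (p k) <= / INR (S k)).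
  { assert (R2 : forall k, snd (p k) <= (/ 2) ^ k).
    { induction k; [simpl; lra |]; rewrite pS.
      destruct (hst k (p k) (rpos k)) as [_ [_ [_ [h2 _]]]]; simpl; lra. }
    intros k; eapply Rle_trans; [apply R2 |]; rewrite pow_inv.
    apply Rinv_le_contravar; [apply lt_0_INR; lia |].
    clear; induction k; [simpl; lra |]; rewrite S_INR; simpl pow.
    assert (1 <= INR (S k)) by (rewrite S_INR; generalize (pos_INR k); lra). lra. }
  destruct (vlim_seq (fun k => fst (p k))) as [x Hx].
  { intros e he; destruct (archimed_cor1 (e / 4)) as [N [hN hN0]]; [lra |].
    exists N.
    assert (near : forall n, (N <= n)%nat -> vnorm (fst (p n) [-] fst (p N)) <= e / 2).
    { intros n hn; replace n with (N + (n - N))%nat by lia.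
      eapply Rle_trans; [apply dist |].
      assert (A := rpos (N + (n - N))%nat); assert (B := rsmall N).
      assert (/ INR (S N) <= / INR N)
        by (apply Rinv_le_contravar; [apply lt_0_INR | apply le_INR]; lia). lra. }
    intros n m hn hm; eapply Rle_trans; [apply (vnorm_tri _ (fst (p N))) |].
    rewrite (vnorm_sub_sym (fst (p N))).
    assert (A := near n hn); assert (B := near m hm). lra. }
  exists (fun k => fst (st k (p k))), x; intros k.
  destruct (hst k (p k) (rpos k)) as [h0 [_ [h1 [h2 h3]]]]; split; auto.
  rewrite <- pS in *.
  assert (near : vnorm (fst (p (S k)) [-] x) <= 2 * snd (p (S k))).
  { apply le_epsilon; intros e he; destruct (Hx e he) as [N HN].
    eapply Rle_trans; [apply (vnorm_tri _ (fst (p (S k + N)%nat))) |].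
    assert (A := HN (S k + N)%nat ltac:(lia)).
    assert (B := dist (S k) N); rewrite vnorm_sub_sym in B.
    assert (C := rpos (S k + N)%nat). lra. }
  assert (A := h3 _ near); destruct (hF _ _ h0) as [lL _].
  rewrite lin_sub in A by auto.
  assert (B := vnorm_le_sub (fst (st k (p k)) (fst (p (S k)))) (fst (st k (p k)) x)). lra.
Qed.

End GlidingHump.

(** * The semigroup *)

(** From here on statements about A are phrased through the bounded operator K = A^-1: an element of
    the domain is some [K w], and the relation y = A x is written x = K y. The last field is the
    density of the domain of A. *)
Record inverse_op {H : Hilbert} (A : operator H) (K : H -> H) : Prop := {
  inv_dom : forall x, dom A (K x);
  inv_r : forall x, A (K x) = x;
  inv_l : forall w, dom A w -> K (A w) = w;
  inv_lin : lin K;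
  inv_sym : forall x y, inner (K x) y = inner x (K y);
  inv_pos : forall x, 0 <= inner (K x) x;
  inv_bnd : exists C, 0 < C /\ bnd K C;
  inv_dense : forall x e, 0 < e -> exists w, vnorm (x [-] K w) <= e
}.

Lemma inv_inj {H : Hilbert} (A : operator H) K x y : inverse_op A K -> K x = K y -> x = y.
Proof. intros h E; rewrite <- (inv_r A K h x), E; now apply inv_r. Qed.

Lemma inverse_exists {H : Hilbert} (A : operator H) :
  self_adjoint A -> positive_definite A -> has_compact_inverse A ->
  exists K, inverse_op A K.
Proof.
  intros [[A0 [Aadd Ascal]] [Ad Asa]] Ap [K [Kr [Kl Kc]]]; exists K.
  assert (Klin : lin K).
  { split.
    - intros x y; destruct (Kr x) as [dx ex], (Kr y) as [dy ey].
      destruct (Aadd _ _ dx dy) as [d e].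
      rewrite ex, ey in e; unfold vadd; rewrite <- e; now apply Kl.
    - intros a x; destruct (Kr x) as [dx ex], (Ascal a _ dx) as [d e].
      rewrite ex in e; unfold vscal; rewrite <- e; now apply Kl. }
  assert (Asym : forall x y, dom A x -> dom A y -> inner (A x) y = inner x (A y)).
  { intros x y dx dy; apply (Asa y (A y)); auto. }
  constructor; auto.
  - intros x; apply Kr.
  - intros x; apply Kr.
  - intros x y; rewrite <- (proj2 (Kr y)) at 1; rewrite <- (proj2 (Kr x)) at 2.
    symmetry; apply Asym; apply Kr.
  - intros x; destruct (excluded_middle_informative (K x = v0)) as [-> | n].
    + rewrite inner_v0_l; lra.
    + rewrite <- (proj2 (Kr x)) at 2; rewrite inner_sym; left; apply Ap; auto; apply Kr.
  (* If [K] were unbounded, there would be [x n] in the unit ball with |K (x n)| > n, but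
     compactness yields a subsequence whose images converge and hence stay bounded. *)
  - apply NNPP; intros nb.
    assert (unb : forall n, exists x, vnorm x <= 1 /\ INR n < vnorm (K x)).
    { intros n; apply NNPP; intros nx; apply nb; exists (INR n + 1).
      assert (hn := pos_INR n); split; [lra |]; intros x.
      destruct (excluded_middle_informative (x = v0)) as [-> | n0].
      { rewrite lin_0, vnorm_0 by auto; lra. }
      assert (hx : 0 < vnorm x) by (apply norm_gt_0; exact n0).
      assert (E : vnorm (K ((/ vnorm x) [*] x)) <= INR n).
      { apply Rnot_lt_le; intros h; apply nx; exists ((/ vnorm x) [*] x); split; auto.
        rewrite vnorm_scal_pos, Rinv_l by (try (left; apply Rinv_0_lt_compat); lra); lra. }
      rewrite (proj2 Klin), vnorm_scal_pos in E by (left; apply Rinv_0_lt_compat; lra).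
      apply Rmult_le_compat_l with (r := vnorm x) in E; [| lra].
      rewrite <- Rmult_assoc, Rinv_r, Rmult_1_l in E by lra.
      assert (0 <= vnorm x) by lra. lra. }
    destruct (choice _ unb) as [x hx].
    destruct (Kc x 1 (fun n => proj1 (hx n))) as [phi [l [inc lim]]].
    assert (big : forall n, (n <= phi n)%nat).
    { induction n; [lia |]; generalize (inc n); lia. }
    assert (L := proj1 (filterlim_locally_ball_norm (F := eventually)
      (fun n => K (x (phi n)) : hspace H) l) lim (mkposreal 1 Rlt_0_1)).
    destruct L as [N HN].
    destruct (INR_unbounded (vnorm l + 1)) as [M hM].
    set (n := (N + M)%nat).
    assert (P := HN n ltac:(unfold n; lia)); unfold ball_norm in P; simpl in P.
    change (vnorm (K (x (phi n)) [-] l) < 1) in P.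
    assert (Q := proj2 (hx (phi n))).
    assert (INR M <= INR (phi n)) by (apply le_INR; generalize (big n); unfold n; lia).
    assert (B := vnorm_le_sub (K (x (phi n))) l). lra.
  - intros x e he; destruct (Ad x e he) as [y [dy hy]].
    exists (A y); rewrite Kl by auto; left; exact hy.
Qed.

(* The properties of the semigroup generated by [-A] in terms of [K = A^-1];
   [sg_smooth] says that [A E(t)] is bounded by [1/t]. *)
Record semigroup {H : Hilbert} (K : H -> H) (E : R -> H -> H) : Prop := {
  sg_lin : forall t, 0 <= t -> lin (E t);
  sg_contr : forall t, 0 <= t -> bnd (E t) 1;
  sg_0 : forall x, E 0 x = x;
  sg_add : forall s t x, 0 <= s -> 0 <= t -> E (s + t) x = E s (E t x);
  sg_cont : forall x t, 0 <= t -> vcont (fun s => 0 <= s) (fun s => E s x) t;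
  sg_comm : forall t x, 0 <= t -> E t (K x) = K (E t x);
  sg_der : forall x t, 0 <= t -> rder (fun s => E s (K x)) t (vopp (E t x));
  sg_smooth : forall t x, 0 < t -> exists y, K y = E t x /\ vnorm y <= / t * vnorm x
}.

Section Generation.
Context {H : Hilbert} (A : operator H) (K : H -> H) (E : R -> H -> H).
Context (hK : inverse_op A K) (hE : semigroup_generated_by (opp_op A) E).

Lemma at_right_eps (f : R -> H) (l : H) :
  filterlim f (at_right 0) (locally l) <->
  forall e, 0 < e -> exists d, 0 < d /\ forall h, 0 < h < d -> vnorm (f h [-] l) <= e.
Proof.
  assert (F := filterlim_locally_ball_norm (F := at_right 0) (f : R -> hspace H) l).
  split.
  - intros h e he; destruct (proj1 F h (mkposreal e he)) as [d Hd].
    exists d; split; [apply cond_pos |]; intros k hk; left; apply (Hd k); [| exact (proj1 hk)].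
    change (Rabs (k - 0) < d); rewrite Rabs_pos_eq; lra.
  - intros h; apply F; intros e; destruct (h (e / 2)) as [d [hd Hd]]; [destruct e; simpl; lra |].
    exists (mkposreal d hd); intros k hk k0.
    change (Rabs (k - 0) < d) in hk; rewrite Rabs_pos_eq in hk by lra.
    assert (B : vnorm (f k [-] l) <= e / 2) by (apply Hd; lra).
    apply Rle_lt_trans with (e / 2); [exact B |].
    destruct e; simpl; lra.
Qed.

Let E_lin : forall t, 0 <= t -> lin (E t).
Proof. intros t ht; destruct hE as [h _]; destruct (h t ht); now split. Qed.

Let E_bnd : forall t, 0 <= t -> exists M, 0 < M /\ bnd (E t) M.
Proof. intros t ht; destruct hE as [h _]; destruct (h t ht) as [_ _ hM]; exact hM. Qed.

Let E_0 : forall x, E 0 x = x.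
Proof. apply hE. Qed.

Let E_add : forall s t x, 0 <= s -> 0 <= t -> E (s + t) x = E s (E t x).
Proof. apply hE. Qed.

Let E_right : forall x e, 0 < e -> exists d, 0 < d /\ forall h, 0 < h < d -> vnorm (E h x [-] x) <= e.
Proof. intros x; apply at_right_eps, hE. Qed.

Let E_gen_quot : forall w e, 0 < e -> exists d, 0 < d /\ forall h, 0 < h < d ->
  vnorm (((/ h) [*] (E h (K w) [-] K w)) [-] vopp w) <= e.
Proof.
  intros w; apply at_right_eps.
  destruct hE as [_ [_ [_ [_ g]]]]; apply (proj2 (g (K w) (vopp w))).
  split; [apply (inv_dom A K hK) |]; simpl.
  now rewrite (inv_r A K hK).
Qed.

Let E_gen : forall w e, 0 < e -> exists d, 0 < d /\ forall h, 0 < h < d ->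
  vnorm (E h (K w) [-] K w [-] (h [*] vopp w)) <= e * h.
Proof.
  intros w e he; destruct (E_gen_quot w e he) as [d [hd Hd]].
  exists d; split; auto; intros h hh; assert (B := Hd h hh).
  replace (E h (K w) [-] K w [-] (h [*] vopp w))
    with (h [*] (((/ h) [*] (E h (K w) [-] K w)) [-] vopp w)) by (vfield; lra).
  rewrite vnorm_scal_pos, Rmult_comm by lra; apply Rmult_le_compat_r; lra.
Qed.

(** E(t) commutes with the difference quotients at 0, so those of [E t (K w)] converge to -E(t) w.
    Because the generator has exactly the domain of A, this puts [E t (K w)] in that domain and
    gives A E(t) K w = E(t) w. *)
Let E_comm : forall t x, 0 <= t -> E t (K x) = K (E t x).
Proof.
  intros t w ht; destruct (E_bnd t ht) as [M [hM bM]].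
  assert (lE := E_lin t ht).
  assert (G : dom A (E t (K w)) /\ vopp (A (E t (K w))) = vopp (E t w)).
  { destruct hE as [_ [_ [_ [_ g]]]]; apply (proj1 (g (E t (K w)) (vopp (E t w)))).
    apply at_right_eps; intros e he.
    destruct (E_gen_quot w (e / M)) as [d [hd Hd]]; [now apply Rdiv_lt_0_compat |].
    exists d; split; auto; intros h hh; assert (B := Hd h hh).
    change (vnorm (((/ h) [*] (E h (E t (K w)) [-] E t (K w))) [-] vopp (E t w)) <= e).
    rewrite <- E_add, Rplus_comm, E_add by lra.
    replace (vopp (E t w)) with (E t (vopp w)).
    2: { replace (vopp w) with ((-1) [*] w) by vring; rewrite (proj2 lE); vring. }
    rewrite <- (lin_sub (E t)), <- (proj2 lE), <- (lin_sub (E t)) by auto.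
    eapply Rle_trans; [apply bM |].
    apply Rle_trans with (M * (e / M)); [| right; field; lra].
    apply Rmult_le_compat_l; lra. }
  destruct G as [dG eG].
  assert (eG' : A (E t (K w)) = E t w).
  { replace (A (E t (K w))) with (vopp (vopp (A (E t (K w))))) by vring.
    rewrite eG; vring. }
  now rewrite <- eG', (inv_l A K hK).
Qed.

(** Otherwise [gliding_hump] gives one vector [x] and times h_k <= 1/(k + 1) along which |E(h_k) x|
    is unbounded, against the continuity of the orbit at 0. *)
Let E_loc_bnd : exists d M, 0 < d /\ 0 < M /\ forall h, 0 <= h <= d -> bnd (E h) M.
Proof.
  apply NNPP; intros n.
  destruct (gliding_hump (fun k L => exists h, 0 <= h <= / INR (S k) /\ L = E h))
    as [Ls [x Hx]].
  - intros k L [h [hh ->]]; split; [apply E_lin | apply E_bnd]; lra.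
  - intros k M; apply NNPP; intros nM; apply n.
    assert (hk : 0 < / INR (S k)) by (apply Rinv_0_lt_compat, lt_0_INR; lia).
    exists (/ INR (S k)), (Rabs M + 1); assert (hM := Rabs_pos M); repeat split; auto; [lra |].
    intros h hh x; destruct (excluded_middle_informative (x = v0)) as [-> | nx].
    { rewrite lin_0, vnorm_0 by (apply E_lin; lra); lra. }
    assert (hx : 0 < vnorm x) by (apply norm_gt_0; exact nx).
    assert (hi : 0 <= / vnorm x) by (left; now apply Rinv_0_lt_compat).
    assert (B : vnorm (E h ((/ vnorm x) [*] x)) <= M).
    { apply Rnot_lt_le; intros lt; apply nM; exists (E h), ((/ vnorm x) [*] x); repeat split; auto.
      - now exists h.
      - rewrite vnorm_scal_pos, Rinv_l; lra. }
    rewrite (proj2 (E_lin h ltac:(lra))), vnorm_scal_pos in B by auto.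
    apply Rmult_le_compat_l with (r := vnorm x) in B; [| lra].
    rewrite <- Rmult_assoc, Rinv_r, Rmult_1_l in B by lra.
    eapply Rle_trans; [exact B |]; rewrite Rmult_comm; apply Rmult_le_compat_r; [lra |].
    generalize (Rle_abs M); lra.
  - destruct (E_right x 1) as [d [hd Hd]]; [lra |].
    destruct (archimed_cor1 d hd) as [N [hN hN0]].
    destruct (INR_unbounded (vnorm x + 3)) as [M hM].
    destruct (Hx (N + M)%nat) as [[h [hh eL]] hL]; rewrite eL in hL.
    assert (hd' : h < d).
    { apply Rle_lt_trans with (/ INR (S (N + M))); [lra |].
      apply Rle_lt_trans with (/ INR N); auto.
      apply Rinv_le_contravar; [apply lt_0_INR; lia | apply le_INR; lia]. }
    assert (INR M <= INR (N + M)) by (apply le_INR; lia).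
    destruct (Req_dec h 0) as [-> | nh]; [rewrite E_0 in hL; lra |].
    assert (B := Hd h ltac:(lra)). assert (C := vnorm_le_sub (E h x) x). lra.
Qed.

Let E_cont : forall x t, 0 <= t -> vcont (fun s => 0 <= s) (fun s => E s x) t.
Proof.
  intros x t ht e he.
  destruct (E_bnd t ht) as [Mt [hMt bMt]].
  destruct E_loc_bnd as [d0 [M0 [hd0 [hM0 bM0]]]].
  (* Left continuity factors out E(s) with s varying below [t], so a bound uniform in s is needed:
     E(t - h) = E(d0 - h) E(t - d0), with the first factor covered by the local bound. *)
  assert (left_bnd : exists M, 0 < M /\ forall h, 0 < h < d0 -> h <= t -> bnd (E (t - h)) M).
  { destruct (Rle_dec t d0) as [le | nle].
    - exists M0; split; auto; intros h hh hht; apply bM0; lra.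
    - destruct (E_bnd (t - d0)) as [M1 [hM1 bM1]]; [lra |].
      exists (M0 * M1); split; [now apply Rmult_lt_0_compat |].
      intros h hh hht y; replace (t - h) with ((d0 - h) + (t - d0)) by ring.
      rewrite E_add by lra; eapply Rle_trans; [apply bM0; lra |].
      rewrite Rmult_assoc; apply Rmult_le_compat_l; [lra | apply bM1]. }
  destruct left_bnd as [M [hM bM]].
  destruct (E_right x (e / (Mt + M))) as [d1 [hd1 H1]]; [apply Rdiv_lt_0_compat; lra |].
  assert (fin : forall h N, 0 < N <= Mt + M -> 0 < h < d1 -> N * vnorm (E h x [-] x) <= e).
  { intros h N hN hh; apply Rle_trans with ((Mt + M) * (e / (Mt + M))); [| right; field; lra].
    apply Rmult_le_compat; auto using vnorm_ge0; lra. }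
  destruct (pos_min d0 d1 hd0 hd1) as [d [hd [? ?]]].
  exists d; split; auto; intros s hs hst.
  destruct (Rtotal_order s t) as [lt | [-> | gt]].
  - rewrite Rabs_left in hst by lra.
    replace (E s x [-] E t x) with (vopp (E s (E (t - s) x [-] x))).
    2: { rewrite (lin_sub (E s)), <- E_add by (try apply E_lin; lra).
         replace (s + (t - s)) with t by ring; vring. }
    rewrite vnorm_opp; replace s with (t - (t - s)) at 1 by ring.
    eapply Rle_trans; [apply bM; lra |]; apply fin; lra.
  - replace (E t x [-] E t x) with (v0 : H) by vring; rewrite vnorm_0; lra.
  - rewrite Rabs_pos_eq in hst by lra.
    replace (E s x [-] E t x) with (E t (E (s - t) x [-] x)).
    2: { rewrite (lin_sub (E t)), <- E_add by (try apply E_lin; lra).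
         now replace (t + (s - t)) with s by ring. }
    eapply Rle_trans; [apply bMt |]; apply fin; lra.
Qed.

Let E_der : forall x t, 0 <= t -> rder (fun s => E s (K x)) t (vopp (E t x)).
Proof.
  intros x t ht e he; destruct (E_bnd t ht) as [M [hM bM]]; assert (lE := E_lin t ht).
  destruct (E_gen x (e / M)) as [d [hd Hd]]; [now apply Rdiv_lt_0_compat |].
  exists d; split; auto; intros h hh; assert (B := Hd h hh).
  replace (E (t + h) (K x) [-] E t (K x) [-] (h [*] vopp (E t x)))
    with (E t (E h (K x) [-] K x [-] (h [*] vopp x))).
  2: { rewrite !(lin_sub (E t)), <- E_add, (proj2 lE) by (auto; lra).
       replace (vopp x) with ((-1) [*] x) by vring; rewrite (proj2 lE); vring. }
  eapply Rle_trans; [apply bM |].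
  apply Rle_trans with (M * (e / M * h)); [| right; field; lra].
  apply Rmult_le_compat_l; lra.
Qed.

Let vcontE : forall x a b t, 0 <= a -> cc a b t -> vcont (cc a b) (fun s => E s x) t.
Proof.
  intros x a b t ha ht; unfold cc in ht.
  apply (vcont_sub (fun s => 0 <= s)); [unfold cc; intros; lra | apply E_cont; lra].
Qed.

(** Energy estimate: for y = E(s) K w the derivative of |y|^2 is -2 (Ay, y) <= 0. Starting in the
    range of [K] makes the orbit differentiable; density then removes this restriction in
    [E_contr]. *)
Let E_contr_range : forall t w, 0 <= t -> vnorm (E t (K w)) <= vnorm (K w).
Proof.
  intros t w ht.
  assert (M : (-1) * inner (E 0 (K w)) (E 0 (K w)) <= (-1) * inner (E t (K w)) (E t (K w))).
  { apply (monotone_rder (H := H) (fun s => (-1) * inner (E s (K w)) (E s (K w)))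
      (fun s => (-1) * (inner (vopp (E s w)) (E s (K w)) + inner (E s (K w)) (vopp (E s w))))
      0 t ht).
    - intros s hs; apply rcont_scal, (rcont_inner _ (fun s => E s (K w)) (fun s => E s (K w)));
        apply vcontE; auto; lra.
    - intros s hs; unfold oo in hs; apply rderR_scal, (rderR_inner (fun s => E s (K w)) (fun s => E s (K w)));
        apply E_der; lra.
    - intros s hs; unfold oo in hs; rewrite inner_vopp_l, inner_vopp_r, E_comm by lra.
      rewrite (inner_sym _ (E s w)); assert (B := inv_pos A K hK (E s w)); lra. }
  rewrite E_0, <- !norm_sqr in M.
  apply Rnot_lt_le; intros lt; assert (B := vnorm_ge0 _ (K w)). nra.
Qed.

Let E_contr : forall t, 0 <= t -> bnd (E t) 1.
Proof.
  intros t ht x; rewrite Rmult_1_l; destruct (E_bnd t ht) as [M [hM bM]].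
  apply le_epsilon; intros e he.
  destruct (inv_dense A K hK x (e / (M + 1))) as [w hw]; [apply Rdiv_lt_0_compat; lra |].
  assert (B1 := vnorm_le_sub (E t x) (E t (K w))).
  rewrite <- (lin_sub (E t)) in B1 by auto.
  assert (B2 := bM (x [-] K w)). assert (B3 := E_contr_range t w ht).
  assert (B4 := vnorm_le_sub (K w) x). rewrite (vnorm_sub_sym (K w) x) in B4.
  assert (M * vnorm (x [-] K w) + vnorm (x [-] K w) <= (M + 1) * (e / (M + 1))).
  { replace (M * vnorm (x [-] K w) + vnorm (x [-] K w)) with ((M + 1) * vnorm (x [-] K w)) by ring.
    apply Rmult_le_compat_l; lra. }
  replace ((M + 1) * (e / (M + 1))) with e in * by (field; lra). lra.
Qed.

(* For [y = E(t) K^2 w], the function [|y|^2 + 2 t (Ay, y) + 2 t^2 |Ay|^2] is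
   nonincreasing. *)
Let E_smooth_range : forall t w, 0 < t -> vnorm (E t (K w)) <= / t * vnorm (K (K w)).
Proof.
  intros t w ht.
  set (y := fun s => E s (K (K w))). set (z := fun s => E s (K w)).
  set (phi := fun s => inner (y s) (y s)
    + (2 * inner (s [*] z s) (y s) + 2 * inner (s [*] z s) (s [*] z s))).
  assert (M : (-1) * phi 0 <= (-1) * phi t).
  { apply (monotone_rder (H := H) (fun s => (-1) * phi s)
      (fun s => (-1) * ((inner (vopp (z s)) (y s) + inner (y s) (vopp (z s)))
        + (2 * (inner (z s [+] (s [*] vopp (E s w))) (y s) + inner (s [*] z s) (vopp (z s)))
        + 2 * (inner (z s [+] (s [*] vopp (E s w))) (s [*] z s)
             + inner (s [*] z s) (z s [+] (s [*] vopp (E s w)))))))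
      0 t ltac:(lra)).
    - intros s hs.
      assert (cy : vcont (cc 0 t) y s) by (apply vcontE; auto; lra).
      assert (cz : vcont (cc 0 t) (fun s => s [*] z s) s).
      { apply vcont_scal; [| apply vcontE; auto; lra].
        intros e he; exists e; split; auto; intros; lra. }
      apply rcont_scal, rcont_add; [now apply (rcont_inner _ y y) |].
      apply rcont_add; apply rcont_scal;
        [apply (rcont_inner _ (fun s => s [*] z s) y)
        | apply (rcont_inner _ (fun s => s [*] z s) (fun s => s [*] z s))]; auto.
    - intros s hs; unfold oo in hs.
      assert (dy : rder y s (vopp (z s))) by (apply E_der; lra).
      assert (dz : rder (fun s => s [*] z s) s (z s [+] (s [*] vopp (E s w)))).
      { apply rder_smul, E_der; lra. }
      apply rderR_scal, rderR_add; [now apply (rderR_inner y y) |].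
      apply rderR_add; apply rderR_scal;
        [apply (rderR_inner (fun s => s [*] z s) y)
        | apply (rderR_inner (fun s => s [*] z s) (fun s => s [*] z s))]; auto.
    - intros s hs; unfold oo in hs.
      assert (ez : z s = K (E s w)) by (apply E_comm; lra).
      assert (ey : y s = K (z s)) by (unfold y, z; apply E_comm; lra).
      rewrite ?inner_add_l, ?inner_add_r, ?inner_vscal_l, ?inner_vscal_r, ?inner_add_l,
        ?inner_vopp_l, ?inner_vopp_r, ?inner_vscal_l, ?inner_vscal_r, ?inner_vopp_l, ?inner_vopp_r.
      assert (e1 : inner (E s w) (y s) = inner (z s) (z s))
        by (rewrite ey, <- (inv_sym A K hK), <- ez; auto).
      assert (e2 := inner_sym _ (y s) (z s)). assert (e3 := inner_sym _ (E s w) (z s)).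
      assert (e4 : 0 <= inner (z s) (E s w)) by (rewrite ez; apply (inv_pos A K hK)).
      rewrite e1, e2, e3.
      assert (0 <= s * s * inner (z s) (E s w)) by (apply Rmult_le_pos; nra).
      nra. }
  assert (p0 : phi 0 = vnorm (K (K w)) * vnorm (K (K w))).
  { unfold phi, y; rewrite !inner_vscal_l, E_0, norm_sqr; ring. }
  assert (pt : 2 * (t * vnorm (z t)) * (t * vnorm (z t)) <= phi t).
  { unfold phi.
    assert (ez : y t = K (z t)) by (unfold y, z; apply E_comm; lra).
    assert (0 <= inner (y t) (y t)) by apply inner_pos.
    assert (0 <= inner (z t) (y t)) by (rewrite ez, inner_sym; apply (inv_pos A K hK)).
    rewrite !inner_vscal_l, inner_vscal_r, <- (norm_sqr _ (z t)).
    assert (0 <= t * inner (z t) (y t)) by (apply Rmult_le_pos; lra). lra. }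
  assert (n1 := vnorm_ge0 _ (K (K w))). assert (n2 := vnorm_ge0 _ (z t)).
  assert (le : t * vnorm (z t) <= vnorm (K (K w))).
  { apply Rnot_lt_le; intros lt.
    assert (vnorm (K (K w)) * vnorm (K (K w)) < (t * vnorm (z t)) * (t * vnorm (z t)))
      by (apply Rmult_le_0_lt_compat; auto).
    assert (0 <= (t * vnorm (z t)) * (t * vnorm (z t))) by apply Rle_0_sqr. lra. }
  apply Rmult_le_reg_l with t; auto.
  rewrite <- Rmult_assoc, Rinv_r, Rmult_1_l by lra; exact le.
Qed.

(** Closedness of A. For K (K w_n) tending to [x], the vectors A E(t) K (K w_n) = E(t) K w_n form a
    Cauchy sequence by [E_smooth_range], and [K] maps their limit to E(t) x. The range of K^2 is
    used because the energy argument differentiates E(s) K w as well. *)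
Let E_smooth : forall t x, 0 < t -> exists y, K y = E t x /\ vnorm y <= / t * vnorm x.
Proof.
  intros t x ht.
  assert (it : 0 < / t) by now apply Rinv_0_lt_compat.
  destruct (inv_bnd A K hK) as [C [hC bC]]. assert (lK := inv_lin A K hK).
  assert (app : forall n, exists w, vnorm (x [-] K (K w)) <= / INR (S n)).
  { intros n; assert (hn : 0 < / INR (S n)) by (apply Rinv_0_lt_compat, lt_0_INR; lia).
    destruct (inv_dense A K hK x (/ INR (S n) / 2)) as [w hw]; [lra |].
    destruct (inv_dense A K hK w (/ INR (S n) / 2 / C)) as [v hv]; [apply Rdiv_lt_0_compat; lra |].
    exists v; eapply Rle_trans; [apply (vnorm_tri _ (K w)) |].
    rewrite <- (lin_sub K) by auto.
    assert (B := bC (w [-] K v)).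
    assert (C * vnorm (w [-] K v) <= C * (/ INR (S n) / 2 / C)) by (apply Rmult_le_compat_l; lra).
    set (i := / INR (S n)) in *.
    replace (C * (i / 2 / C)) with (i / 2) in * by (field; lra). lra. }
  destruct (choice _ app) as [w hw].
  assert (small : forall e, 0 < e -> exists N, forall n, (N <= n)%nat -> / INR (S n) <= e).
  { intros e he; destruct (archimed_cor1 e he) as [N [hN hN0]]; exists N; intros n hn.
    apply Rle_trans with (/ INR N); [| lra].
    apply Rinv_le_contravar; [apply lt_0_INR | apply le_INR]; lia. }
  destruct (vlim_seq (fun n => E t (K (w n)))) as [y Hy].
  { intros e he; destruct (small (e / 2 * t)) as [N HN]; [apply Rmult_lt_0_compat; lra |].
    exists N; intros n m hn hm.
    rewrite <- (lin_sub (E t)), <- (lin_sub K) by (auto; apply E_lin; lra).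
    eapply Rle_trans; [apply E_smooth_range; auto |].
    rewrite !(lin_sub K) by auto.
    assert (B := vnorm_tri (K (K (w n))) x (K (K (w m)))).
    rewrite (vnorm_sub_sym (K (K (w n))) x) in B.
    assert (h1 := hw n); assert (h2 := hw m); assert (h3 := HN n hn); assert (h4 := HN m hm).
    apply Rle_trans with (/ t * (e * t)); [| right; field; lra].
    apply Rmult_le_compat_l; lra. }
  exists y; split.
  - apply vnorm_small_eq; intros e he.
    destruct (Hy (e / 2 / C)) as [N1 H1]; [repeat apply Rdiv_lt_0_compat; lra |].
    destruct (small (e / 2)) as [N2 H2]; [lra |].
    set (n := (N1 + N2)%nat).
    assert (B1 := H1 n ltac:(unfold n; lia)); assert (B2 := H2 n ltac:(unfold n; lia)).
    eapply Rle_trans; [apply (vnorm_tri _ (K (E t (K (w n))))) |].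
    rewrite <- (lin_sub K), <- (E_comm t (K (w n))), <- (lin_sub (E t)) by (auto; try apply E_lin; lra).
    assert (B3 := bC (y [-] E t (K (w n)))).
    assert (B4 := E_contr t ltac:(lra) (K (K (w n)) [-] x)).
    rewrite vnorm_sub_sym in B1. rewrite (vnorm_sub_sym _ x) in B4.
    assert (h1 := hw n).
    assert (C * vnorm (y [-] E t (K (w n))) <= C * (e / 2 / C)) by (apply Rmult_le_compat_l; lra).
    replace (C * (e / 2 / C)) with (e / 2) in * by (field; lra). lra.
  - apply le_epsilon; intros e he.
    destruct (Hy (e / 2)) as [N1 H1]; [lra |].
    destruct (small (e / 2 * t)) as [N2 H2]; [apply Rmult_lt_0_compat; lra |].
    set (n := (N1 + N2)%nat).
    assert (B1 := H1 n ltac:(unfold n; lia)); assert (B2 := H2 n ltac:(unfold n; lia)).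
    assert (h1 := hw n).
    assert (B3 := vnorm_le_sub y (E t (K (w n)))); rewrite vnorm_sub_sym in B1.
    assert (B4 := E_smooth_range t (w n) ht).
    assert (B5 := vnorm_le_sub (K (K (w n))) x); rewrite (vnorm_sub_sym _ x) in B5.
    assert (/ t * vnorm (K (K (w n))) <= / t * (vnorm x + e / 2 * t))
      by (apply Rmult_le_compat_l; lra).
    replace (/ t * (vnorm x + e / 2 * t)) with (/ t * vnorm x + e / 2) in * by (field; lra). lra.
Qed.

Lemma generated_semigroup : semigroup K E.
Proof. constructor; auto. Qed.

End Generation.

(** * The parabolic problem with a singular source *)

Section Parabolic.
Context {H : Hilbert} (A : operator H) (K : H -> H) (E : R -> H -> H) (T : R).
Context (hK : inverse_op A K) (hE : semigroup K E).

(** Initial conditions are stated as limits at 0 from the right, since functions obtained by choice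
    are controlled only on (0, T]. *)
Definition vanishes (z : R -> H) := forall e, 0 < e -> exists d, 0 < d /\
  forall t, oc 0 T t -> t < d -> vnorm (z t) <= e.

Lemma vanishes_rp a N (z : R -> H) : 0 < a -> 0 <= N ->
  (forall t, oc 0 T t -> vnorm (z t) <= N * rp t a) -> vanishes z.
Proof.
  intros ha hN le e he.
  destruct (rcont_rp (fun _ => True) a 0 ha ltac:(lra) (e / (N + 1))) as [d [hd Hd]].
  { apply Rdiv_lt_0_compat; lra. }
  exists d; split; auto; intros t ht htd; unfold oc in ht.
  assert (B := Hd t I ltac:(rewrite Rminus_0_r, Rabs_pos_eq; lra)).
  rewrite rp_zero, Rminus_0_r, Rabs_pos_eq in B by apply rp_ge0.
  eapply Rle_trans; [apply le; unfold oc; lra |].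
  apply Rle_trans with ((N + 1) * (e / (N + 1))); [| right; field; lra].
  apply Rmult_le_compat; auto using rp_ge0; lra.
Qed.

Lemma vanishes_add (y z : R -> H) : vanishes y -> vanishes z -> vanishes (fun t => y t [+] z t).
Proof.
  intros hy hz e he; destruct (hy (e / 2)) as [d [hd Hd]]; [lra |].
  destruct (hz (e / 2)) as [d' [hd' Hd']]; [lra |].
  destruct (pos_min d d' hd hd') as [m [hm [? ?]]].
  exists m; split; auto; intros t ht htm.
  assert (B := vnorm_add _ (y t) (z t)).
  assert (B1 := Hd t ht ltac:(lra)); assert (B2 := Hd' t ht ltac:(lra)). lra.
Qed.

Lemma vanishes_lin (L : H -> H) C (z : R -> H) : 0 < C -> bnd L C -> vanishes z ->
  vanishes (fun t => L (z t)).
Proof.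
  intros hC bL hz e he; destruct (hz (e / C)) as [d [hd Hd]]; [now apply Rdiv_lt_0_compat |].
  exists d; split; auto; intros t ht htd; eapply Rle_trans; [apply bL |].
  apply Rle_trans with (C * (e / C)); [| right; field; lra].
  apply Rmult_le_compat_l; [lra | auto].
Qed.

Lemma vanishes_constant (z : R -> H) : 0 < T ->
  (forall t, oc 0 T t -> vcont (oc 0 T) z t) ->
  (forall t, oo 0 T t -> rder z t v0) -> vanishes z -> forall t, oc 0 T t -> z t = v0.
Proof.
  intros hT cz dz hz t ht; unfold oc in ht; apply vnorm_small_eq; intros e he.
  destruct (hz e he) as [d [hd Hd]].
  destruct (pos_min d t hd) as [m [hm [? ?]]]; [lra |].
  replace (z t [-] v0) with (z t) by vring.
  rewrite (zero_rder z (m / 2) t); [apply Hd; [unfold oc |]; lra | lra | |].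
  - intros s hs; unfold cc in *; apply (vcont_sub (oc 0 T)); [unfold oc; intros; lra |].
    apply cz; unfold oc; lra.
  - intros s hs; apply dz; unfold oo in *; lra.
Qed.

(* Here [z' = - A z], so the norm of [z] is nonincreasing. *)
Lemma homogeneous_zero (z w : R -> H) :
  (forall t, oc 0 T t -> z t = K (w t)) ->
  (forall t, oc 0 T t -> vcont (oc 0 T) z t) ->
  (forall t, oo 0 T t -> rder z t (vopp (w t))) -> vanishes z ->
  forall t, oc 0 T t -> z t = v0.
Proof.
  intros ez cz dz hz t ht; unfold oc in ht; apply vnorm_small_eq; intros e he.
  destruct (hz e he) as [d [hd Hd]].
  destruct (pos_min d t hd) as [m [hm [? ?]]]; [lra |].
  replace (z t [-] v0) with (z t) by vring.
  assert (M : (-1) * inner (z (m / 2)) (z (m / 2)) <= (-1) * inner (z t) (z t)).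
  { apply (monotone_rder (H := H) (fun s => (-1) * inner (z s) (z s))
      (fun s => (-1) * (inner (vopp (w s)) (z s) + inner (z s) (vopp (w s))))); [lra | | |].
    - intros s hs; unfold cc in *; apply rcont_scal, (rcont_inner _ z z);
      apply (vcont_sub (oc 0 T)); try (apply cz; unfold oc; lra); unfold oc; intros; lra.
    - intros s hs; apply rderR_scal, (rderR_inner z z); apply dz; unfold oo in *; lra.
    - intros s hs; unfold oo in hs; rewrite inner_vopp_l, inner_vopp_r, (inner_sym _ (w s)).
      rewrite ez by (unfold oc; lra). assert (B := inv_pos A K hK (w s)). lra. }
  rewrite <- !norm_sqr in M.
  assert (B := Hd (m / 2) ltac:(unfold oc; lra) ltac:(lra)).
  assert (n1 := vnorm_ge0 _ (z t)); assert (n2 := vnorm_ge0 _ (z (m / 2))).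
  apply Rnot_lt_le; intros lt. nra.
Qed.

(** The condition on |h| and t |h'| with the derivative replaced by increments. The weight is taken
    at the left point [s], where t^(a - 2) is largest. *)
Definition lip_src a N (h : R -> H) :=
  (forall t, oc 0 T t -> vnorm (h t) <= N * rp t (a - 1)) /\
  (forall s t, 0 < s <= t -> t <= T -> vnorm (h t [-] h s) <= N * rp s (a - 2) * (t - s)).

Lemma lip_src_vcont a N h t : a <= 1 -> 0 <= N -> lip_src a N h -> oc 0 T t -> vcont (oc 0 T) h t.
Proof.
  intros ha hN [_ hl] ht e he; unfold oc in ht.
  set (M := N * rp (t / 2) (a - 2)).
  assert (hM : 0 <= M) by (apply Rmult_le_pos; auto using rp_ge0).
  destruct (pos_min (t / 2) (e / (M + 1))) as [d [hd [? ?]]]; [lra | apply Rdiv_lt_0_compat; lra |].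
  exists d; split; auto; intros s hs hst; unfold oc in hs.
  assert (gen : forall s t', t / 2 <= s <= t' -> t' <= T -> t' - s < d -> vnorm (h t' [-] h s) <= e).
  { intros s1 s2 h1 h2 h3; eapply Rle_trans; [apply hl; lra |].
    apply Rle_trans with ((M + 1) * (e / (M + 1))); [| right; field; lra].
    apply Rmult_le_compat; try lra; [apply Rmult_le_pos; auto using rp_ge0 |].
    apply Rle_trans with M; [| lra]; apply Rmult_le_compat_l; auto; apply rp_decr; lra. }
  apply Rabs_def2 in hst.
  destruct (Rle_dec s t); [rewrite vnorm_sub_sym |]; apply gen; lra.
Qed.

Lemma lip_src_src a N h : a <= 1 -> 0 <= N -> lip_src a N h -> src T a N h.
Proof. intros ha hN hh; split; [apply hh | intros; now apply (lip_src_vcont a N)]. Qed.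

Lemma sg_ker : ker T 1 1 E.
Proof.
  split; [| split].
  - intros t ht; apply (sg_lin K E hE); unfold oc in ht; lra.
  - intros t x ht; unfold oc in ht; rewrite Rminus_diag, rp_0, Rmult_1_r by lra.
    apply (sg_contr K E hE); lra.
  - intros x t ht; unfold oc in *.
    apply (vcont_sub (fun s => 0 <= s)); [intros; lra | apply (sg_cont K E hE); lra].
Qed.

(* [AE t] is the operator [A E(t)]. *)
Lemma smoothing_exists : exists AE : R -> H -> H,
  (forall t x, 0 < t -> K (AE t x) = E t x) /\ (forall t x, 0 < t -> vnorm (AE t x) <= / t * vnorm x).
Proof.
  assert (c : forall p : R * H, exists y, 0 < fst p ->
    K y = E (fst p) (snd p) /\ vnorm y <= / fst p * vnorm (snd p)).
  { intros [t x]; simpl; destruct (Rlt_dec 0 t) as [ht |]; [| exists v0; lra].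
    destruct (sg_smooth K E hE t x ht) as [y hy]; now exists y. }
  destruct (choice _ c) as [f hf]; exists (fun t x => f (t, x)).
  split; intros t x ht; apply (hf (t, x)); auto.
Qed.

Section Smoothing.
Context (AE : R -> H -> H).
Context (AE_K : forall t x, 0 < t -> K (AE t x) = E t x).
Context (AE_bnd : forall t x, 0 < t -> vnorm (AE t x) <= / t * vnorm x).

Lemma AE_lin t : 0 < t -> lin (AE t).
Proof.
  intros ht; assert (lE := sg_lin K E hE t ltac:(lra)); assert (lK := inv_lin A K hK).
  split; intros; apply (inv_inj A K _ _ hK).
  - rewrite (proj1 lK), !AE_K, (proj1 lE) by auto; auto.
  - rewrite (proj2 lK), !AE_K, (proj2 lE) by auto; auto.
Qed.

Lemma AE_E s t x : 0 < s -> 0 <= t -> AE s (E t x) = AE (s + t) x.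
Proof.
  intros hs ht; apply (inv_inj A K _ _ hK); rewrite !AE_K, (sg_add K E hE) by lra; auto.
Qed.

Lemma E_AE s t x : 0 <= s -> 0 < t -> E s (AE t x) = AE (s + t) x.
Proof.
  intros hs ht; apply (inv_inj A K _ _ hK).
  rewrite <- (sg_comm K E hE), !AE_K, (sg_add K E hE) by lra; auto.
Qed.

Lemma AE_inv t x : 0 < t -> AE t (K x) = E t x.
Proof. intros ht; apply (inv_inj A K _ _ hK); rewrite AE_K, (sg_comm K E hE) by lra; auto. Qed.

Lemma AE_vcont x t : 0 < t -> vcont (fun s => 0 < s) (fun s => AE s x) t.
Proof.
  intros ht; apply (vcont_local (fun s => t / 2 <= s) _ _ _ (t / 2)); [lra | |].
  { intros s hs hst; apply Rabs_def2 in hst; lra. }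
  apply (vcont_ext _ (fun s => E (1 * s + - (t / 2)) (AE (t / 2) x))); [lra | |].
  { intros s hs; rewrite E_AE by lra; f_equal; lra. }
  apply (vcont_affine (fun s => 0 <= s) _ (fun s => E s (AE (t / 2) x))); [lra | intros; lra |].
  apply (sg_cont K E hE); lra.
Qed.

Lemma E_der_near x l M s t : 0 <= s <= t ->
  (forall r, oo s t r -> vnorm (E r x [-] l) <= M) ->
  vnorm (E t (K x) [-] E s (K x) [+] ((t - s) [*] l)) <= M * (t - s).
Proof.
  intros hs le.
  replace (E t (K x) [-] E s (K x) [+] ((t - s) [*] l))
    with (E t (K x) [-] E s (K x) [-] ((t - s) [*] vopp l)) by vring.
  apply (mean_value_lin (fun r => E r (K x)) (fun r => vopp (E r x))); [lra | | |].
  - intros r hr; unfold cc in hr; apply (vcont_sub (fun r => 0 <= r));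
      [unfold cc; intros; lra | apply (sg_cont K E hE); lra].
  - intros r hr; unfold oo in hr; apply (sg_der K E hE); lra.
  - intros r hr; replace (vopp (E r x) [-] vopp l) with (vopp (E r x [-] l)) by vring.
    rewrite vnorm_opp; auto.
Qed.

(** A primitive of E(c - s) x in s is E(c - s) K x, since the derivative of E(t) K x is -E(t) x and
    the reversal of time changes the sign. *)
Lemma NI_E_const c b x : b <= c -> NI (fun s => E (c - s) x) b c (K (x [-] E (c - b) x)).
Proof.
  intros hbc; exists (fun s => E (c - s) (K x)); split; [| split].
  - intros s hs e he; unfold cc in hs.
    destruct (sg_cont K E hE (K x) (c - s) ltac:(lra) e he) as [d [hd Hd]].
    exists d; split; auto; intros r hr hrs; unfold cc in hr; apply Hd; [lra |].
    replace (c - r - (c - s)) with (- (r - s)) by ring; now rewrite Rabs_Ropp.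
  - intros s hs e he; unfold oo in hs.
    destruct (sg_cont K E hE x (c - s) ltac:(lra) e he) as [d [hd Hd]].
    destruct (pos_min d (c - s) hd) as [m [hm [? ?]]]; [lra |].
    exists m; split; auto; intros h hh.
    assert (B := E_der_near x (E (c - s) x) e (c - (s + h)) (c - s) ltac:(lra)
      ltac:(intros r hr; unfold oo in hr; apply Hd; [lra |]; rewrite Rabs_left; lra)).
    replace (c - s - (c - (s + h))) with h in B by ring.
    replace (E (c - (s + h)) (K x) [-] E (c - s) (K x) [-] (h [*] E (c - s) x))
      with (vopp (E (c - s) (K x) [-] E (c - (s + h)) (K x) [+] (h [*] E (c - s) x))) by vring.
    now rewrite vnorm_opp.
  - rewrite Rminus_diag, (sg_0 K E hE), (lin_sub K) by apply (inv_lin A K hK).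
    rewrite (sg_comm K E hE) by lra; auto.
Qed.

Section Source.
Context (a N : R) (h : R -> H).
Context (ha : 0 < a <= 1) (hN : 0 <= N) (hh : lip_src a N h).

Let z := conv E h.

Let lip_src' : src T a N h.
Proof. apply lip_src_src; auto; lra. Qed.

Lemma duhamel_bound t : oc 0 T t -> vnorm (z t) <= N * beta_const 1 a * rp t a.
Proof.
  intros ht; assert (B := conv_bound T 1 1 a N E h t ltac:(lra) ha ltac:(lra) hN sg_ker lip_src' ht).
  rewrite Rmult_1_l in B; replace (1 + a - 1) with a in B by ring; exact B.
Qed.

Lemma duhamel_cont t : oc 0 T t -> vcont (oc 0 T) z t.
Proof.
  intros ht; apply (conv_cont T 1 1 a N); auto; try lra; apply sg_ker.
Qed.

(** Restarting the Duhamel formula at time [t]: by the semigroup law the part of the integral before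
    [t] is E(t' - t) applied to [z t]. *)
Lemma duhamel_split t t' : 0 < t <= t' -> t' <= T ->
  exists J, NI (fun s => E (t' - s) (h s)) t t' J /\ z t' = E (t' - t) (z t) [+] J.
Proof.
  intros ht htT.
  assert (I1 := conv_spec T 1 1 a N E h t' ltac:(lra) ha ltac:(lra) hN sg_ker lip_src' ltac:(unfold oc; lra)).
  assert (I0 := conv_spec T 1 1 a N E h t ltac:(lra) ha ltac:(lra) hN sg_ker lip_src' ltac:(unfold oc; lra)).
  destruct (NI_split _ 0 t t' _ ltac:(lra) I1) as [J1 [J2 [hJ1 [hJ2 e]]]].
  exists J2; split; auto; unfold z at 1; rewrite e; f_equal.
  apply (NI_unique (fun s => E (t' - s) (h s)) 0 t); auto; [lra |].
  assert (I2 := NI_lin (E (t' - t)) 1 _ _ _ _ (sg_lin K E hE (t' - t) ltac:(lra)) ltac:(lra)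
    (sg_contr K E hE (t' - t) ltac:(lra)) I0).
  revert I2; apply NI_ext; intros s hs; unfold oo in hs.
  rewrite <- (sg_add K E hE) by lra; f_equal; ring.
Qed.

(* [A z(t) - h(t)] is the limit as [e -> 0] of [dlt e t], which regularizes
   [A z] through the smoothing of [E(e)]. *)
Let dlt e t := AE e (z (t - e)) [-] E e (h t).
(** A Lipschitz constant of [h] on [t/2, T]. *)
Let lipc t := N * rp (t / 2) (a - 2).

Let lipc_ge0 t : 0 <= lipc t.
Proof. apply Rmult_le_pos; auto using rp_ge0. Qed.

(** The cancellation on which the estimate rests. The difference is the integral of A E(t - s) (h(s)
    - h(t)) over (t - e, t - e'): the factor 1/(t - s) of the smoothing meets the Lipschitz factor t
    - s, and the integrand is bounded by [lipc t]. Subtracting [E e (h t)] in [dlt] is what makes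
    h(t) appear here, by [NI_E_const]. *)
Lemma dlt_lip t e e' : oc 0 T t -> 0 < e' <= e -> e <= t / 2 ->
  vnorm (dlt e' t [-] dlt e t) <= lipc t * (e - e').
Proof.
  intros ht he het; unfold oc in ht.
  destruct (duhamel_split (t - e) (t - e') ltac:(lra) ltac:(lra)) as [J [hJ eJ]].
  replace (t - e' - (t - e)) with (e - e') in eJ by ring.
  assert (hc := NI_E_const (t - e') (t - e) (h t) ltac:(lra)).
  replace (t - e' - (t - e)) with (e - e') in hc by ring.
  assert (lA := AE_lin e' ltac:(lra)).
  assert (hd := NI_lin (AE e') (/ e') _ _ _ _ lA ltac:(left; apply Rinv_0_lt_compat; lra)
    (fun x => AE_bnd e' x ltac:(lra)) (NI_sub _ _ _ _ _ _ hJ hc)).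
  cbv beta in hd.
  rewrite (lin_sub (AE e')), AE_inv, (lin_sub (E e')), <- (sg_add K E hE) in hd
    by (auto; try apply (sg_lin K E hE); lra).
  replace (e' + (e - e')) with e in hd by ring.
  assert (eq : dlt e' t [-] dlt e t = AE e' J [-] (E e' (h t) [-] E e (h t))).
  { unfold dlt; rewrite eJ, (proj1 lA), AE_E by lra.
    replace (e' + (e - e')) with e by ring; vring. }
  rewrite eq.
  assert (le : forall s, oo (t - e) (t - e') s ->
    vnorm (AE e' (E (t - e' - s) (h s) [-] E (t - e' - s) (h t)) [-] v0) <= lipc t).
  { intros s hs; unfold oo in hs.
    replace (AE e' (E (t - e' - s) (h s) [-] E (t - e' - s) (h t)) [-] v0)
      with (AE (t - s) (h s [-] h t)).
    2: { rewrite <- (lin_sub (E (t - e' - s))), AE_E by (try apply (sg_lin K E hE); lra).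
         replace (e' + (t - e' - s)) with (t - s) by ring; vring. }
    eapply Rle_trans; [apply AE_bnd; lra |]; rewrite vnorm_sub_sym.
    apply Rle_trans with (/ (t - s) * (lipc t * (t - s))); [| right; field; lra].
    apply Rmult_le_compat_l; [left; apply Rinv_0_lt_compat; lra |].
    eapply Rle_trans; [apply (proj2 hh); lra |]; apply Rmult_le_compat_r; [lra |].
    apply Rmult_le_compat_l; auto; apply rp_decr; lra. }
  assert (B := NI_near _ v0 (lipc t) (t - e) (t - e') _ ltac:(lra) le hd).
  replace (t - e' - (t - e)) with (e - e') in B by ring.
  match type of B with vnorm (?x [-] ?y) <= _ => replace (x [-] y) with x in B by vring end.
  exact B.
Qed.

(** At e = t/2 the smoothing costs only 2/t, against a Duhamel integral of order t^a. *)
Lemma dlt_half t : oc 0 T t ->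
  vnorm (dlt (t / 2) t)
    <= N * (beta_const 1 a * rp (1 / 2) (a - 1) + 1) * rp t (a - 1).
Proof.
  intros ht; unfold oc in ht; eapply Rle_trans; [apply vnorm_sub |].
  assert (B1 := AE_bnd (t / 2) (z (t - t / 2)) ltac:(lra)).
  replace (t - t / 2) with (t / 2) in * by field.
  assert (B2 := duhamel_bound (t / 2) ltac:(unfold oc; lra)).
  assert (B3 := sg_contr K E hE (t / 2) ltac:(lra) (h t)); rewrite Rmult_1_l in B3.
  assert (B4 := proj1 hh t ltac:(unfold oc; lra)).
  assert (/ (t / 2) * vnorm (z (t / 2)) <= / (t / 2) * (N * beta_const 1 a * rp (t / 2) a)).
  { apply Rmult_le_compat_l; auto; left; apply Rinv_0_lt_compat; lra. }
  replace (/ (t / 2) * (N * beta_const 1 a * rp (t / 2) a))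
    with (N * (beta_const 1 a * rp (1 / 2) (a - 1)) * rp t (a - 1)) in *.
  2: { replace (rp (t / 2) a) with (rp (t / 2) (a - 1) * (t / 2)).
       - replace (t / 2) with (1 / 2 * t) by field; rewrite rp_mult by lra; field; lra.
       - rewrite <- (rp_1 (t / 2)) at 2 by lra; rewrite <- rp_add by lra; f_equal; ring. }
  lra.
Qed.

Lemma dlt_limit t : oc 0 T t -> exists l, forall e, 0 < e <= t / 2 ->
  vnorm (dlt e t [-] l) <= lipc t * e.
Proof.
  intros ht; assert (ht' := ht); unfold oc in ht'.
  assert (hl := lipc_ge0 t).
  destruct (vlim_right (fun e => dlt e t)) as [l Hl].
  - intros e he; destruct (pos_min (t / 2) (e / (lipc t + 1))) as [d [hd [? ?]]];
      [lra | apply Rdiv_lt_0_compat; lra |].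
    exists d; split; auto.
    assert (gen : forall x y, 0 < x <= y -> y < d -> vnorm (dlt x t [-] dlt y t) <= e).
    { intros x y hx hy; eapply Rle_trans; [apply dlt_lip; auto; lra |].
      apply Rle_trans with ((lipc t + 1) * (e / (lipc t + 1))); [| right; field; lra].
      apply Rmult_le_compat; lra. }
    intros x y hx hy; destruct (Rle_dec x y); [| rewrite vnorm_sub_sym]; apply gen; lra.
  - exists l; intros e he; apply le_epsilon; intros e' he'.
    destruct (Hl e' he') as [d [hd Hd]].
    destruct (pos_min d e hd) as [m [hm [? ?]]]; [lra |].
    assert (B1 := Hd (m / 2) ltac:(lra)); assert (B2 := dlt_lip t e (m / 2) ht ltac:(lra) ltac:(lra)).
    assert (B3 := vnorm_tri (dlt e t) (dlt (m / 2) t) l).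
    rewrite (vnorm_sub_sym (dlt e t) (dlt (m / 2) t)) in B3.
    assert (lipc t * (e - m / 2) <= lipc t * e) by (apply Rmult_le_compat_l; lra). lra.
Qed.

(** [P] = A z is the limit of [dlt] plus [h]. Its constant adds the bound at e = t/2, the distance
    [lipc t * (t / 2)] from there to the limit, and the bound of [h]. *)
Lemma duhamel_regular : exists P : R -> H,
  src T a (N * (beta_const 1 a * rp (1 / 2) (a - 1) + rp (1 / 2) (a - 1) + 2)) P /\
  (forall t, oc 0 T t -> z t = K (P t)) /\
  (forall t, oo 0 T t -> rder z t (h t [-] P t)).
Proof.
  destruct (inv_bnd A K hK) as [C [hC bC]]. assert (lK := inv_lin A K hK).
  assert (c : forall t, exists l, oc 0 T t -> forall e, 0 < e <= t / 2 ->
    vnorm (dlt e t [-] l) <= lipc t * e).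
  { intros t; destruct (excluded_middle_informative (oc 0 T t)) as [ht | nt].
    - destruct (dlt_limit t ht) as [l hl]; now exists l.
    - now exists v0. }
  destruct (choice _ c) as [Dl hD].
  assert (hcont : forall t, oc 0 T t -> vcont (oc 0 T) h t) by apply lip_src'.
  (* Restart at t - m, where E(m) z(t - m) = K (dlt m t + E(m) h(t)); as m tends to 0 the remaining
     integral over (t - m, t) disappears. *)
  assert (eK : forall t, oc 0 T t -> z t = K (Dl t [+] h t)).
  { intros t ht; assert (ht' := ht); unfold oc in ht'; apply vnorm_small_eq; intros e he.
    set (Q := N * rp (t / 2) (a - 1) + C * lipc t + C).
    assert (hq1 : 0 <= N * rp (t / 2) (a - 1)) by (apply Rmult_le_pos; auto using rp_ge0).
    assert (hq2 : 0 <= C * lipc t) by (apply Rmult_le_pos; auto; lra).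
    assert (hQ : 0 < Q) by (unfold Q; lra).
    destruct (sg_cont K E hE (h t) 0 ltac:(lra) (e / 2 / C)) as [d [hd Hd]].
    { repeat apply Rdiv_lt_0_compat; lra. }
    destruct (pos_min (d / 2) (t / 2)) as [m1 [hm1 [? ?]]]; [lra | lra |].
    destruct (pos_min m1 (e / 2 / Q)) as [m [hm [? ?]]];
      [lra | repeat apply Rdiv_lt_0_compat; lra |].
    destruct (duhamel_split (t - m) t ltac:(lra) ltac:(lra)) as [J [hJ eJ]].
    replace (t - (t - m)) with m in eJ by ring.
    assert (le : forall s, oo (t - m) t s ->
      vnorm (E (t - s) (h s) [-] v0) <= N * rp (t / 2) (a - 1)).
    { intros s hs; unfold oo in hs; replace (E (t - s) (h s) [-] v0) with (E (t - s) (h s)) by vring.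
      eapply Rle_trans; [apply (sg_contr K E hE); lra |]; rewrite Rmult_1_l.
      eapply Rle_trans; [apply (proj1 hh); unfold oc; lra |].
      apply Rmult_le_compat_l; auto; apply rp_decr; lra. }
    assert (B1 := NI_near _ v0 _ (t - m) t _ ltac:(lra) le hJ).
    replace (t - (t - m)) with m in B1 by ring.
    replace (J [-] (m [*] v0)) with J in B1 by vring.
    assert (B2 := hD t ht m ltac:(lra)).
    assert (B3 := Hd m ltac:(lra) ltac:(rewrite Rminus_0_r, Rabs_pos_eq; lra)).
    rewrite (sg_0 K E hE) in B3.
    assert (eD : E m (z (t - m)) = K (dlt m t [+] E m (h t))).
    { unfold dlt; replace (AE m (z (t - m)) [-] E m (h t) [+] E m (h t))
        with (AE m (z (t - m))) by vring; rewrite AE_K; auto. }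
    rewrite eJ, eD.
    replace (K (dlt m t [+] E m (h t)) [+] J [-] K (Dl t [+] h t))
      with (K (dlt m t [-] Dl t) [+] K (E m (h t) [-] h t) [+] J)
      by (rewrite !(lin_sub K), !(proj1 lK) by auto; vring).
    assert (D1 := vnorm_add _ (K (dlt m t [-] Dl t) [+] K (E m (h t) [-] h t)) J).
    assert (D2 := vnorm_add _ (K (dlt m t [-] Dl t)) (K (E m (h t) [-] h t))).
    assert (D3 := bC (dlt m t [-] Dl t)). assert (D4 := bC (E m (h t) [-] h t)).
    assert (C * vnorm (dlt m t [-] Dl t) <= C * (lipc t * m)) by (apply Rmult_le_compat_l; lra).
    assert (C * vnorm (E m (h t) [-] h t) <= C * (e / 2 / C)) by (apply Rmult_le_compat_l; lra).
    replace (C * (e / 2 / C)) with (e / 2) in * by (field; lra).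
    assert ((N * rp (t / 2) (a - 1) + C * lipc t) * m <= Q * (e / 2 / Q)).
    { apply Rmult_le_compat; unfold Q in *; lra. }
    replace (Q * (e / 2 / Q)) with (e / 2) in * by (field; lra). lra. }
  (* A locally uniform limit of the continuous functions [dlt m]: for s >= t/2 the constant [lipc s]
     is at most the same expression taken at t/4. *)
  assert (Dcont : forall t, oc 0 T t -> vcont (oc 0 T) Dl t).
  { intros t ht e he; assert (ht' := ht); unfold oc in ht'.
    set (M := N * rp (t / 4) (a - 2)).
    assert (hM : 0 <= M) by (apply Rmult_le_pos; auto using rp_ge0).
    destruct (pos_min (t / 8) (e / 3 / (M + 1))) as [m [hm [? ?]]];
      [lra | repeat apply Rdiv_lt_0_compat; lra |].
    assert (small : forall s, oc 0 T s -> t / 2 <= s -> vnorm (dlt m s [-] Dl s) <= e / 3).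
    { intros s hs hst; unfold oc in hs; eapply Rle_trans; [apply hD; [unfold oc |]; lra |].
      apply Rle_trans with ((M + 1) * (e / 3 / (M + 1))); [| right; field; lra].
      apply Rmult_le_compat; try lra; [apply lipc_ge0 |].
      apply Rle_trans with M; [| lra].
      apply Rmult_le_compat_l; auto; apply rp_decr; lra. }
    assert (cd : vcont (oc 0 T) (fun s => dlt m s) t).
    { apply vcont_minus.
      - apply (vcont_local (fun s => oc 0 T s /\ t / 2 <= s) _ _ _ (t / 2)); [lra | |].
        { intros s hs hst; apply Rabs_def2 in hst; split; [auto | lra]. }
        apply (vcont_lip _ (fun s => z (s - m)) _ (AE m) (/ m)).
        + left; now apply Rinv_0_lt_compat.
        + intros x y; rewrite <- (lin_sub (AE m)) by (apply AE_lin; auto); now apply AE_bnd.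
        + apply (vcont_ext _ (fun s => z (1 * s + - m))); [unfold oc; lra | |].
          { intros; f_equal; ring. }
          apply (vcont_affine (oc 0 T)); [lra | |].
          * intros s [hs hst]; unfold oc in *; lra.
          * apply duhamel_cont; unfold oc; lra.
      - apply (vcont_lip _ h _ (E m) 1); [lra | |].
        + intros x y; rewrite <- (lin_sub (E m)) by (apply (sg_lin K E hE); lra).
          apply (sg_contr K E hE); lra.
        + apply hcont; unfold oc; lra. }
    destruct (cd (e / 3)) as [d [hd Hd]]; [lra |].
    destruct (pos_min d (t / 2) hd) as [d' [hd' [? ?]]]; [lra |].
    exists d'; split; auto; intros s hs hst.
    assert (hst' := hst); apply Rabs_def2 in hst'.
    assert (B1 := small s hs ltac:(lra)); assert (B2 := small t ht ltac:(lra)).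
    assert (B3 := Hd s hs ltac:(lra)).
    assert (B4 := vnorm_tri (Dl s) (dlt m s) (Dl t)).
    assert (B5 := vnorm_tri (dlt m s) (dlt m t) (Dl t)).
    rewrite (vnorm_sub_sym (Dl s) (dlt m s)) in B4. lra. }
  exists (fun t => Dl t [+] h t); split; [split | split]; auto.
  - intros t ht; assert (ht' := ht); unfold oc in ht'.
    assert (B1 := dlt_half t ht); assert (B2 := hD t ht (t / 2) ltac:(lra)).
    assert (B3 := proj1 hh t ht). assert (B4 := vnorm_add _ (Dl t) (h t)).
    assert (B5 := vnorm_le_sub (Dl t) (dlt (t / 2) t)).
    rewrite (vnorm_sub_sym (Dl t)) in B5.
    replace (lipc t * (t / 2)) with (N * rp (1 / 2) (a - 1) * rp t (a - 1)) in B2; [lra |].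
    unfold lipc; replace (N * rp (t / 2) (a - 2) * (t / 2))
      with (N * (rp (t / 2) (a - 2) * rp (t / 2) 1)) by (rewrite rp_1; lra).
    rewrite <- rp_add by lra; replace (a - 2 + 1) with (a - 1) by ring.
    replace (t / 2) with (1 / 2 * t) by field; rewrite rp_mult by lra; ring.
  - intros t ht; apply vcont_add; auto.
  - intros t ht e he; assert (ht' := ht); unfold oo in ht'.
    assert (htc : oc 0 T t) by (unfold oc; lra).
    cbv beta; set (P := Dl t [+] h t).
    destruct (sg_cont K E hE P 0 ltac:(lra) (e / 2)) as [d1 [hd1 H1]]; [lra |].
    destruct (sg_cont K E hE (h t) 0 ltac:(lra) (e / 4)) as [d2 [hd2 H2]]; [lra |].
    destruct (hcont t htc (e / 4)) as [d3 [hd3 H3]]; [lra |].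
    destruct (pos_min d1 d2 hd1 hd2) as [m1 [hm1 [? ?]]].
    destruct (pos_min d3 (T - t) hd3) as [m2 [hm2 [? ?]]]; [lra |].
    destruct (pos_min m1 m2 hm1 hm2) as [m [hm [? ?]]].
    exists m; split; auto; intros k hk.
    destruct (duhamel_split t (t + k) ltac:(lra) ltac:(lra)) as [J [hJ eJ]].
    replace (t + k - t) with k in eJ by ring.
    assert (B1 := E_der_near P P (e / 2) 0 k ltac:(lra)
      ltac:(intros r hr; unfold oo in hr; rewrite <- (sg_0 K E hE P) at 2; apply H1; [lra |];
            rewrite Rminus_0_r, Rabs_pos_eq; lra)).
    rewrite (sg_0 K E hE), !Rminus_0_r in B1.
    assert (eP : z t = K P) by exact (eK t htc); rewrite <- eP in B1.
    assert (le : forall s, oo t (t + k) s -> vnorm (E (t + k - s) (h s) [-] h t) <= e / 2).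
    { intros s hs; unfold oo in hs.
      assert (C1 := H2 (t + k - s) ltac:(lra) ltac:(rewrite Rminus_0_r, Rabs_pos_eq; lra)).
      rewrite (sg_0 K E hE) in C1.
      assert (C2 := H3 s ltac:(unfold oc; lra) ltac:(rewrite Rabs_pos_eq; lra)).
      assert (C3 := vnorm_tri (E (t + k - s) (h s)) (E (t + k - s) (h t)) (h t)).
      rewrite <- (lin_sub (E (t + k - s))) in C3 by (apply (sg_lin K E hE); lra).
      assert (C4 := sg_contr K E hE (t + k - s) ltac:(lra) (h s [-] h t)). lra. }
    assert (B2 := NI_near _ (h t) _ t (t + k) _ ltac:(lra) le hJ).
    replace (t + k - t) with k in B2 by ring.
    rewrite eJ.
    replace (E k (z t) [+] J [-] z t [-] (k [*] (h t [-] P)))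
      with ((E k (z t) [-] z t [+] (k [*] P)) [+] (J [-] (k [*] h t))) by vring.
    eapply Rle_trans; [apply vnorm_add |]; lra.
Qed.

End Source.
End Smoothing.

Definition par_const a := beta_const 1 a * rp (1 / 2) (a - 1) + rp (1 / 2) (a - 1) + 2.

Lemma par_const_pos a : 0 < a -> 0 < par_const a.
Proof.
  intros ha; unfold par_const.
  assert (0 <= beta_const 1 a * rp (1 / 2) (a - 1)).
  { apply Rmult_le_pos; [left; apply beta_const_pos; lra | apply rp_ge0]. }
  assert (B := rp_ge0 (1 / 2) (a - 1)). lra.
Qed.

Lemma parabolic a N h : 0 < a <= 1 -> 0 <= N -> lip_src a N h -> exists P : R -> H,
  src T a (N * par_const a) P /\
  (forall t, oc 0 T t -> vcont (oc 0 T) (fun s => K (P s)) t) /\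
  (forall t, oc 0 T t -> vnorm (K (P t)) <= N * beta_const 1 a * rp t a) /\
  (forall t, oo 0 T t -> rder (fun s => K (P s)) t (h t [-] P t)).
Proof.
  intros ha hN hh; destruct smoothing_exists as [AE [AK Ab]].
  destruct (duhamel_regular AE AK Ab a N h ha hN hh) as [P [hP [eP dP]]].
  exists P; split; [exact hP | split; [| split]].
  - intros t ht; apply (vcont_ext _ (conv E h)); auto.
    apply (duhamel_cont a N); auto.
  - intros t ht; rewrite <- eP by auto; apply (duhamel_bound a N h); auto.
  - intros t ht; apply (rder_ext_loc (conv E h) _ _ _ (T - t)); unfold oo in ht; [lra | |].
    + intros s hs; apply eP; unfold oc; lra.
    + now apply dP.
Qed.

(** For s >= t/2 the orbit of an arbitrary [x] is E(s - t/2) applied to K (A E(t/2) x), an orbit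
    that starts in the range of [K] and is therefore differentiable. *)
Lemma orbit_regular x : exists Q : R -> H, forall t, 0 < t ->
  K (Q t) = E t x /\ rder (fun s => E s x) t (vopp (Q t)) /\ vcont (fun s => 0 < s) Q t.
Proof.
  destruct smoothing_exists as [AE [AK Ab]]; exists (fun t => AE t x); intros t ht.
  split; [now apply AK | split; [| now apply AE_vcont]].
  apply (rder_ext_loc (fun s => E (1 * s + - (t / 2)) (K (AE (t / 2) x))) _ _ _ 1); [lra | |].
  - intros s hs; rewrite AK, <- (sg_add K E hE) by lra; f_equal; lra.
  - replace (vopp (AE t x)) with (1 [*] vopp (E (1 * t + - (t / 2)) (AE (t / 2) x))).
    + apply (rder_affine (fun s => E s (K (AE (t / 2) x)))); [lra |].
      apply (sg_der K E hE); lra.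
    + rewrite (E_AE AE AK) by lra; replace (1 * t + - (t / 2) + t / 2) with t by lra; vring.
Qed.

End Parabolic.

(** * Volterra equations and resolvent kernels *)

Lemma exp_mono x y : x <= y -> exp x <= exp y.
Proof. intros [h | ->]; [left; now apply exp_increasing | lra]. Qed.

Lemma exp_ge_rp x a : 0 < x -> 0 <= a <= 1 -> rp x a <= exp x.
Proof.
  intros hx ha; destruct (Rle_dec x 1).
  - apply Rle_trans with (rp 1 a); [apply rp_incr; lra |].
    rewrite rp_eq by lra; unfold Rpower; rewrite ln_1, Rmult_0_r, exp_0.
    left; rewrite <- exp_0; apply exp_increasing; auto.
  - apply Rle_trans with (rp x 1).
    + rewrite !rp_eq by auto; apply Rle_Rpower; lra.
    + rewrite rp_1 by auto; assert (B := exp_ineq1 x ltac:(lra)); lra.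
Qed.

Section Volterra.
Context {H : Hilbert} (T : R).
Implicit Types (r : R -> H -> H) (phi : R -> H).

(** A Bielecki weight multiplied by the admissible singularity at 0. *)
Definition wgt a l t := exp (l * t) * rp t (a - 1).

Lemma wgt_ge0 a l t : 0 <= wgt a l t.
Proof. apply Rmult_le_pos; [left; apply exp_pos | apply rp_ge0]. Qed.

Lemma wgt_src a l N phi : 0 <= l -> 0 <= N ->
  (forall t, oc 0 T t -> vcont (oc 0 T) phi t) ->
  (forall t, oc 0 T t -> vnorm (phi t) <= N * wgt a l t) -> src T a (N * exp (l * T)) phi.
Proof.
  intros hl hN cp le; split; auto; intros t ht; eapply Rle_trans; [now apply le |].
  unfold wgt; rewrite <- Rmult_assoc; apply Rmult_le_compat_r; [apply rp_ge0 |].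
  apply Rmult_le_compat_l; auto; apply exp_mono; unfold oc in ht.
  apply Rmult_le_compat_l; lra.
Qed.

Lemma src_wgt a l N phi t : 0 <= l -> 0 <= N -> src T a N phi -> oc 0 T t ->
  vnorm (phi t) <= N * wgt a l t.
Proof.
  intros hl hN [pb _] ht; eapply Rle_trans; [now apply pb |].
  apply Rmult_le_compat_l; auto; unfold wgt.
  rewrite <- (Rmult_1_l (rp t (a - 1))) at 1; apply Rmult_le_compat_r; [apply rp_ge0 |].
  rewrite <- exp_0; apply exp_mono; unfold oc in ht; apply Rmult_le_pos; lra.
Qed.

(* With the weight [exp (l t)], the kernel is multiplied by [exp (- l (t - s))],
   which is at most [(l (t - s))^(-a/2)]; half of the exponent is thus traded
   for the small factor [l^(-a/2)]. *)
Lemma conv_contraction a C r : 0 < T -> 0 < a <= 1 -> 0 <= C -> ker T a C r ->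
  exists l, 0 < l /\ forall phi N, 0 <= N ->
    (forall t, oc 0 T t -> vcont (oc 0 T) phi t) ->
    (forall t, oc 0 T t -> vnorm (phi t) <= N * wgt a l t) ->
    forall t, oc 0 T t -> vnorm (conv r phi t) <= 1 / 2 * N * wgt a l t.
Proof.
  intros hT ha hC hr.
  (* The norm of the convolution is at most Q / l^(a/2). The choice of [l] below makes l^(a/2) = 2
     (Q + 1), hence this ratio at most 1/2; the added 1 keeps [l] positive when Q = 0. *)
  set (Q := C * beta_const (a / 2) a * rp T (a / 2)).
  assert (hb : 0 < beta_const (a / 2) a) by (apply beta_const_pos; lra).
  assert (hQ : 0 <= Q) by (repeat apply Rmult_le_pos; auto using rp_ge0; lra).
  set (l := rp (2 * (Q + 1)) (2 / a)).
  assert (hl : 0 < l) by (apply rp_pos; lra).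
  assert (el : rp l (a / 2) = 2 * (Q + 1)).
  { unfold l; rewrite (rp_eq (rp _ _)) by exact hl; rewrite rp_eq, Rpower_mult by lra.
    replace (2 / a * (a / 2)) with 1 by (field; lra); apply Rpower_1; lra. }
  exists l; split; auto; intros phi N hN cp le t ht; assert (ht' := ht); unfold oc in ht'.
  assert (hp := wgt_src a l N phi ltac:(lra) hN cp le).
  assert (he : 0 < exp (l * T)) by apply exp_pos.
  assert (I := conv_spec T a C a (N * exp (l * T)) r phi t ha ha hC
    ltac:(apply Rmult_le_pos; lra) hr hp ht).
  set (M := C * N * exp (l * t) * / rp l (a / 2)).
  assert (hM : 0 <= M).
  { repeat apply Rmult_le_pos; auto; left; [apply exp_pos | apply Rinv_0_lt_compat; lra]. }
  apply Rle_trans with (M * beta_const (a / 2) a * rp t (a / 2 + a - 1)).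
  - apply (NI_beta_bound (fun s => r (t - s) (phi s))); auto; try lra.
    intros s hs; unfold oo in hs.
    eapply Rle_trans; [apply (proj1 (proj2 hr)); unfold oc; lra |].
    apply Rle_trans with (C * rp (t - s) (a - 1) * (N * wgt a l s)).
    { apply Rmult_le_compat_l; [apply Rmult_le_pos; auto using rp_ge0 |].
      apply le; unfold oc; lra. }
    assert (B : exp (l * s) <= exp (l * t) * (/ rp l (a / 2) * / rp (t - s) (a / 2))).
    { rewrite <- Rinv_mult, <- rp_mult by lra.
      assert (hx : 0 < l * (t - s)) by (apply Rmult_lt_0_compat; lra).
      replace (exp (l * s)) with (exp (l * t) * / exp (l * (t - s))).
      - apply Rmult_le_compat_l; [left; apply exp_pos |].
        apply Rinv_le_contravar; [now apply rp_pos | apply exp_ge_rp; lra].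
      - rewrite <- exp_Ropp, <- exp_plus; f_equal; ring. }
    unfold wgt, M.
    replace (rp (t - s) (a / 2 - 1)) with (rp (t - s) (a - 1) * / rp (t - s) (a / 2)).
    2: { rewrite <- rp_opp, <- rp_add by lra; f_equal; lra. }
    replace (C * rp (t - s) (a - 1) * (N * (exp (l * s) * rp s (a - 1))))
      with (C * N * rp (t - s) (a - 1) * rp s (a - 1) * exp (l * s)) by ring.
    replace (C * N * exp (l * t) * / rp l (a / 2)
      * (rp (t - s) (a - 1) * / rp (t - s) (a / 2) * rp s (a - 1)))
      with (C * N * rp (t - s) (a - 1) * rp s (a - 1)
        * (exp (l * t) * (/ rp l (a / 2) * / rp (t - s) (a / 2)))) by ring.
    apply Rmult_le_compat_l; auto.
    repeat apply Rmult_le_pos; auto using rp_ge0.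
  - replace (a / 2 + a - 1) with (a / 2 + (a - 1)) by ring; rewrite rp_add by lra.
    unfold M, wgt.
    replace (C * N * exp (l * t) * / rp l (a / 2) * beta_const (a / 2) a * (rp t (a / 2) * rp t (a - 1)))
      with ((C * beta_const (a / 2) a * rp t (a / 2)) * / rp l (a / 2) * (N * (exp (l * t) * rp t (a - 1))))
      by ring.
    rewrite Rmult_assoc with (r1 := 1 / 2); apply Rmult_le_compat_r.
    { apply Rmult_le_pos; auto; apply wgt_ge0. }
    rewrite el; apply Rle_trans with (Q * / (2 * (Q + 1))).
    + apply Rmult_le_compat_r; [left; apply Rinv_0_lt_compat; lra |].
      unfold Q; apply Rmult_le_compat_l; [apply Rmult_le_pos; lra | apply rp_incr; lra].
    + apply Rmult_le_reg_r with (2 * (Q + 1)); [lra |].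
      rewrite Rmult_assoc, Rinv_l by lra; lra.
Qed.

Lemma pow_half_small (N e : R) : 0 < e -> exists n, (1 / 2) ^ n * N <= e.
Proof.
  intros he; assert (hN := Rabs_pos N).
  destruct (pow_lt_1_zero (1 / 2) ltac:(rewrite Rabs_pos_eq; lra) (e / (Rabs N + 1)))
    as [n hn]; [apply Rdiv_lt_0_compat; lra |].
  exists n; assert (B := hn n (le_n n)).
  assert (p := pow_lt (1 / 2) n ltac:(lra)); rewrite Rabs_pos_eq in B by lra.
  apply Rle_trans with (e / (Rabs N + 1) * (Rabs N + 1)); [| right; field; lra].
  apply Rle_trans with ((1 / 2) ^ n * (Rabs N + 1)).
  - apply Rmult_le_compat_l; [lra |]; generalize (Rle_abs N); lra.
  - apply Rmult_le_compat_r; lra.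
Qed.

(** Each use of the equation halves the weighted bound of [phi]. *)
Lemma volterra_zero a C N r phi : 0 < T -> 0 < a <= 1 -> 0 <= C -> 0 <= N ->
  ker T a C r -> src T a N phi ->
  (forall t, oc 0 T t -> phi t = vopp (conv r phi t)) -> forall t, oc 0 T t -> phi t = v0.
Proof.
  intros hT ha hC hN hr hp e t ht.
  destruct (conv_contraction a C r hT ha hC hr) as [l [hl ctr]].
  assert (it : forall n t, oc 0 T t -> vnorm (phi t) <= (1 / 2) ^ n * N * wgt a l t).
  { induction n; intros s hs.
    - rewrite pow_O, Rmult_1_l; apply src_wgt; auto; lra.
    - rewrite e, vnorm_opp by auto.
      replace ((1 / 2) ^ S n * N) with (1 / 2 * ((1 / 2) ^ n * N)) by (simpl; ring).
      apply ctr; auto; [| apply hp].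
      apply Rmult_le_pos; auto; apply pow_le; lra. }
  apply vnorm_small_eq; intros e' he'.
  destruct (pow_half_small (N * wgt a l t) e' he') as [n hn].
  replace (phi t [-] v0) with (phi t) by vring.
  eapply Rle_trans; [apply (it n t ht) |]; lra.
Qed.

(** Picard iteration from 0 in the weighted norm. The ball of radius 2N is preserved because N +
    (1/2) 2N = 2N, and convergence is geometric. The weight is bounded on compact parts of (0, T],
    so the convergence is locally uniform and the limit continuous. *)
Lemma volterra_solve a C N r P : 0 < T -> 0 < a <= 1 -> 0 <= C -> 0 <= N ->
  ker T a C r -> src T a N P ->
  exists W N', 0 <= N' /\ src T a N' W /\ forall t, oc 0 T t -> W t = P t [-] conv r W t.
Proof.
  intros hT ha hC hN hr hP.
  destruct (conv_contraction a C r hT ha hC hr) as [l [hl ctr]].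
  assert (he : 0 < exp (l * T)) by apply exp_pos.
  set (X := nat_rect (fun _ => R -> H) (fun _ => v0) (fun _ W t => P t [-] conv r W t)).
  assert (XS : forall n t, X (S n) t = P t [-] conv r (X n) t) by reflexivity.
  assert (hX : forall n, (forall t, oc 0 T t -> vcont (oc 0 T) (X n) t) /\
    forall t, oc 0 T t -> vnorm (X n t) <= 2 * N * wgt a l t).
  { induction n as [| n [cn bn]].
    - split; intros t ht; [apply vcont_const |]; simpl; rewrite vnorm_0.
      apply Rmult_le_pos; [lra | apply wgt_ge0].
    - assert (hs : src T a (2 * N * exp (l * T)) (X n)) by (apply wgt_src; auto; lra).
      split; intros t ht.
      + apply (vcont_minus _ P); [now apply hP |].
        apply (conv_cont T a C a (2 * N * exp (l * T))); auto; apply Rmult_le_pos; lra.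
      + rewrite XS; eapply Rle_trans; [apply vnorm_sub |].
        assert (B1 := src_wgt a l N P t ltac:(lra) hN hP ht).
        assert (B2 := ctr (X n) (2 * N) ltac:(lra) cn bn t ht). lra. }
  assert (sX : forall n, src T a (2 * N * exp (l * T)) (X n)).
  { intros n; apply wgt_src; try apply hX; lra. }
  assert (hNe : 0 <= 2 * N * exp (l * T)) by (apply Rmult_le_pos; lra).
  assert (sub_ctr : forall V V' M, 0 <= M ->
    src T a (2 * N * exp (l * T)) V -> src T a (2 * N * exp (l * T)) V' ->
    (forall t, oc 0 T t -> vnorm (V t [-] V' t) <= M * wgt a l t) ->
    forall t, oc 0 T t -> vnorm (conv r V t [-] conv r V' t) <= 1 / 2 * M * wgt a l t).
  { intros V V' M hM hV hV' le t ht.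
    rewrite <- (conv_src_sub T a C a (2 * N * exp (l * T)) (2 * N * exp (l * T))) by auto.
    apply (ctr (fun s => V s [-] V' s)); auto.
    intros s hs; apply vcont_minus; [apply hV | apply hV']; auto. }
  assert (dX : forall n t, oc 0 T t -> vnorm (X (S n) t [-] X n t) <= (1 / 2) ^ n * (2 * N) * wgt a l t).
  { induction n; intros t ht.
    - rewrite pow_O, Rmult_1_l; replace (X 1%nat t [-] X 0%nat t) with (X 1%nat t) by (simpl; vring).
      now apply (hX 1%nat).
    - rewrite (XS (S n)), (XS n).
      replace (P t [-] conv r (X (S n)) t [-] (P t [-] conv r (X n) t))
        with (vopp (conv r (X (S n)) t [-] conv r (X n) t)) by vring.
      rewrite vnorm_opp.
      replace ((1 / 2) ^ S n * (2 * N)) with (1 / 2 * ((1 / 2) ^ n * (2 * N))) by (simpl; ring).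
      apply sub_ctr; auto; apply Rmult_le_pos; [apply pow_le |]; lra. }
  (* The tail of the geometric series doubles the constant 2N of a single step. *)
  assert (cauchy : forall n j t, oc 0 T t ->
    vnorm (X (n + j)%nat t [-] X n t) <= (1 / 2) ^ n * (4 * N) * wgt a l t).
  { intros n j t ht; assert (w0 := wgt_ge0 a l t).
    assert (G : vnorm (X (n + j)%nat t [-] X n t)
      <= ((1 / 2) ^ n - (1 / 2) ^ (n + j)) * (4 * N) * wgt a l t).
    { induction j.
      - rewrite Nat.add_0_r; replace (X n t [-] X n t) with (v0 : H) by vring; rewrite vnorm_0; lra.
      - rewrite Nat.add_succ_r; assert (B := vnorm_tri (X (S (n + j)) t) (X (n + j)%nat t) (X n t)).
        assert (D := dX (n + j)%nat t ht); simpl pow. lra. }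
    eapply Rle_trans; [exact G |]; apply Rmult_le_compat_r; auto.
    apply Rmult_le_compat_r; [lra |]; assert (p := pow_le (1 / 2) (n + j) ltac:(lra)); lra. }
  assert (lim : forall t, exists W, oc 0 T t -> forall n,
    vnorm (X n t [-] W) <= (1 / 2) ^ n * (4 * N) * wgt a l t).
  { intros t; destruct (excluded_middle_informative (oc 0 T t)) as [ht | nt]; [| now exists v0].
    destruct (vlim_seq (fun n => X n t)) as [W hW].
    - intros e hee; destruct (pow_half_small (4 * N * wgt a l t) (e / 2)) as [n0 hn0]; [lra |].
      exists n0.
      assert (near : forall n, (n0 <= n)%nat -> vnorm (X n t [-] X n0 t) <= e / 2).
      { intros n hn; replace n with (n0 + (n - n0))%nat by lia.
        eapply Rle_trans; [now apply cauchy |]; lra. }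
      intros n m hn hm; eapply Rle_trans; [apply (vnorm_tri _ (X n0 t)) |].
      rewrite (vnorm_sub_sym (X n0 t)); assert (B1 := near n hn); assert (B2 := near m hm); lra.
    - exists W; intros _ n; apply le_epsilon; intros e hee.
      destruct (hW e hee) as [m hm].
      assert (B1 := hm (n + m)%nat ltac:(lia)).
      assert (B2 := cauchy n m t ht); rewrite vnorm_sub_sym in B2.
      assert (B3 := vnorm_tri (X n t) (X (n + m)%nat t) W). lra. }
  destruct (choice _ lim) as [W hW].
  assert (cW : forall t, oc 0 T t -> vcont (oc 0 T) W t).
  { intros t ht e hee; assert (ht' := ht); unfold oc in ht'.
    set (M := exp (l * T) * rp (t / 2) (a - 1)).
    destruct (pow_half_small (4 * N * M) (e / 3)) as [n hn]; [lra |].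
    assert (near : forall s, oc 0 T s -> t / 2 <= s -> vnorm (X n s [-] W s) <= e / 3).
    { intros s hs hts; eapply Rle_trans; [now apply hW |].
      apply Rle_trans with ((1 / 2) ^ n * (4 * N) * M); [| lra].
      apply Rmult_le_compat_l.
      { apply Rmult_le_pos; [apply pow_le |]; lra. }
      unfold oc in hs; apply Rmult_le_compat; try apply rp_ge0; [left; apply exp_pos | |].
      - apply exp_mono, Rmult_le_compat_l; lra.
      - apply rp_decr; lra. }
    destruct (proj1 (hX n) t ht (e / 3)) as [d [hd Hd]]; [lra |].
    destruct (pos_min d (t / 2) hd) as [m [hm [? ?]]]; [lra |].
    exists m; split; auto; intros s hs hst; assert (hst' := hst); apply Rabs_def2 in hst'.
    assert (B1 := near s hs ltac:(lra)); assert (B2 := near t ht ltac:(lra)).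
    assert (B3 := Hd s hs ltac:(lra)).
    assert (B4 := vnorm_tri (W s) (X n s) (W t)).
    assert (B5 := vnorm_tri (X n s) (X n t) (W t)).
    rewrite (vnorm_sub_sym (W s) (X n s)) in B4. lra. }
  assert (sW : src T a (2 * N * exp (l * T)) W).
  { apply wgt_src; auto; [lra | lra |]; intros t ht; apply le_epsilon; intros e hee.
    destruct (pow_half_small (4 * N * wgt a l t) e hee) as [n hn].
    assert (B1 := hW t ht n); rewrite vnorm_sub_sym in B1.
    assert (B2 := vnorm_le_sub (W t) (X n t)). assert (B3 := proj2 (hX n) t ht). lra. }
  exists W, (2 * N * exp (l * T)); repeat split; auto; try apply sW.
  intros t ht; apply vnorm_small_eq; intros e hee.
  destruct (pow_half_small (4 * N * wgt a l t) (e / 2)) as [n hn]; [lra |].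
  assert (p := pow_lt (1 / 2) n ltac:(lra)).
  assert (B1 := hW t ht (S n)); rewrite vnorm_sub_sym in B1; simpl pow in B1.
  assert (B2 := sub_ctr (X n) W ((1 / 2) ^ n * (4 * N))
    ltac:(apply Rmult_le_pos; lra) (sX n) sW (fun s hs => hW s hs n) t ht).
  assert (B3 := vnorm_tri (W t) (X (S n) t) (P t [-] conv r W t)).
  rewrite XS in B1, B3.
  replace (P t [-] conv r (X n) t [-] (P t [-] conv r W t))
    with (vopp (conv r (X n) t [-] conv r W t)) in B3 by vring.
  rewrite vnorm_opp in B3. lra.
Qed.

End Volterra.

(** * Resolvents and primitives of memory kernels *)

Section Resolvent.
Context {H : Hilbert} (A : operator H) (K : H -> H) (E : R -> H -> H) (T : R).
Context (hK : inverse_op A K) (hE : semigroup K E) (hT : 0 < T).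

Definition lip_ker a N (b : R -> H -> H) :=
  (forall t, oc 0 T t -> lin (b t)) /\
  forall x : H, lip_src T a (N * vnorm x) (fun t => b t x).

Lemma lip_ker_ker a N b : 0 < a <= 1 -> 0 <= N -> lip_ker a N b -> ker T a N b.
Proof.
  intros ha hN [bl bh]; split; [auto | split].
  - intros t x ht; eapply Rle_trans; [apply (proj1 (bh x)); auto |]; right; ring.
  - intros x t ht; apply (lip_src_vcont T a (N * vnorm x)); auto; [lra |].
    apply Rmult_le_pos; auto using vnorm_ge0.
Qed.

(** [prim] asks for one constant in both of its bounds: the term T^a dominates t^a, the term 1
    preserves the decay at 0. *)
Lemma ker_of_bound a C (r : R -> H -> H) : 0 <= a -> 0 <= C ->
  (forall t, oc 0 T t -> lin (r t)) ->
  (forall t x, oc 0 T t -> vnorm (r t x) <= C * rp t a * vnorm x) ->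
  (forall x t, oc 0 T t -> vcont (oc 0 T) (fun s => r s x) t) ->
  ker T 1 (C * (1 + rp T a)) r /\
  (forall t x, oc 0 T t -> vnorm (r t x) <= C * (1 + rp T a) * rp t a * vnorm x).
Proof.
  intros ha hC rl rb rc; assert (p := rp_ge0 T a).
  split; [split; [auto | split; [| auto]] |]; intros t x ht; unfold oc in ht.
  - rewrite Rminus_diag, rp_0, Rmult_1_r by lra.
    eapply Rle_trans; [apply rb; unfold oc; lra |].
    apply Rmult_le_compat_r; [apply vnorm_ge0 |]; apply Rmult_le_compat_l; auto.
    assert (rp t a <= rp T a) by (apply rp_incr; lra). lra.
  - eapply Rle_trans; [apply rb; unfold oc; lra |].
    apply Rmult_le_compat_r; [apply vnorm_ge0 |]; apply Rmult_le_compat_r; [apply rp_ge0 |].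
    assert (0 <= C * rp T a) by (apply Rmult_le_pos; auto). lra.
Qed.

(* [S = A (E * b)], so that [K S] solves [R' + A R = b], [R(0) = 0]. *)
Lemma resolvent_exists a N b : 0 < a <= 1 -> 0 <= N -> lip_ker a N b ->
  exists S C C', 0 <= C /\ 0 <= C' /\ ker T a C S /\
    prim T a C' (fun t x => K (S t x)) (fun t x => b t x [-] S t x).
Proof.
  intros ha hN [bl bh]; assert (lK := inv_lin A K hK).
  assert (hp := par_const_pos a ltac:(lra)). assert (hb := beta_const_pos 1 a ltac:(lra) ltac:(lra)).
  assert (c := fun x => parabolic A K E T hK hE a (N * vnorm x) (fun t => b t x) ha
    ltac:(apply Rmult_le_pos; auto using vnorm_ge0) (bh x)).
  destruct (choice _ c) as [S hS]; clear c.
  (* The choice is made for each [x] separately, so linearity must be proved: the defect, mapped by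
     [K], solves z' = -A z with limit 0 at time 0 and hence vanishes. *)
  assert (Sl : forall t, oc 0 T t -> lin (fun x => S x t)).
  { assert (van : forall x, vanishes T (fun t => K (S x t))).
    { intros x; apply (vanishes_rp T a (N * vnorm x * beta_const 1 a)); [lra | |].
      - repeat apply Rmult_le_pos; auto using vnorm_ge0; lra.
      - intros t ht; now apply (hS x). }
    assert (van_scal : forall c x, vanishes T (fun t => c [*] K (S x t))).
    { intros c x; apply (vanishes_lin T (vscal c) (Rabs c + 1)); auto.
      - generalize (Rabs_pos c); lra.
      - intros y; rewrite vnorm_scal; apply Rmult_le_compat_r; [apply vnorm_ge0 | lra]. }
    intros t ht; apply lin_comb; intros k x y.
    set (w := fun t => S (x [+] (k [*] y)) t [-] S x t [-] (k [*] S y t)).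
    set (z := fun t => K (S (x [+] (k [*] y)) t) [-] K (S x t) [-] (k [*] K (S y t))).
    assert (eKw : forall s, z s = K (w s)).
    { intros s; unfold z, w; now rewrite !(lin_sub K), (proj2 lK). }
    assert (Z : z t = v0).
    { apply (homogeneous_zero A K T hK z w); auto.
      - intros s hs; repeat apply vcont_minus; try now apply hS.
        apply (vcont_lip _ (fun s => K (S y s)) _ (vscal k) (Rabs k));
          [apply Rabs_pos | | now apply hS].
        intros p q; replace ((k [*] p) [-] (k [*] q)) with (k [*] (p [-] q)) by vring.
        rewrite vnorm_scal; lra.
      - intros s hs.
        replace (vopp (w s)) with (b s (x [+] (k [*] y)) [-] S (x [+] (k [*] y)) s
          [-] (b s x [-] S x s) [-] (k [*] (b s y [-] S y s))).
        + repeat apply rder_sub; try now apply hS.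
          apply (rder_lin (vscal k) (Rabs k)); [split; intros; vring | apply Rabs_pos | |].
          * intros p; rewrite vnorm_scal; lra.
          * now apply hS.
        + destruct (bl s ltac:(unfold oc, oo in *; lra)) as [b1 b2].
          rewrite b1, b2; unfold w; vring.
      - assert (V := vanishes_add T _ _ (van (x [+] (k [*] y)))
          (vanishes_add T _ _ (van_scal (-1) x) (van_scal (- k) y))).
        intros e he; destruct (V e he) as [d [hd Hd]]; exists d; split; auto.
        intros s hs hsd; assert (B := Hd s hs hsd).
        replace (z s) with (K (S (x [+] (k [*] y)) s)
          [+] (((-1) [*] K (S x s)) [+] ((- k) [*] K (S y s)))) by (unfold z; vring).
        exact B. }
    assert (Z' : w t = v0) by (apply (inv_inj A K _ _ hK); rewrite <- eKw, Z, lin_0; auto).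
    replace (S (x [+] (k [*] y)) t) with (w t [+] S x t [+] (k [*] S y t)) by (unfold w; vring).
    rewrite Z'; vring. }
  assert (hC0 : 0 <= N * beta_const 1 a) by (apply Rmult_le_pos; lra).
  destruct (ker_of_bound a (N * beta_const 1 a) (fun t x => K (S x t))) as [k1 k2]; [lra | auto | | | |].
  - intros t ht; destruct (Sl t ht) as [l1 l2]; split; intros.
    + now rewrite l1, (proj1 lK).
    + now rewrite l2, (proj2 lK).
  - intros t x ht; destruct (hS x) as [_ [_ [B _]]]; eapply Rle_trans; [now apply B |].
    right; ring.
  - intros x t ht; now apply hS.
  - exists (fun t x => S x t), (N * par_const a), (N * beta_const 1 a * (1 + rp T a)).
    split; [apply Rmult_le_pos; lra |].
    split; [apply Rmult_le_pos; auto; generalize (rp_ge0 T a); lra |].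
    split; [split; [exact Sl | split] | split; [exact k1 | split; [exact k2 |]]].
    + intros t x ht; destruct (hS x) as [[B _] _]; eapply Rle_trans; [now apply B |]; right; ring.
    + intros x t ht; now apply hS.
    + intros t x ht; now apply hS.
Qed.

Lemma src_primitive a N (q : R -> H) : 0 < a <= 1 -> 0 <= N -> src T a N q ->
  exists F : R -> H, F 0 = v0 /\ (forall t, cc 0 T t -> vcont (cc 0 T) F t) /\
    (forall t, oo 0 T t -> rder F t (q t)) /\
    (forall t, oc 0 T t -> vnorm (F t) <= N / a * rp t a).
Proof.
  intros ha hN [qb qc].
  (* With zero second coefficient this is N/a times t^a; c = T + 1 keeps all of [0, T] within its
     range. *)
  set (G := beta_prim N a 0 1 (T + 1)).
  assert (cG : forall D t, cc 0 T t -> rcont D G t).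
  { intros D t ht; unfold cc in ht; apply beta_prim_cont; lra. }
  assert (dG : forall t, oo 0 T t -> rderR G t (N * rp t (a - 1))).
  { intros t ht; unfold oo in ht.
    assert (B := beta_prim_der N a 0 1 (T + 1) t ltac:(lra) ltac:(lra) ltac:(lra)).
    rewrite Rmult_0_l, Rplus_0_r in B; exact B. }
  destruct (NI_exists q (fun t => N * rp t (a - 1)) G 0 T hT) as [I [F [cF [dF eI]]]]; auto.
  - intros t ht; unfold oo in ht; apply (vcont_sub (oc 0 T)); [unfold oo, oc; intros; lra |].
    apply qc; unfold oc; lra.
  - intros t ht; unfold oo in ht; apply qb; unfold oc; lra.
  - exists (fun t => F t [-] F 0); repeat split.
    + vring.
    + intros t ht; apply vcont_minus; [now apply cF | apply vcont_const].
    + intros t ht; replace (q t) with (q t [-] v0) by vring.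
      apply rder_sub; [now apply dF | apply rder_const].
    + intros t ht; unfold oc in ht.
      replace (N / a * rp t a) with (G t - G 0).
      2: { unfold G, beta_prim; rewrite rp_zero; field; lra. }
      apply (mean_value_rder F q G (fun t => N * rp t (a - 1))); [lra | | | | |].
      * intros s hs; apply (vcont_sub (cc 0 T)); unfold cc in *; [intros; lra | apply cF; unfold cc; lra].
      * intros s hs; apply cG; unfold cc in *; lra.
      * intros s hs; apply dF; unfold oo in *; lra.
      * intros s hs; apply dG; unfold oo in *; lra.
      * intros s hs; apply qb; unfold oo, oc in *; lra.
Qed.

(** The primitive is chosen for each [x] separately; linearity follows because a function with zero
    derivative and value 0 at time 0 vanishes. *)
Lemma lip_ker_primitive a N b : 0 < a <= 1 -> 0 <= N -> lip_ker a N b ->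
  exists B C, 0 <= C /\ prim T a C B b.
Proof.
  intros ha hN hb; assert (hk := lip_ker_ker a N b ha hN hb); destruct hb as [bl bh].
  assert (c := fun x => src_primitive a (N * vnorm x) (fun t => b t x) ha
    ltac:(apply Rmult_le_pos; auto using vnorm_ge0)
    (lip_src_src T a (N * vnorm x) _ ltac:(lra) ltac:(apply Rmult_le_pos; auto using vnorm_ge0) (bh x))).
  destruct (choice _ c) as [B hB]; clear c.
  assert (zero : forall (z : R -> H) t, z 0 = v0 -> (forall s, cc 0 T s -> vcont (cc 0 T) z s) ->
    (forall s, oo 0 T s -> rder z s v0) -> oc 0 T t -> z t = v0).
  { intros z t z0 cz dz ht; unfold oc in ht; rewrite <- z0; apply zero_rder; [lra | |].
    - intros s hs; apply (vcont_sub (cc 0 T)); unfold cc in *; [intros; lra |].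
      apply cz; unfold cc; lra.
    - intros s hs; apply dz; unfold oo in *; lra. }
  assert (Bl : forall t, oc 0 T t -> lin (fun x => B x t)).
  { intros t ht; apply lin_comb; intros k x y.
    assert (Z : B (x [+] (k [*] y)) t [-] B x t [-] (k [*] B y t) = v0).
    { apply (zero (fun t => B (x [+] (k [*] y)) t [-] B x t [-] (k [*] B y t))); auto.
      - rewrite !(proj1 (hB _)); vring.
      - intros s hs; repeat apply vcont_minus; try now apply hB.
        apply (vcont_lip _ (B y) _ (vscal k) (Rabs k)); [apply Rabs_pos | | now apply hB].
        intros p q; replace ((k [*] p) [-] (k [*] q)) with (k [*] (p [-] q)) by vring.
        rewrite vnorm_scal; lra.
      - intros s hs; replace (v0 : H) with (b s (x [+] (k [*] y)) [-] b s x [-] (k [*] b s y)).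
        + repeat apply rder_sub; try now apply hB.
          apply (rder_lin (vscal k) (Rabs k)); [split; intros; vring | apply Rabs_pos | |].
          * intros p; rewrite vnorm_scal; lra.
          * now apply hB.
        + destruct (bl s ltac:(unfold oc, oo in *; lra)) as [b1 b2]; rewrite b1, b2; vring. }
    replace (B (x [+] (k [*] y)) t)
      with (B (x [+] (k [*] y)) t [-] B x t [-] (k [*] B y t) [+] B x t [+] (k [*] B y t)) by vring.
    rewrite Z; vring. }
  assert (hNa : 0 <= N / a) by (apply Rdiv_le_0_compat; lra).
  destruct (ker_of_bound a (N / a) (fun t x => B x t)) as [k1 k2]; [lra | auto | auto | | |].
  - intros t x ht; destruct (hB x) as [_ [_ [_ bd]]]; eapply Rle_trans; [now apply bd |].
    right; field; lra.
  - intros x t ht; apply (vcont_sub (cc 0 T)); [unfold oc, cc; intros; lra |].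
    apply hB; unfold oc, cc in *; lra.
  - exists (fun t x => B x t), (N / a * (1 + rp T a)); split.
    + apply Rmult_le_pos; auto; generalize (rp_ge0 T a); lra.
    + split; [exact k1 | split; [exact k2 |]]. intros t x ht; now apply hB.
Qed.

End Resolvent.

(** * Regularity of the solution *)

Section SourceAlgebra.
Context {H : Hilbert} (T : R) (hT : 0 < T).
Implicit Types (phi psi : R -> H).

Lemma src_add b N N' phi psi : src T b N phi -> src T b N' psi ->
  src T b (N + N') (fun t => phi t [+] psi t).
Proof.
  intros [p1 p2] [q1 q2]; split; intros t ht.
  - eapply Rle_trans; [apply vnorm_add |]; rewrite Rmult_plus_distr_r.
    apply Rplus_le_compat; auto.
  - apply vcont_add; auto.
Qed.

Lemma src_opp b N phi : src T b N phi -> src T b N (fun t => vopp (phi t)).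
Proof.
  intros [p1 p2]; split; intros t ht; [rewrite vnorm_opp; auto | apply vcont_opp; auto].
Qed.

Lemma src_sub b N N' phi psi : src T b N phi -> src T b N' psi ->
  src T b (N + N') (fun t => phi t [-] psi t).
Proof. intros h h'; apply (src_add b N N' phi); auto; now apply src_opp. Qed.

Lemma src_weaken b N N' phi : N <= N' -> src T b N phi -> src T b N' phi.
Proof.
  intros hN [p1 p2]; split; auto; intros t ht; eapply Rle_trans; [now apply p1 |].
  apply Rmult_le_compat_r; auto using rp_ge0.
Qed.

Lemma src_conv a C b N r phi : 0 < a <= 1 -> 0 < b <= 1 -> 0 <= C -> 0 <= N ->
  ker T a C r -> src T b N phi -> src T b (C * N * beta_const a b * rp T a) (conv r phi).
Proof.
  intros ha hb hC hN hr hp; split; intros t ht.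
  - eapply Rle_trans; [apply (conv_bound T a C b N); auto |]; unfold oc in ht.
    assert (B := beta_const_pos a b ltac:(lra) ltac:(lra)).
    rewrite (Rmult_assoc _ (rp T a)); apply Rmult_le_compat_l.
    { repeat apply Rmult_le_pos; lra. }
    replace (a + b - 1) with (a + (b - 1)) by ring; rewrite rp_add by lra.
    apply Rmult_le_compat_r; [apply rp_ge0 | apply rp_incr; lra].
  - apply (conv_cont T a C b N); auto.
Qed.

Lemma src_of_bounded a N phi : 0 < a <= 1 -> 0 <= N -> src T 1 N phi ->
  src T a (N * rp T (1 - a)) phi.
Proof.
  intros ha hN [p1 p2]; split; auto; intros t ht; eapply Rle_trans; [now apply p1 |].
  unfold oc in ht; rewrite Rmult_assoc; apply Rmult_le_compat_l; auto.
  replace (1 - 1) with ((1 - a) + (a - 1)) by ring; rewrite rp_add by lra.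
  apply Rmult_le_compat_r; [apply rp_ge0 | apply rp_incr; lra].
Qed.

Lemma bounded_src phi : (forall t, cc 0 T t -> vcont (cc 0 T) phi t) ->
  exists M, 0 <= M /\ src T 1 M phi.
Proof.
  intros cp; destruct (vcont_bounded phi 0 T cp) as [M [hM pM]].
  exists M; split; [lra | split]; intros t ht; unfold oc in ht.
  - rewrite Rminus_diag, rp_0, Rmult_1_r by lra; apply pM; unfold cc; lra.
  - apply (vcont_sub (cc 0 T)); [unfold oc, cc; intros; lra | apply cp; unfold cc; lra].
Qed.

Lemma vanishes_conv a C r phi : 0 < a <= 1 -> 0 <= C ->
  forall N, 0 <= N -> ker T 1 C r -> src T a N phi -> vanishes T (conv r phi).
Proof.
  intros ha hC N hN hr hp; assert (B := beta_const_pos 1 a ltac:(lra) ltac:(lra)).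
  apply (vanishes_rp T a (C * N * beta_const 1 a)); [lra | |].
  - repeat apply Rmult_le_pos; lra.
  - intros t ht; eapply Rle_trans; [apply (conv_bound T 1 C a N); auto; lra |].
    replace (1 + a - 1) with a by ring; lra.
Qed.

Lemma vanishes_ext phi psi : (forall t, oc 0 T t -> phi t = psi t) ->
  vanishes T phi -> vanishes T psi.
Proof.
  intros e v x hx; destruct (v x hx) as [d [hd Hd]]; exists d; split; auto.
  intros t ht htd; rewrite <- e; auto.
Qed.

Lemma vanishes_cont phi : vcont (cc 0 T) phi 0 -> vanishes T (fun t => phi t [-] phi 0).
Proof.
  intros c e he; destruct (c e he) as [d [hd Hd]]; exists d; split; auto.
  intros t ht htd; unfold oc in ht; apply Hd; [unfold cc; lra |].
  rewrite Rminus_0_r, Rabs_pos_eq; lra.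
Qed.

Lemma vanishes_opp phi : vanishes T phi -> vanishes T (fun t => vopp (phi t)).
Proof.
  intros v e he; destruct (v e he) as [d [hd Hd]]; exists d; split; auto.
  intros; rewrite vnorm_opp; auto.
Qed.

End SourceAlgebra.

Section Regularity.
Context {H : Hilbert} (A : operator H) (K : H -> H) (E : R -> H -> H) (T : R).
Context (hK : inverse_op A K) (hE : semigroup K E) (hT : 0 < T).
(** Intended reading: [b] is the sum of the beta_j M_j and [bt] that of the beta_j N_j, linked by
    [Kb]; [f1] = f', [f0] = f(0), [a0] = A u0, so that [f0 [-] a0] is u'(0) and [Q] is A E(t)
    u'(0). *)
Context (a Nb Nt Nf NQ : R) (b bt : R -> H -> H) (f f1 Q : R -> H) (f0 a0 : H).
Context (ha : 0 < a <= 1) (hNb : 0 <= Nb) (hNt : 0 <= Nt) (hNf : 0 <= Nf) (hNQ : 0 <= NQ).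
Context (hb : lip_ker T a Nb b) (hbt : lip_ker T a Nt bt).
Context (Kb : forall t x, oc 0 T t -> K (b t x) = bt t (K x)).
Context (fc : forall t, oc 0 T t -> vcont (oc 0 T) f t).
Context (fd : forall t, oo 0 T t -> rder f t (f1 t)).
Context (fv : vanishes T (fun t => f t [-] f0)).
Context (f1s : lip_src T a Nf f1).
Context (QK : forall t, oc 0 T t -> K (Q t) = E t (f0 [-] a0)).
Context (Qd : forall t, oo 0 T t -> rder (fun s => E s (f0 [-] a0)) t (vopp (Q t))).
Context (Qs : src T a NQ Q).

Let h t := f1 t [-] b t a0.

Let Kl : lin K.
Proof. apply (inv_lin A K hK). Qed.

Let Kbd : exists C, 0 < C /\ bnd K C.
Proof. apply (inv_bnd A K hK). Qed.

Lemma h_lip_src : lip_src T a (Nf + Nb * vnorm a0) h.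
Proof.
  destruct f1s as [h1 h2]; destruct hb as [_ hb']; destruct (hb' a0) as [b1 b2].
  unfold h; split.
  - intros t ht; eapply Rle_trans; [apply vnorm_sub |]; rewrite Rmult_plus_distr_r.
    apply Rplus_le_compat; auto.
  - intros s t hs ht.
    replace (f1 t [-] b t a0 [-] (f1 s [-] b s a0))
      with ((f1 t [-] f1 s) [-] (b t a0 [-] b s a0)) by vring.
    eapply Rle_trans; [apply vnorm_sub |]; rewrite !Rmult_plus_distr_r.
    apply Rplus_le_compat; auto.
Qed.

(* The derivative [y = u'] of the solution is constructed as [K W], where [W = A u'] solves
   a Volterra equation obtained by differentiating the problem. *)
Lemma derivative_exists : exists W NW, 0 <= NW /\ src T a NW W /\
  (forall t, oc 0 T t -> vcont (oc 0 T) (fun s => K (W s)) t) /\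
  (forall t, oo 0 T t -> rder (fun s => K (W s)) t (h t [-] W t [-] conv b W t)) /\
  vanishes T (fun t => K (W t) [-] (f0 [-] a0)) /\
  exists My, 0 <= My /\ src T 1 My (fun t => K (W t)).
Proof.
  assert (hNh : 0 <= Nf + Nb * vnorm a0).
  { assert (0 <= Nb * vnorm a0) by (apply Rmult_le_pos; auto using vnorm_ge0). lra. }
  destruct (parabolic A K E T hK hE a _ h ha hNh h_lip_src) as [P [Ps [Pc [Pb Pd]]]].
  destruct (resolvent_exists A K E T hK hE a Nb b ha hNb hb)
    as [S [C [C' [hC [hC' [Sk Sp]]]]]].
  assert (bk := lip_ker_ker T a Nb b ha hNb hb).
  assert (ppos := par_const_pos a ltac:(lra)).
  assert (bpos := beta_const_pos 1 a ltac:(lra) ltac:(lra)).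
  assert (hNP : 0 <= NQ + (Nf + Nb * vnorm a0) * par_const a).
  { assert (0 <= (Nf + Nb * vnorm a0) * par_const a) by (apply Rmult_le_pos; lra). lra. }
  destruct (volterra_solve T a C _ S (fun t => Q t [+] P t) hT ha hC hNP Sk
    (src_add T a _ _ Q P Qs Ps)) as [W [NW [hNW [Ws We]]]].
  assert (Sk1 : ker T 1 C' (fun t x => K (S t x))) by apply Sp.
  destruct Kbd as [CK [hCK bK]].
  (* The Volterra equation after applying [K]. The kernel [S] becomes K S, a primitive of b - S, so
     every term can now be differentiated. *)
  set (y := fun t => E t (f0 [-] a0) [+] K (P t) [-] conv (fun t x => K (S t x)) W t).
  assert (ey : forall t, oc 0 T t -> K (W t) = y t).
  { intros t ht; unfold y.
    rewrite (conv_lin T K CK a C a NW S W) by (auto; lra).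
    rewrite <- QK, We, (lin_sub K), (proj1 Kl) by auto; vring. }
  assert (Ec : forall t, cc 0 T t -> vcont (cc 0 T) (fun s => E s (f0 [-] a0)) t).
  { intros t ht; unfold cc in ht; apply (vcont_sub (fun s => 0 <= s)); [unfold cc; intros; lra |].
    apply (sg_cont K E hE); lra. }
  assert (cy : forall t, oc 0 T t -> vcont (oc 0 T) (fun s => K (W s)) t).
  { intros t ht; apply (vcont_lip _ W _ K CK); [lra | now apply lin_lip |]; now apply Ws. }
  exists W, NW; split; [auto | split; [auto | split; [auto | split; [| split]]]].
  - intros t ht; assert (ht' : oc 0 T t) by (unfold oo, oc in *; lra).
    apply (rder_ext_loc y _ _ _ (T - t)); unfold oo in ht; [lra | |].
    { intros s hs; symmetry; apply ey; unfold oc; lra. }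
    (* Differentiating [y] gives -Q + (h - P) - (b - S) * W, and the Volterra equation W = Q + P - S
       * W turns this into the claimed form. *)
    replace (h t [-] W t [-] conv b W t)
      with (vopp (Q t) [+] (h t [-] P t) [-] conv (fun s x => b s x [-] S s x) W t).
    2: { rewrite (conv_ker_sub T a Nb C a NW b S W) by auto.
         rewrite (We t ht'); vring. }
    apply rder_sub; [apply rder_add |].
    + apply Qd; unfold oo; lra.
    + apply Pd; unfold oo; lra.
    + apply (conv_prim_rder T a (Nb + C) C' a NW); auto; [lra |].
      now apply ker_sub.
  - assert (v1 : vanishes T (fun t => E t (f0 [-] a0) [-] (f0 [-] a0))).
    { assert (V := vanishes_cont T _ (Ec 0 ltac:(unfold cc; lra))).
      cbv beta in V; rewrite (sg_0 K E hE) in V; exact V. }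
    assert (v2 : vanishes T (fun t => K (P t))).
    { apply (vanishes_rp T a ((Nf + Nb * vnorm a0) * beta_const 1 a)); [lra | | exact Pb].
      apply Rmult_le_pos; lra. }
    assert (v3 := vanishes_conv T a C' _ W ha hC' NW hNW Sk1 Ws).
    assert (V := vanishes_add T _ _ v1 (vanishes_add T _ _ v2 (vanishes_opp T _ v3))).
    revert V; apply vanishes_ext; intros t ht; rewrite ey by auto; unfold y; vring.
  - destruct (bounded_src T _ Ec) as [M1 [hM1 s1]].
    assert (s2 : src T 1 ((Nf + Nb * vnorm a0) * beta_const 1 a * rp T a) (fun t => K (P t))).
    { split; auto; intros t ht; eapply Rle_trans; [now apply Pb |]; unfold oc in ht.
      rewrite Rminus_diag, rp_0, Rmult_1_r by lra.
      apply Rmult_le_compat_l; [apply Rmult_le_pos; lra | apply rp_incr; lra]. }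
    assert (s3 : src T 1 (C' * NW * beta_const 1 a * rp T a) (conv (fun t x => K (S t x)) W)).
    { assert (hq : 0 <= C' * NW * beta_const 1 a) by (repeat apply Rmult_le_pos; lra).
      split; intros t ht.
      - eapply Rle_trans; [apply (conv_bound T 1 C' a NW); auto; lra |]; unfold oc in ht.
        rewrite Rminus_diag, rp_0, Rmult_1_r by lra; replace (1 + a - 1) with a by ring.
        apply Rmult_le_compat_l; [auto | apply rp_incr; lra].
      - apply (conv_cont T 1 C' a NW); auto; lra. }
    assert (s := src_sub T 1 _ _ _ _ (src_add T 1 _ _ _ _ s1 s2) s3).
    match type of s with src _ _ ?M _ => exists M end; split.
    + repeat apply Rplus_le_le_0_compat; auto; repeat apply Rmult_le_pos; auto using rp_ge0; lra.
    + destruct s as [sb sc]; split; auto; intros t ht; rewrite ey by auto; now apply sb.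
Qed.

(* For [U = u0 + int_0^t y], the residual of the equation has zero derivative. *)
Lemma antiderivative_solves (W y : R -> H) NW My : 0 <= NW -> 0 <= My -> src T a NW W ->
  (forall t, oc 0 T t -> y t = K (W t)) -> src T 1 My y ->
  (forall t, oo 0 T t -> rder y t (h t [-] W t [-] conv b W t)) ->
  vanishes T (fun t => y t [-] (f0 [-] a0)) ->
  exists U, U 0 = K a0 /\ (forall t, cc 0 T t -> vcont (cc 0 T) U t) /\
    (forall t, oo 0 T t -> rder U t (y t)) /\
    (forall t, oc 0 T t -> K (y t) [+] U t [+] conv bt U t = K (f t)).
Proof.
  intros hNW hMy Ws ey ys dy vy.
  destruct Kbd as [CK [hCK bK]].
  assert (bk := lip_ker_ker T a Nb b ha hNb hb). assert (btk := lip_ker_ker T a Nt bt ha hNt hbt).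
  destruct (src_primitive T hT 1 My y ltac:(lra) hMy ys) as [F [F0 [Fc [Fd _]]]].
  destruct (lip_ker_primitive T hT a Nt bt ha hNt hbt) as [B [CB [hCB Bp]]].
  assert (Bk : ker T 1 CB B) by apply Bp.
  set (U := fun t => K a0 [+] F t).
  assert (Uc : forall t, cc 0 T t -> vcont (cc 0 T) U t).
  { intros t ht; apply vcont_add; [apply vcont_const | now apply Fc]. }
  assert (Ud : forall t, oo 0 T t -> rder U t (y t)).
  { intros t ht; replace (y t) with (v0 [+] y t) by vring.
    apply rder_add; [apply rder_const | now apply Fd]. }
  assert (U0 : U 0 = K a0) by (unfold U; rewrite F0; vring).
  exists U; repeat split; auto.
  destruct (bounded_src T U Uc) as [MU [hMU Us]].
  assert (Uoc : forall t, oc 0 T t -> vcont (oc 0 T) U t) by apply Us.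
  (* The convolution of the singular [bt] with [U] is rewritten with its primitive [B], to which
     [conv_prim_rder] applies; the boundary term comes from U(0) = K a0. *)
  assert (parts : forall t, oc 0 T t -> conv bt U t = B t (K a0) [+] conv B y t).
  { intros t ht; rewrite <- U0.
    apply (conv_by_parts T a Nt CB a (My * rp T (1 - a)) MU B bt y U); auto.
    - apply Rmult_le_pos; auto using rp_ge0.
    - now apply src_of_bounded. }
  assert (convK : forall t, oc 0 T t -> K (conv b W t) = conv bt y t).
  { intros t ht; symmetry; apply conv_unique; [unfold oc in ht; lra |].
    apply (NI_ext (fun s => K (b (t - s) (W s)))).
    - intros s hs; unfold oo, oc in *; rewrite Kb, <- ey by (unfold oc; lra); auto.
    - apply (NI_lin K CK (fun s => b (t - s) (W s))); auto; [lra |].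
      apply (conv_spec T a Nb a NW); auto. }
  set (Z := fun t => K (y t) [+] U t [+] (B t (K a0) [+] conv B y t) [-] K (f t)).
  assert (Zz : forall t, oc 0 T t -> Z t = v0).
  { apply (vanishes_constant T Z hT).
    - intros t ht; apply vcont_minus; [apply vcont_add; [apply vcont_add |] |].
      + apply (vcont_lip _ y _ K CK); [lra | now apply lin_lip | now apply ys].
      + now apply Uoc.
      + apply vcont_add; [now apply Bk |].
        apply (conv_cont T 1 CB 1 My); auto; lra.
      + apply (vcont_lip _ f _ K CK); [lra | now apply lin_lip | now apply fc].
    - intros t ht; assert (ht' : oc 0 T t) by (unfold oo, oc in *; lra).
      replace (v0 : H) with (K (h t [-] W t [-] conv b W t) [+] y t
        [+] (bt t (K a0) [+] conv bt y t) [-] K (f1 t)).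
      2: { rewrite !(lin_sub K), convK, <- ey by auto; unfold h.
           rewrite (lin_sub K), Kb by auto; vring. }
      apply rder_sub; [apply rder_add; [apply rder_add | apply rder_add] |].
      + apply (rder_lin K CK); auto; lra.
      + now apply Ud.
      + now apply Bp.
      + apply (conv_prim_rder T a Nt CB 1 My); auto; lra.
      + apply (rder_lin K CK); auto; lra.
    (* At 0 the residual tends to K (f0 - a0) + K a0 - K f0 = 0, the memory terms being of positive
       order in t. *)
    - assert (v1 := vanishes_lin T K CK _ hCK bK vy).
      assert (v2 := vanishes_cont T U (Uc 0 ltac:(unfold cc; lra))).
      assert (v3 : vanishes T (fun t => B t (K a0))).
      { apply (vanishes_rp T a (CB * vnorm (K a0))); [lra | |].
        - apply Rmult_le_pos; auto using vnorm_ge0.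
        - intros t ht; eapply Rle_trans; [now apply Bp |]; right; ring. }
      assert (v4 := vanishes_conv T 1 CB B y ltac:(lra) hCB My hMy Bk ys).
      assert (v5 := vanishes_opp T _ (vanishes_lin T K CK _ hCK bK fv)).
      assert (V := vanishes_add T _ _ (vanishes_add T _ _ v1 v2)
        (vanishes_add T _ _ (vanishes_add T _ _ v3 v4) v5)).
      revert V; apply vanishes_ext; intros t ht; unfold Z.
      rewrite U0, !(lin_sub K) by auto; vring. }
  intros t ht; assert (Q1 := Zz t ht); unfold Z in Q1.
  rewrite parts by auto.
  replace (K (f t)) with (K (f t) [+] v0) by vring; rewrite <- Q1; vring.
Qed.

(** The equations contain only [K du], [u] and [bt], so bounds on A u are never called for. Two
    steps: q = d + S * d, for the difference [d], vanishes by the energy argument, and then d = -S *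
    d vanishes by the contraction. *)
Lemma solution_unique (u du U y : R -> H) : u 0 = U 0 ->
  (forall t, cc 0 T t -> vcont (cc 0 T) u t) ->
  (forall t, cc 0 T t -> vcont (cc 0 T) U t) ->
  (forall t, oo 0 T t -> rder u t (du t)) -> (forall t, oo 0 T t -> rder U t (y t)) ->
  (forall t, oc 0 T t -> K (du t) [+] u t [+] conv bt u t = K (f t)) ->
  (forall t, oc 0 T t -> K (y t) [+] U t [+] conv bt U t = K (f t)) ->
  forall t, oc 0 T t -> u t = U t.
Proof.
  intros e0 uc Uc ud Ud eu eU.
  destruct Kbd as [CK [hCK bK]].
  assert (btk := lip_ker_ker T a Nt bt ha hNt hbt).
  destruct (resolvent_exists A K E T hK hE a Nt bt ha hNt hbt)
    as [S [C [C' [hC [hC' [Sk Sp]]]]]].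
  assert (Sk1 : ker T 1 C' (fun t x => K (S t x))) by apply Sp.
  destruct (bounded_src T u uc) as [Mu [hMu us]]. destruct (bounded_src T U Uc) as [MU [hMU Us]].
  set (d := fun t => u t [-] U t).
  assert (dc : forall t, cc 0 T t -> vcont (cc 0 T) d t) by (intros; apply vcont_minus; auto).
  destruct (bounded_src T d dc) as [Md [hMd ds]].
  assert (deq : forall t, oc 0 T t -> K (du t [-] y t) [+] d t [+] conv bt d t = v0).
  { intros t ht; unfold d at 2.
    rewrite (conv_src_sub T a Nt 1 Mu MU bt u U) by (auto; lra).
    assert (G : K (du t) [+] u t [+] conv bt u t [-] (K (y t) [+] U t [+] conv bt U t) = v0).
    { rewrite eu, eU by auto; vring. }
    rewrite <- G, (lin_sub K) by auto; unfold d; vring. }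
  (* From K d' = -d - bt * d and (K S)' = bt - S it follows that (K q)' = -d - S * d = -q, the
     homogeneous problem z' = -A z for z = K q. *)
  set (q := fun t => d t [+] conv S d t).
  assert (Kq : forall t, oc 0 T t -> K (q t) = K (d t) [+] conv (fun t x => K (S t x)) d t).
  { intros t ht; unfold q; rewrite (proj1 Kl).
    now rewrite (conv_lin T K CK a C 1 Md S d) by (auto; lra). }
  assert (Kq0 : forall t, oc 0 T t -> K (q t) = v0).
  { apply (homogeneous_zero A K T hK (fun t => K (q t)) q); auto.
    - intros t ht; apply (vcont_ext _ (fun s => K (d s) [+] conv (fun t x => K (S t x)) d s)); auto.
      + intros; symmetry; auto.
      + apply vcont_add.
        * apply (vcont_lip _ d _ K CK); [lra | now apply lin_lip | now apply ds].
        * apply (conv_cont T 1 C' 1 Md); auto; lra.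
    - intros t ht; assert (ht' : oc 0 T t) by (unfold oo, oc in *; lra).
      apply (rder_ext_loc (fun s => K (d s) [+] conv (fun t x => K (S t x)) d s) _ _ _ (T - t));
        unfold oo in ht; [lra | |].
      { intros s hs; symmetry; apply Kq; unfold oc; lra. }
      replace (vopp (q t))
        with (K (du t [-] y t) [+] conv (fun s x => bt s x [-] S s x) d t).
      + apply rder_add.
        * apply (rder_lin K CK); auto; [lra |]; apply rder_sub; [apply ud | apply Ud]; unfold oo; lra.
        * apply (conv_prim_rder T a (Nt + C) C' 1 Md); auto; try lra.
          now apply ker_sub.
      + rewrite (conv_ker_sub T a Nt C 1 Md bt S d) by (auto; lra).
        assert (G := deq t ht'); unfold q.
        replace (K (du t [-] y t) [+] (conv bt d t [-] conv S d t))
          with ((K (du t [-] y t) [+] d t [+] conv bt d t) [-] (d t [+] conv S d t)) by vring.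
        rewrite G; vring.
    - assert (v1 : vanishes T d).
      { assert (V := vanishes_cont T d (dc 0 ltac:(unfold cc; lra))).
        revert V; apply vanishes_ext; intros t ht.
        unfold d at 2; rewrite e0; vring. }
      assert (v2 := vanishes_conv T 1 C' _ d ltac:(lra) hC' Md hMd Sk1 ds).
      assert (V := vanishes_add T _ _ (vanishes_lin T K CK _ hCK bK v1) v2).
      revert V; apply vanishes_ext; intros t ht; rewrite Kq; auto. }
  assert (dz : forall t, oc 0 T t -> d t = v0).
  { apply (volterra_zero T a C (Md * rp T (1 - a)) S d); auto.
    - apply Rmult_le_pos; auto using rp_ge0.
    - now apply src_of_bounded.
    - intros t ht; assert (q0 : q t = v0).
      { apply (inv_inj A K _ _ hK); rewrite Kq0, lin_0; auto. }
      replace (d t) with (q t [-] conv S d t) by (unfold q; vring); rewrite q0; vring. }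
  intros t ht; replace (u t) with (d t [+] U t) by (unfold d; vring); rewrite dz by auto; vring.
Qed.

(** Uniqueness transfers to [u] what holds by construction: u' = K W, so [W] is A u', and [V] = h -
    W - b * W is u'', both in the weighted class from the outset. *)
Lemma regularity (u du : R -> H) : u 0 = K a0 ->
  (forall t, cc 0 T t -> vcont (cc 0 T) u t) ->
  (forall t, oo 0 T t -> rder u t (du t)) ->
  (forall t, oc 0 T t -> K (du t) [+] u t [+] conv bt u t = K (f t)) ->
  exists W V N, 0 <= N /\ src T a N W /\ src T a N V /\
    (forall t, oc 0 T t -> vcont (oc 0 T) (fun s => K (W s)) t) /\
    (forall t, oo 0 T t -> rder u t (K (W t))) /\
    (forall t, oo 0 T t -> rder (fun s => K (W s)) t (V t)).
Proof.
  intros e0 uc ud eu.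
  destruct derivative_exists as [W [NW [hNW [Ws [yc [yd [yv [My [hMy ys]]]]]]]]].
  destruct (antiderivative_solves W (fun t => K (W t)) NW My hNW hMy Ws (fun t _ => eq_refl) ys yd yv)
    as [U [U0 [Uc [Ud eU]]]].
  assert (uU : forall t, oc 0 T t -> u t = U t).
  { apply (solution_unique u du U (fun t => K (W t))); auto; congruence. }
  assert (bk := lip_ker_ker T a Nb b ha hNb hb).
  assert (hNh : 0 <= Nf + Nb * vnorm a0).
  { assert (0 <= Nb * vnorm a0) by (apply Rmult_le_pos; auto using vnorm_ge0). lra. }
  assert (Vs := src_sub T a _ _ _ _
    (src_sub T a _ _ _ _ (lip_src_src T a _ h ltac:(lra) hNh h_lip_src) Ws)
    (src_conv T a Nb a NW b W ha ha hNb hNW bk Ws)).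
  match type of Vs with src _ _ (?M1 + NW + ?M2) _ => set (R1 := M1) in *; set (R2 := M2) in * end.
  assert (0 <= R2).
  { assert (B := beta_const_pos a a ltac:(lra) ltac:(lra)).
    unfold R2; repeat apply Rmult_le_pos; auto using rp_ge0; lra. }
  assert (0 <= R1) by auto.
  exists W, (fun t => h t [-] W t [-] conv b W t), (R1 + NW + R2).
  split; [lra | split; [| split; [exact Vs | split; [auto | split; [| auto]]]]].
  - apply (src_weaken T a NW); auto; lra.
  - intros t ht; apply (rder_ext_loc U _ _ _ (T - t)); unfold oo in ht; [lra | |].
    + intros s hs; symmetry; apply uU; unfold oc; lra.
    + apply Ud; unfold oo; lra.
Qed.

End Regularity.

(** * Memory kernels and improper integrals *)

Section DerivativeOn.
Context {H : Hilbert} (T : R).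
Implicit Types (f : R -> H).

Lemma is_derive_on_eps f t (l : H) : oc 0 T t ->
  is_derive_on T f t l <-> forall e, 0 < e -> exists d, 0 < d /\
    forall s, oc 0 T s -> Rabs (s - t) < d ->
      vnorm (f s [-] f t [-] ((s - t) [*] l)) <= e * Rabs (s - t).
Proof.
  intros ht; split.
  - intros [_ h] e he.
    assert (L : is_filter_lim (within (fun s => 0 < s <= T) (locally t)) t).
    { intros P [d Hd]; exists d; intros s hs _; now apply Hd. }
    destruct (h t L (mkposreal e he)) as [d Hd].
    exists d; split; [apply cond_pos |]; intros s hs hst; exact (Hd s hst hs).
  - intros h; split.
    + apply (is_linear_scal_l (K := R_AbsRing) (V := hspace H) l).
    + intros x hx.
      (* The point [t] belongs to every set of the restricted neighbourhood filter, so no other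
         point can be a limit of it. *)
      assert (ex : x = t).
      { apply NNPP; intros n.
        assert (hp : 0 < Rabs (t - x)) by (apply Rabs_pos_lt; lra).
        destruct (hx (fun s => Rabs (s - x) < Rabs (t - x))) as [d Hd].
        - exists (mkposreal _ hp); intros s hs; exact hs.
        - assert (B := Hd t (ball_center t d) ht). lra. }
      subst x; intros e; destruct (h e (cond_pos e)) as [d [hd Hd]].
      exists (mkposreal d hd); intros s hs Ds; exact (Hd s Ds hs).
Qed.

Lemma is_derive_on_vcont f t (l : H) : oc 0 T t -> is_derive_on T f t l -> vcont (oc 0 T) f t.
Proof.
  intros ht h; apply (two_sided_vcont _ _ _ l).
  exact (proj1 (is_derive_on_eps f t l ht) h).
Qed.

Lemma is_derive_on_rder f t (l : H) : oo 0 T t -> is_derive_on T f t l -> rder f t l.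
Proof.
  intros ht h e he; assert (ht' : oc 0 T t) by (unfold oo, oc in *; lra); unfold oo in ht.
  destruct (proj1 (is_derive_on_eps f t l ht') h e he) as [d [hd Hd]].
  destruct (pos_min d (T - t) hd) as [m [hm [? ?]]]; [lra |].
  exists m; split; auto; intros k hk.
  assert (B := Hd (t + k) ltac:(unfold oc; lra)).
  replace (t + k - t) with k in B by ring; rewrite Rabs_pos_eq in B by lra; apply B; lra.
Qed.

(** On [t/2, T] both functions are continuous up to the ends, so [two_sided_rder] applies, also at t
    = T. *)
Lemma is_derive_on_of_rder f f' t :
  (forall s, oc 0 T s -> vcont (oc 0 T) f s) -> (forall s, oc 0 T s -> vcont (oc 0 T) f' s) ->
  (forall s, oo 0 T s -> rder f s (f' s)) -> oc 0 T t -> is_derive_on T f t (f' t).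
Proof.
  intros cf cf' df ht; apply is_derive_on_eps; auto; intros e he; unfold oc in ht.
  assert (sub : forall g : R -> H, (forall s, oc 0 T s -> vcont (oc 0 T) g s) ->
    forall s, cc (t / 2) T s -> vcont (cc (t / 2) T) g s).
  { intros g cg s hs; apply (vcont_sub (oc 0 T)); unfold cc, oc in *; [intros; lra |].
    apply cg; unfold oc; lra. }
  destruct (two_sided_rder f f' (t / 2) T t) with (e := e) as [d [hd Hd]]; auto.
  - intros s hs; apply df; unfold oo in *; lra.
  - unfold cc; lra.
  - apply sub; auto; unfold cc; lra.
  - destruct (pos_min d (t / 2) hd) as [m [hm [? ?]]]; [lra |].
    exists m; split; auto; intros s hs hst; apply Hd; [| lra].
    apply Rabs_def2 in hst; unfold cc, oc in *; lra.
Qed.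

Lemma rder_unique f t (l k : H) : rder f t l -> rder f t k -> l = k.
Proof.
  intros hl hk; apply vnorm_small_eq; intros e he.
  destruct (hl (e / 2)) as [d [hd Hd]]; [lra |]. destruct (hk (e / 2)) as [d' [hd' Hd']]; [lra |].
  destruct (pos_min d d' hd hd') as [m [hm [? ?]]].
  assert (A := Hd (m / 2) ltac:(lra)); assert (B := Hd' (m / 2) ltac:(lra)).
  set (D := f (t + m / 2) [-] f t) in *.
  assert (G := vnorm_sub (D [-] ((m / 2) [*] k)) (D [-] ((m / 2) [*] l))).
  replace (D [-] ((m / 2) [*] k) [-] (D [-] ((m / 2) [*] l))) with ((m / 2) [*] (l [-] k)) in G by vring.
  rewrite vnorm_scal_pos in G by lra.
  apply Rmult_le_reg_l with (m / 2); lra.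
Qed.

End DerivativeOn.

Lemma derivable_exp_scal c t : derivable_pt_lim (fun s => exp (c * s)) t (c * exp (c * t)).
Proof.
  rewrite Rmult_comm.
  apply (derivable_pt_lim_comp (fun s => c * s) exp).
  - assert (D := derivable_pt_lim_scal id c t 1 (derivable_pt_lim_id t)).
    rewrite Rmult_1_r in D; exact D.
  - apply derivable_pt_lim_exp.
Qed.

Lemma exp_neg_le1 x : 0 <= x -> exp (- x) <= 1.
Proof. intros; rewrite <- exp_0; apply exp_mono; lra. Qed.

Lemma exp_neg_lip k s t : 0 <= k -> 0 <= s <= t ->
  Rabs (exp (- (k * t)) - exp (- (k * s))) <= k * (t - s).
Proof.
  intros hk hs.
  assert (0 <= k * s) by (apply Rmult_le_pos; lra).
  assert (hd : 0 <= k * (t - s)) by (apply Rmult_le_pos; lra).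
  assert (e : exp (- (k * t)) = exp (- (k * s)) * exp (- (k * (t - s)))).
  { rewrite <- exp_plus; f_equal; ring. }
  assert (B1 := exp_neg_le1 (k * s) ltac:(lra)).
  assert (B2 := exp_neg_le1 _ hd).
  assert (B3 : 1 - k * (t - s) <= exp (- (k * (t - s)))).
  { destruct (Req_dec (k * (t - s)) 0) as [z | nz].
    - rewrite z, Ropp_0, exp_0; lra.
    - assert (G := exp_ineq1 (- (k * (t - s))) ltac:(lra)); lra. }
  assert (P := exp_pos (- (k * s))).
  rewrite e, Rabs_left1; nra.
Qed.

(** All kernels are measured with the smallest exponent, at the cost of the factor T^(aj - a). The
    factor 1/Gamma enters as a constant, and the exponential is bounded by 1 and Lipschitz with
    constant kappa. *)
Lemma beta_kernel_bound (kappa aj a T : R) : 0 <= kappa -> 0 < a <= aj -> aj < 1 -> 0 < T ->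
  exists N, 0 <= N /\ (forall t, oc 0 T t -> Rabs (beta kappa aj t) <= N * rp t (a - 1)) /\
    forall s t, 0 < s <= t -> t <= T ->
      Rabs (beta kappa aj t - beta kappa aj s) <= N * rp s (a - 2) * (t - s).
Proof.
  intros hk ha haj hT; set (g := Rabs (/ Gamma aj)); set (D := rp T (aj - a)).
  assert (g0 : 0 <= g) by apply Rabs_pos. assert (D0 : 0 <= D) by apply rp_ge0.
  assert (bE : forall t, 0 < t -> beta kappa aj t = exp (- (kappa * t)) * rp t (aj - 1) * / Gamma aj).
  { intros t ht; unfold beta, Rdiv; now rewrite rp_eq. }
  assert (shift : forall t c, 0 < t <= T -> rp t (aj - c) <= D * rp t (a - c)).
  { intros t c ht; replace (aj - c) with ((aj - a) + (a - c)) by ring; rewrite rp_add by lra.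
    apply Rmult_le_compat_r; [apply rp_ge0 | apply rp_incr; lra]. }
  assert (hkT : 0 <= kappa * T) by (apply Rmult_le_pos; lra).
  exists (D * g * (1 + kappa * T)); split; [| split].
  - repeat apply Rmult_le_pos; lra.
  - intros t ht; unfold oc in ht; rewrite bE, !Rabs_mult by lra; fold g.
    rewrite (Rabs_pos_eq (exp (- (kappa * t)))) by (left; apply exp_pos).
    rewrite (Rabs_pos_eq (rp t (aj - 1))) by apply rp_ge0.
    assert (B1 := exp_neg_le1 (kappa * t) ltac:(apply Rmult_le_pos; lra)).
    assert (B2 := shift t 1 ht). assert (P := exp_pos (- (kappa * t))).
    assert (R1 := rp_ge0 t (aj - 1)). assert (R2 := rp_ge0 t (a - 1)).
    apply Rle_trans with (1 * (D * rp t (a - 1)) * g).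
    + apply Rmult_le_compat_r; auto; apply Rmult_le_compat; lra.
    + assert (0 <= D * rp t (a - 1) * g * (kappa * T)) by (repeat apply Rmult_le_pos; auto; lra).
      lra.
  - intros s t hs ht; rewrite !bE by lra.
    replace (exp (- (kappa * t)) * rp t (aj - 1) * / Gamma aj
        - exp (- (kappa * s)) * rp s (aj - 1) * / Gamma aj)
      with ((exp (- (kappa * t)) * (rp t (aj - 1) - rp s (aj - 1))
        + (exp (- (kappa * t)) - exp (- (kappa * s))) * rp s (aj - 1)) * / Gamma aj) by ring.
    rewrite Rabs_mult; fold g.
    assert (B1 := exp_neg_le1 (kappa * t) ltac:(apply Rmult_le_pos; lra)).
    assert (P := exp_pos (- (kappa * t))).
    assert (B2 := rp_lip s t (aj - 1) hs ltac:(lra)).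
    replace (aj - 1 - 1) with (aj - 2) in B2 by ring.
    rewrite (Rabs_left (aj - 1)) in B2 by lra.
    assert (B3 := exp_neg_lip kappa s t hk ltac:(lra)).
    assert (S2 := shift s 2 ltac:(lra)).
    assert (R0 := rp_ge0 s (aj - 2)). assert (R1 := rp_ge0 s (a - 2)).
    assert (C1 : Rabs (exp (- (kappa * t)) * (rp t (aj - 1) - rp s (aj - 1)))
      <= D * rp s (a - 2) * (t - s)).
    { rewrite Rabs_mult, (Rabs_pos_eq (exp _)) by lra.
      apply Rle_trans with (1 * (D * rp s (a - 2) * (t - s))); [| lra].
      apply Rmult_le_compat; [lra | apply Rabs_pos | lra |].
      eapply Rle_trans; [exact B2 |]; apply Rmult_le_compat_r; [lra |].
      apply Rle_trans with (1 * rp s (aj - 2)); [| lra].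
      apply Rmult_le_compat_r; lra. }
    assert (C2 : Rabs ((exp (- (kappa * t)) - exp (- (kappa * s))) * rp s (aj - 1))
      <= kappa * T * (D * rp s (a - 2) * (t - s))).
    { rewrite Rabs_mult, (Rabs_pos_eq (rp _ _)) by apply rp_ge0.
      replace (kappa * T * (D * rp s (a - 2) * (t - s)))
        with (kappa * (t - s) * (T * (D * rp s (a - 2)))) by ring.
      apply Rmult_le_compat; [apply Rabs_pos | apply rp_ge0 | lra |].
      replace (aj - 1) with (1 + (aj - 2)) by ring; rewrite rp_add, rp_1 by lra.
      apply Rmult_le_compat; lra. }
    replace (D * g * (1 + kappa * T) * rp s (a - 2) * (t - s))
      with ((D * rp s (a - 2) * (t - s) + kappa * T * (D * rp s (a - 2) * (t - s))) * g) by ring.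
    apply Rmult_le_compat_r; auto.
    eapply Rle_trans; [apply Rabs_triang |]; lra.
Qed.

Section Sums.
Context {H : Hilbert} (T : R).

Fixpoint vsum (x : nat -> H) (n : nat) : H :=
  match n with 0%nat => v0 | S k => vsum x k [+] x (S k) end.

Lemma sum_n_m_vsum (x : nat -> H) n : sum_n_m x 1 n = vsum x n.
Proof.
  induction n as [| n IH].
  - apply (sum_n_m_zero (G := AbelianGroup.AbelianMonoid (CompleteNormedModule.AbelianGroup _ H))); lia.
  - rewrite sum_n_Sm by lia; simpl; now rewrite <- IH.
Qed.

Lemma vsum_lin (L : H -> H) x n : lin L -> L (vsum x n) = vsum (fun j => L (x j)) n.
Proof.
  intros hL; induction n; simpl; [now apply lin_0 |]. now rewrite (proj1 hL), IHn.
Qed.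

Lemma vsum_ext (x y : nat -> H) n : (forall j, (1 <= j <= n)%nat -> x j = y j) ->
  vsum x n = vsum y n.
Proof.
  intros e; induction n; simpl; auto; rewrite IHn, e by (intros; try apply e; lia); auto.
Qed.

Lemma NI_vsum (q : nat -> R -> H) (I : nat -> H) a b n : a <= b ->
  (forall j, (1 <= j <= n)%nat -> NI (q j) a b (I j)) ->
  NI (fun s => vsum (fun j => q j s) n) a b (vsum I n).
Proof.
  intros hab h; induction n; simpl.
  - exists (fun _ => v0); repeat split.
    + intros; apply vcont_const.
    + intros; apply rder_const.
    + vring.
  - apply NI_add; [apply IHn; intros; apply h; lia | apply h; lia].
Qed.

Lemma lip_ker_add a N N' (b b' : R -> H -> H) : lip_ker T a N b -> lip_ker T a N' b' ->
  lip_ker T a (N + N') (fun t x => b t x [+] b' t x).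
Proof.
  intros [l h] [l' h']; split.
  - intros t ht; destruct (l t ht) as [l1 l2], (l' t ht) as [l1' l2']; split; intros.
    + rewrite l1, l1'; vring.
    + rewrite l2, l2'; vring.
  - intros x; destruct (h x) as [h1 h2], (h' x) as [h1' h2']; split.
    + intros t ht; eapply Rle_trans; [apply vnorm_add |].
      assert (A := h1 t ht); assert (B := h1' t ht). lra.
    + intros s t hs ht.
      replace (b t x [+] b' t x [-] (b s x [+] b' s x))
        with ((b t x [-] b s x) [+] (b' t x [-] b' s x)) by vring.
      eapply Rle_trans; [apply vnorm_add |].
      assert (A := h2 s t hs ht); assert (B := h2' s t hs ht). lra.
Qed.

Lemma lip_ker_scalar a N C (be : R -> R) (M : H -> H) : 0 <= N -> 0 <= C -> lin M -> bnd M C ->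
  (forall t, oc 0 T t -> Rabs (be t) <= N * rp t (a - 1)) ->
  (forall s t, 0 < s <= t -> t <= T -> Rabs (be t - be s) <= N * rp s (a - 2) * (t - s)) ->
  lip_ker T a (N * C) (fun t x => be t [*] M x).
Proof.
  intros hN hC [M1 M2] bM b1 b2; split.
  - intros t ht; split; intros; rewrite ?M1, ?M2; vring.
  - intros x; split.
    + intros t ht; rewrite vnorm_scal.
      replace (N * C * vnorm x * rp t (a - 1)) with (N * rp t (a - 1) * (C * vnorm x)) by ring.
      apply Rmult_le_compat; auto using Rabs_pos, vnorm_ge0.
    + intros s t hs ht; replace ((be t [*] M x) [-] (be s [*] M x)) with ((be t - be s) [*] M x) by vring.
      rewrite vnorm_scal.
      replace (N * C * vnorm x * rp s (a - 2) * (t - s))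
        with (N * rp s (a - 2) * (t - s) * (C * vnorm x)) by ring.
      apply Rmult_le_compat; auto using Rabs_pos, vnorm_ge0.
Qed.

Lemma lip_ker_vsum a (b : nat -> R -> H -> H) n :
  (forall j, (1 <= j <= n)%nat -> exists N, 0 <= N /\ lip_ker T a N (b j)) ->
  exists N, 0 <= N /\ lip_ker T a N (fun t x => vsum (fun j => b j t x) n).
Proof.
  intros h; induction n.
  - exists 0; split; [lra |]; split; simpl.
    + intros t ht; split; intros; vring.
    + intros x; split.
      * intros t ht; rewrite vnorm_0; lra.
      * intros s t hs ht; replace ((v0 : H) [-] v0) with (v0 : H) by vring; rewrite vnorm_0; lra.
  - destruct IHn as [N [hN hn]]; [intros; apply h; lia |].
    destruct (h (S n)) as [N' [hN' hn']]; [lia |].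
    exists (N + N'); split; [lra |]; simpl; now apply lip_ker_add.
Qed.

End Sums.

(** * Bounded operators B K and K B obtained from domination *)

Section DominatedOperator.
Context {H : Hilbert} (A : operator H) (K : H -> H) (B : operator H).
Context (hK : inverse_op A K) (hBl : linear_op B) (hBd : forall w, dom A w -> dom B w)
  (hB : dominates A B).

Lemma BK_lin : lin (fun x => B (K x)).
Proof.
  destruct hBl as [_ [Badd Bscal]]; assert (lK := inv_lin A K hK).
  assert (d : forall x, dom B (K x)) by (intros; apply hBd, (inv_dom A K hK)).
  split; intros.
  - rewrite (proj1 lK); apply (Badd (K x) (K y)); auto.
  - rewrite (proj2 lK); apply (Bscal a (K x)); auto.
Qed.

(** Testing on the dense range of [K] suffices: take [K v] close to [z] itself. *)
Lemma inner_bound_norm (z : H) c : 0 <= c ->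
  (forall v, inner z (K v) <= c * vnorm (K v)) -> vnorm z <= c.
Proof.
  intros hc h; apply le_epsilon; intros e he.
  assert (nz := vnorm_ge0 _ z).
  destruct (Req_dec (vnorm z) 0) as [-> | n]; [lra |].
  (* Approximation within [d] gives |z|^2 <= c |z| + (|z| + c) d, and this [d] makes the last term
     at most e |z|. *)
  set (d := e * vnorm z / (vnorm z + c + 1)).
  assert (hd : 0 < d) by (apply Rdiv_lt_0_compat; [apply Rmult_lt_0_compat |]; lra).
  destruct (inv_dense A K hK z d hd) as [v hv].
  assert (P : vnorm z * vnorm z = inner z (z [-] K v) + inner z (K v)).
  { rewrite norm_sqr; unfold vsub; rewrite inner_add_r, inner_vopp_r; ring. }
  assert (P1 := inner_le_norm z (z [-] K v)). assert (P2 := h v).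
  assert (P3 := vnorm_le_sub (K v) z). rewrite vnorm_sub_sym in P3.
  assert (vnorm z * vnorm (z [-] K v) <= vnorm z * d) by (apply Rmult_le_compat_l; lra).
  assert (c * vnorm (K v) <= c * (vnorm z + d)) by (apply Rmult_le_compat_l; lra).
  assert (ed : (vnorm z + c + 1) * d = e * vnorm z) by (unfold d; field; lra).
  apply Rmult_le_reg_l with (vnorm z); lra.
Qed.

(** Domination with (q, theta) = (2, 0) bounds (B K x, K v) by |x| |K v|. With (0, 2) and the test
    vector K (K v), symmetry of [K] bounds (K B K x, K v) by |K x| |K v|, that is, K B is bounded on
    the domain of A. *)
Lemma dominated_bounds : exists C, 0 < C /\ bnd (fun x => B (K x)) C /\
  forall x, vnorm (K (B (K x))) <= C * vnorm (K x).
Proof.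
  destruct hB as [C [hC h]]; exists C; split; auto.
  assert (d := inv_dom A K hK).
  split; intros x.
  - apply inner_bound_norm; [apply Rmult_le_pos; auto using vnorm_ge0; lra |]; intros v.
    assert (G := h 2%nat 0%nat eq_refl (K x) (K v) (d x) (d v)); simpl in G.
    rewrite (inv_r A K hK) in G; eapply Rle_trans; [apply Rle_abs | exact G].
  - apply inner_bound_norm; [apply Rmult_le_pos; auto using vnorm_ge0; lra |]; intros v.
    assert (G := h 0%nat 2%nat eq_refl (K x) (K (K v)) (d x) (d (K v))); simpl in G.
    rewrite (inv_r A K hK) in G; rewrite (inv_sym A K hK).
    eapply Rle_trans; [apply Rle_abs | exact G].
Qed.

(** Extension by density. The value at [x] is characterized by |y - L w| <= C |x - K w| for all [w];
    linearity, the bound and agreement on the range of [K] all follow from this inequality, without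
    reference to approximating sequences. *)
Lemma extension (L : H -> H) C : 0 < C -> lin L -> (forall x, vnorm (L x) <= C * vnorm (K x)) ->
  exists N, lin N /\ bnd N C /\ forall x, N (K x) = L x.
Proof.
  intros hC lL bL; assert (lK := inv_lin A K hK).
  assert (ex : forall x, exists y, forall w, vnorm (y [-] L w) <= C * vnorm (x [-] K w)).
  { intros x.
    assert (app : forall n, exists w, vnorm (x [-] K w) <= / INR (S n)).
    { intros n; apply (inv_dense A K hK), Rinv_0_lt_compat, lt_0_INR; lia. }
    destruct (choice _ app) as [w hw].
    assert (small : forall e, 0 < e -> exists N, forall n, (N <= n)%nat -> / INR (S n) <= e).
    { intros e he; destruct (archimed_cor1 e he) as [N [hN hN0]]; exists N; intros n hn.
      apply Rle_trans with (/ INR N); [| lra].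
      apply Rinv_le_contravar; [apply lt_0_INR | apply le_INR]; lia. }
    assert (near : forall n w', vnorm (L (w n) [-] L w') <= C * (/ INR (S n) + vnorm (x [-] K w'))).
    { intros n w'; rewrite <- (lin_sub L) by auto; eapply Rle_trans; [apply bL |].
      apply Rmult_le_compat_l; [lra |]; rewrite (lin_sub K) by auto.
      assert (P := vnorm_tri (K (w n)) x (K w')); rewrite (vnorm_sub_sym (K (w n)) x) in P.
      assert (Q := hw n). lra. }
    destruct (vlim_seq (fun n => L (w n))) as [y hy].
    - intros e he; destruct (small (e / 2 / C)) as [N hN]; [repeat apply Rdiv_lt_0_compat; lra |].
      exists N; intros n m hn hm; eapply Rle_trans; [apply near |].
      assert (P1 := hN n hn); assert (P2 := hN m hm); assert (P3 := hw m).
      apply Rle_trans with (C * (e / 2 / C + e / 2 / C)); [| right; field; lra].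
      apply Rmult_le_compat_l; lra.
    - exists y; intros w'; apply le_epsilon; intros e he.
      destruct (hy (e / 2)) as [N1 h1]; [lra |].
      destruct (small (e / 2 / C)) as [N2 h2]; [repeat apply Rdiv_lt_0_compat; lra |].
      set (n := (N1 + N2)%nat).
      assert (P1 := h1 n ltac:(unfold n; lia)); assert (P2 := h2 n ltac:(unfold n; lia)).
      assert (P3 := near n w'); assert (P4 := vnorm_tri y (L (w n)) (L w')).
      rewrite vnorm_sub_sym in P1.
      assert (C * / INR (S n) <= C * (e / 2 / C)) by (apply Rmult_le_compat_l; lra).
      replace (C * (e / 2 / C)) with (e / 2) in * by (field; lra). lra. }
  destruct (choice _ ex) as [N hN]; exists N; split; [| split].
  - apply lin_comb; intros k x y; apply vnorm_small_eq; intros e he.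
    assert (hk := Rabs_pos k).
    assert (hp : 0 < C * (2 + 2 * Rabs k)) by (apply Rmult_lt_0_compat; lra).
    destruct (inv_dense A K hK x (e / (C * (2 + 2 * Rabs k)))) as [v hv]; [now apply Rdiv_lt_0_compat |].
    destruct (inv_dense A K hK y (e / (C * (2 + 2 * Rabs k)))) as [w hw]; [now apply Rdiv_lt_0_compat |].
    assert (P1 := hN (x [+] (k [*] y)) (v [+] (k [*] w))).
    assert (P2 := hN x v). assert (P3 := hN y w).
    rewrite (proj1 lL), (proj2 lL), (proj1 lK), (proj2 lK) in P1.
    replace (x [+] (k [*] y) [-] (K v [+] (k [*] K w)))
      with ((x [-] K v) [+] (k [*] (y [-] K w))) in P1 by vring.
    assert (P4 := vnorm_add _ (x [-] K v) (k [*] (y [-] K w))).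
    replace (N (x [+] (k [*] y)) [-] (N x [+] (k [*] N y)))
      with ((N (x [+] (k [*] y)) [-] (L v [+] (k [*] L w)))
        [-] ((N x [-] L v) [+] (k [*] (N y [-] L w)))) by vring.
    eapply Rle_trans; [apply vnorm_sub |].
    assert (P6 := vnorm_add _ (N x [-] L v) (k [*] (N y [-] L w))).
    rewrite vnorm_scal in P4, P6.
    set (X := vnorm (x [-] K v)) in *. set (Y := vnorm (y [-] K w)) in *.
    assert (Rabs k * vnorm (N y [-] L w) <= Rabs k * (C * Y)) by (apply Rmult_le_compat_l; lra).
    assert (C * vnorm ((x [-] K v) [+] (k [*] (y [-] K w))) <= C * (X + Rabs k * Y))
      by (apply Rmult_le_compat_l; lra).
    apply Rle_trans with (C * (2 * X + 2 * Rabs k * Y)); [lra |].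
    apply Rle_trans with (C * (2 + 2 * Rabs k) * (e / (C * (2 + 2 * Rabs k)))); [| right; field; lra].
    rewrite (Rmult_assoc C (2 + 2 * Rabs k)); apply Rmult_le_compat_l; [lra |].
    assert (Rabs k * Y <= Rabs k * (e / (C * (2 + 2 * Rabs k)))) by (apply Rmult_le_compat_l; lra).
    lra.
  - intros x; assert (P := hN x v0); rewrite (lin_0 L), (lin_0 K) in P by auto.
    replace (N x [-] v0) with (N x) in P by vring; replace (x [-] v0) with x in P by vring; auto.
  - intros x; apply vnorm_le0_eq; eapply Rle_trans; [apply (hN (K x) x) |].
    replace (K x [-] K x) with (v0 : H) by vring; rewrite vnorm_0; lra.
Qed.

End DominatedOperator.

(** * Improper integrals under bounded linear maps *)

Section ImproperIntegral.
Context {H : Hilbert}.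

Lemma Riemann_sum_lin (L : H -> H) (f : R -> H) (ptd : SF_seq) : lin L ->
  (Riemann_sum (fun s => L (f s)) ptd : H) = L (Riemann_sum f ptd).
Proof.
  intros lL; revert ptd; apply SF_cons_ind.
  - intros x; symmetry; apply (lin_0 L lL).
  - intros h s IH; rewrite !Riemann_sum_cons, IH.
    change (((SF_h s - fst h) [*] L (f (snd h))) [+] L (Riemann_sum f s)
      = L (((SF_h s - fst h) [*] f (snd h)) [+] Riemann_sum f s)).
    now rewrite (proj1 lL), (proj2 lL).
Qed.

Lemma is_RInt_lin (L : H -> H) C (f : R -> H) a b (I : H) : lin L -> 0 < C -> bnd L C ->
  is_RInt f a b I -> is_RInt (fun s => L (f s)) a b (L I).
Proof.
  intros lL hC bL h.
  refine (proj2 (filterlim_locally_ball_norm (F := Riemann_fine a b)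
    (fun ptd => scal (sign (b - a)) (Riemann_sum (fun s => L (f s)) ptd) : hspace H) (L I)) _).
  intros e.
  assert (he : 0 < e / (C + 1)) by (apply Rdiv_lt_0_compat; [apply cond_pos | lra]).
  assert (B := proj1 (filterlim_locally_ball_norm (F := Riemann_fine a b)
    (fun ptd => scal (sign (b - a)) (Riemann_sum f ptd) : hspace H) I) h (mkposreal _ he)).
  revert B; apply filter_imp; intros ptd hp.
  rewrite (Riemann_sum_lin L f ptd lL).
  change (vnorm ((sign (b - a) [*] Riemann_sum f ptd) [-] I) < e / (C + 1)) in hp.
  change (vnorm ((sign (b - a) [*] L (Riemann_sum f ptd)) [-] L I) < e).
  rewrite <- (proj2 lL), <- (lin_sub L) by auto.
  eapply Rle_lt_trans; [apply bL |].
  replace (pos e) with ((C + 1) * (e / (C + 1))) by (field; lra).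
  assert (n := vnorm_ge0 _ ((sign (b - a) [*] Riemann_sum f ptd) [-] I)).
  apply Rle_lt_trans with ((C + 1) * vnorm ((sign (b - a) [*] Riemann_sum f ptd) [-] I)).
  - apply Rmult_le_compat_r; lra.
  - apply Rmult_lt_compat_l; lra.
Qed.

Lemma two_sided_is_derive (f : R -> H) t (l : H) :
  (forall e, 0 < e -> exists d, 0 < d /\ forall s, Rabs (s - t) < d ->
    vnorm (f s [-] f t [-] ((s - t) [*] l)) <= e * Rabs (s - t)) -> is_derive f t l.
Proof.
  intros h; split.
  - apply (is_linear_scal_l (K := R_AbsRing) (V := hspace H) l).
  - intros x hx; assert (ex := @is_filter_lim_locally_unique R_AbsRing R_NormedModule t x hx).
    subst x.
    intros e; destruct (h e (cond_pos e)) as [d [hd Hd]].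
    exists (mkposreal d hd); intros s hs; exact (Hd s hs).
Qed.

(** Connects the improper integrals of the problem with [NI]. The integrand B_j u is not known to be
    continuous, but its image under [L] = K is, so primitives become available only after applying
    [L]. *)
Lemma improper_integral_lin (L : H -> H) C (f q : R -> H) t (I J : H) :
  lin L -> 0 < C -> bnd L C -> 0 < t ->
  is_RInt_gen f (at_right 0) (at_left t) I ->
  (forall s, oo 0 t s -> L (f s) = q s) -> (forall s, oo 0 t s -> vcont (oo 0 t) q s) ->
  NI q 0 t J -> L I = J.
Proof.
  intros lL hC bL ht hI eq cq [F [cF [dF <-]]].
  assert (FD : forall s, oo 0 t s -> is_derive F s (q s)).
  { intros s hs; unfold oo in hs; apply two_sided_is_derive; intros e he.
    assert (sub : forall r, cc (s / 2) ((s + t) / 2) r -> oo 0 t r) by (unfold cc, oo; intros; lra).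
    destruct (two_sided_rder F q (s / 2) ((s + t) / 2) s) with (e := e) as [d [hd Hd]]; auto.
    - intros r hr; apply (vcont_sub (cc 0 t)); [unfold cc; intros; lra |].
      apply cF; unfold cc in *; lra.
    - intros r hr; apply dF; unfold oo in *; lra.
    - unfold cc; lra.
    - apply (vcont_sub (oo 0 t)); auto.
    - destruct (pos_min (s / 2) ((t - s) / 2)) as [m1 [hm1 [? ?]]]; [lra | lra |].
      destruct (pos_min d m1 hd hm1) as [m [hm [? ?]]].
      exists m; split; auto; intros r hr; assert (hr' := hr); apply Rabs_def2 in hr'.
      apply Hd; [unfold cc |]; lra. }
  (* On compact subintervals [L z] is the Riemann integral of the continuous [q], which the
     fundamental theorem evaluates by [F]. *)
  assert (FI : forall x y z, 0 < x <= y -> y < t -> is_RInt f x y z -> L z = F y [-] F x).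
  { intros x y z hx hy hz.
    assert (I1 : is_RInt q x y (F y [-] F x)).
    { apply (is_RInt_derive (V := H) F q); rewrite Rmin_left, Rmax_right by lra; intros s hs.
      - apply FD; unfold oo; lra.
      - apply (vcont_continuous q 0 t); [unfold oo; lra |]; apply cq; unfold oo; lra. }
    assert (I2 : is_RInt q x y (L z)).
    { apply (is_RInt_ext (V := H) (fun s => L (f s))).
      - rewrite Rmin_left, Rmax_right by lra; intros s hs; apply eq; unfold oo; lra.
      - apply (is_RInt_lin L C f); auto. }
    rewrite <- (is_RInt_unique (V := H) _ _ _ _ I1).
    now rewrite <- (is_RInt_unique (V := H) _ _ _ _ I2). }
  apply vnorm_small_eq; intros e he.
  assert (he' : 0 < e / 3 / (C + 1)) by (repeat apply Rdiv_lt_0_compat; lra).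
  destruct (hI _ (locally_ball_norm I (mkposreal _ he'))) as [P1 P2 h1 h2 h12].
  destruct h1 as [d1 h1]. destruct h2 as [d2 h2].
  destruct (cF 0 ltac:(unfold cc; lra) (e / 3)) as [d3 [hd3 h3]]; [lra |].
  destruct (cF t ltac:(unfold cc; lra) (e / 3)) as [d4 [hd4 h4]]; [lra |].
  destruct (pos_min d1 d2 (cond_pos d1) (cond_pos d2)) as [m1 [hm1 [? ?]]].
  destruct (pos_min d3 d4 hd3 hd4) as [m2 [hm2 [? ?]]].
  destruct (pos_min m1 m2 hm1 hm2) as [m3 [hm3 [? ?]]].
  destruct (pos_min m3 t hm3 ht) as [m [hm [? ?]]].
  assert (ax : Rabs (m / 3 - 0) = m / 3) by (rewrite Rminus_0_r, Rabs_pos_eq; lra).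
  assert (ay : Rabs (t - m / 3 - t) = m / 3) by (rewrite Rabs_left; lra).
  destruct (h12 (m / 3) (t - m / 3)) as [z [hz hzI]].
  { apply h1; [change (Rabs (m / 3 - 0) < d1) |]; lra. }
  { apply h2; [change (Rabs (t - m / 3 - t) < d2) |]; lra. }
  simpl in hz; change (vnorm (z [-] I) < e / 3 / (C + 1)) in hzI.
  assert (E := FI (m / 3) (t - m / 3) z ltac:(lra) ltac:(lra) hz).
  assert (A3 := h3 (m / 3) ltac:(unfold cc; lra) ltac:(lra)).
  assert (A4 := h4 (t - m / 3) ltac:(unfold cc; lra) ltac:(lra)).
  replace (L I [-] (F t [-] F 0))
    with ((F (t - m / 3) [-] F t) [-] (F (m / 3) [-] F 0) [-] L (z [-] I))
    by (rewrite (lin_sub L), E by auto; vring).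
  assert (B1 := vnorm_sub ((F (t - m / 3) [-] F t) [-] (F (m / 3) [-] F 0)) (L (z [-] I))).
  assert (B2 := vnorm_sub (F (t - m / 3) [-] F t) (F (m / 3) [-] F 0)).
  assert (B3 := bL (z [-] I)).
  assert (n := vnorm_ge0 _ (z [-] I)).
  assert (C * vnorm (z [-] I) <= (C + 1) * (e / 3 / (C + 1))) by (apply Rmult_le_compat; lra).
  replace ((C + 1) * (e / 3 / (C + 1))) with (e / 3) in * by (field; lra). lra.
Qed.

End ImproperIntegral.

(** The hypotheses concern g, the equation contains f = exp(-kappa t) g. The derivative of f picks
    up the term -kappa g, of lower order because 1 <= T^(1 - a) t^(a - 1) on (0, T]. *)
Lemma damped_source {H : Hilbert} (T kappa a C : R) (g g1 g2 : R -> H) :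
  0 < T -> 0 <= kappa -> 0 < a <= 1 -> 0 <= C ->
  (forall t, oc 0 T t -> is_derive_on T g t (g1 t)) ->
  (forall t, oc 0 T t -> is_derive_on T g1 t (g2 t)) ->
  (forall t, oc 0 T t -> vnorm (g t) <= C) ->
  (forall t, oc 0 T t -> vnorm (g1 t) <= C * rp t (a - 1)) ->
  (forall t, oc 0 T t -> vnorm (g2 t) <= C * rp t (a - 2)) ->
  (forall t, oo 0 T t -> rder (fun s => exp (- kappa * s) [*] g s) t
     (exp (- kappa * t) [*] (g1 t [-] (kappa [*] g t)))) /\
  exists N, 0 <= N /\ lip_src T a N (fun t => exp (- kappa * t) [*] (g1 t [-] (kappa [*] g t))).
Proof.
  intros hT hk ha hC dg dg1 bg bg1 bg2.
  assert (increment : forall (G G' : R -> H) M s t, 0 < s <= t -> t <= T ->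
    (forall r, oc 0 T r -> is_derive_on T G r (G' r)) ->
    (forall r, oo s t r -> vnorm (G' r) <= M) -> vnorm (G t [-] G s) <= M * (t - s)).
  { intros G G' M s t hs ht dG le.
    assert (B := mean_value_lin G G' v0 M s t ltac:(lra)).
    replace (G t [-] G s [-] ((t - s) [*] v0)) with (G t [-] G s) in B by vring.
    apply B; unfold cc, oo in *.
    - intros r hr; apply (vcont_sub (oc 0 T)); [unfold oc; intros; lra |].
      apply (is_derive_on_vcont T G r (G' r)); [| apply dG]; unfold oc; lra.
    - intros r hr; apply (is_derive_on_rder T G r (G' r)); [| apply dG]; unfold oo, oc; lra.
    - intros r hr; replace (G' r [-] v0) with (G' r) by vring; auto. }
  split.
  - intros t ht.
    assert (de : rderR (fun s => exp (- kappa * s)) t (- kappa * exp (- kappa * t))).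
    { apply rderR_of_derivable, derivable_exp_scal. }
    assert (dgt : rder g t (g1 t)).
    { apply (is_derive_on_rder T); auto; apply dg; unfold oo, oc in *; lra. }
    assert (D := rder_scal_fun (fun s => exp (- kappa * s)) g t _ _ de dgt).
    match goal with |- rder _ _ ?l => match type of D with rder _ _ ?l' =>
      replace l with l' by vring end end; exact D.
  - set (D := rp T (1 - a)). set (C1 := C * (1 + kappa * D)).
    assert (D0 : 0 <= D) by apply rp_ge0.
    assert (kD : 0 <= kappa * D) by (apply Rmult_le_pos; auto).
    assert (C10 : 0 <= C1) by (apply Rmult_le_pos; lra).
    assert (one : forall t, 0 < t <= T -> 1 <= D * rp t (a - 1)).
    { intros t ht; assert (e : 1 = rp t (1 - a) * rp t (a - 1)).
      { rewrite <- rp_add by lra; replace (1 - a + (a - 1)) with 0 by ring; rewrite rp_0; lra. }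
      apply Rle_trans with (rp t (1 - a) * rp t (a - 1)); [lra |].
      apply Rmult_le_compat_r; [apply rp_ge0 | apply rp_incr; lra]. }
    assert (bF : forall t, oc 0 T t -> vnorm (g1 t [-] (kappa [*] g t)) <= C1 * rp t (a - 1)).
    { intros t ht; assert (o := one t ht).
      eapply Rle_trans; [apply vnorm_sub |]; rewrite vnorm_scal_pos by auto.
      assert (B1 := bg1 t ht). assert (B2 := bg t ht).
      assert (kappa * vnorm (g t) <= kappa * (C * (D * rp t (a - 1)))).
      { apply Rmult_le_compat_l; auto.
        apply Rle_trans with (C * 1); [lra | apply Rmult_le_compat_l; auto]. }
      unfold C1; lra. }
    assert (shift : forall s, 0 < s <= T -> rp s (a - 1) <= T * rp s (a - 2)).
    { intros s hs; replace (a - 1) with (1 + (a - 2)) by ring; rewrite rp_add, rp_1 by lra.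
      apply Rmult_le_compat_r; [apply rp_ge0 | lra]. }
    assert (kT : 0 <= kappa * T) by (apply Rmult_le_pos; lra).
    (* The first summand is the pointwise bound; the others come from the increments of g', of kappa
       g and of the exponential, each T paying for s^(a - 1) <= T s^(a - 2). *)
    exists (C1 + C + kappa * T * C + kappa * T * C1).
    assert (0 <= kappa * T * C) by (apply Rmult_le_pos; auto).
    assert (0 <= kappa * T * C1) by (apply Rmult_le_pos; auto).
    split; [lra |]; split.
    + intros t ht; rewrite vnorm_scal_pos by (left; apply exp_pos).
      assert (ht' := ht); unfold oc in ht'.
      assert (B1 := exp_neg_le1 (kappa * t) ltac:(apply Rmult_le_pos; lra)).
      replace (- (kappa * t)) with (- kappa * t) in B1 by ring.
      apply Rle_trans with (1 * (C1 * rp t (a - 1))).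
      * apply Rmult_le_compat; auto using vnorm_ge0; left; apply exp_pos.
      * rewrite Rmult_1_l; apply Rmult_le_compat_r; [apply rp_ge0 | lra].
    + intros s t hs ht.
      assert (E1 := exp_neg_le1 (kappa * t) ltac:(apply Rmult_le_pos; lra)).
      assert (E2 := exp_neg_lip kappa s t hk ltac:(lra)).
      replace (- kappa * t) with (- (kappa * t)) by ring.
      replace (- kappa * s) with (- (kappa * s)) by ring.
      set (et := exp (- (kappa * t))) in *. set (es := exp (- (kappa * s))) in *.
      assert (et0 : 0 < et) by apply exp_pos.
      set (F := fun t => g1 t [-] (kappa [*] g t)).
      change (vnorm ((et [*] F t) [-] (es [*] F s))
        <= (C1 + C + kappa * T * C + kappa * T * C1) * rp s (a - 2) * (t - s)).
      set (p := rp s (a - 2) * (t - s)).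
      assert (r0 := rp_ge0 s (a - 2)).
      assert (p0 : 0 <= p) by (apply Rmult_le_pos; lra).
      assert (I1 : vnorm (g1 t [-] g1 s) <= C * p).
      { unfold p; rewrite <- Rmult_assoc; apply (increment g1 g2); auto.
        intros r hr; unfold oo in hr; eapply Rle_trans; [apply bg2; unfold oc; lra |].
        apply Rmult_le_compat_l; auto; apply rp_decr; lra. }
      assert (I2 : vnorm (g t [-] g s) <= T * C * p).
      { apply Rle_trans with (C * (T * rp s (a - 2)) * (t - s)); [| unfold p; lra].
        apply (increment g g1); auto.
        intros r hr; unfold oo in hr; eapply Rle_trans; [apply bg1; unfold oc; lra |].
        apply Rmult_le_compat_l; auto.
        apply Rle_trans with (rp s (a - 1)); [apply rp_decr | apply shift]; lra. }
      replace ((et [*] F t) [-] (es [*] F s))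
        with ((et [*] ((g1 t [-] g1 s) [-] (kappa [*] (g t [-] g s)))) [+] ((et - es) [*] F s))
        by (unfold F; vring).
      assert (V1 := vnorm_add _ (et [*] ((g1 t [-] g1 s) [-] (kappa [*] (g t [-] g s))))
        ((et - es) [*] F s)).
      assert (V2 := vnorm_sub (g1 t [-] g1 s) (kappa [*] (g t [-] g s))).
      rewrite !vnorm_scal, (Rabs_pos_eq et) in V1 by lra.
      rewrite vnorm_scal_pos in V2 by auto.
      assert (W1 : et * vnorm ((g1 t [-] g1 s) [-] (kappa [*] (g t [-] g s)))
        <= 1 * (C * p + kappa * (T * C * p))).
      { apply Rmult_le_compat; auto using vnorm_ge0; try lra.
        assert (kappa * vnorm (g t [-] g s) <= kappa * (T * C * p))
          by (apply Rmult_le_compat_l; auto). lra. }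
      assert (W2 : Rabs (et - es) * vnorm (F s) <= kappa * (t - s) * (C1 * (T * rp s (a - 2)))).
      { apply Rmult_le_compat; auto using vnorm_ge0, Rabs_pos.
        eapply Rle_trans; [apply bF; unfold oc; lra |].
        apply Rmult_le_compat_l; auto; apply shift; lra. }
      assert (0 <= C1 * p) by (apply Rmult_le_pos; auto).
      unfold p in *; lra.
Qed.

Lemma memory_kernels {H : Hilbert} (m : nat) (kappa T a : R) (alpha : nat -> R)
  (A : operator H) (B : nat -> operator H) (K : H -> H) :
  0 <= kappa -> 0 < T -> 0 < a ->
  (forall j, (1 <= j <= m)%nat -> 0 < alpha j < 1) ->
  (forall j, (1 <= j <= m)%nat -> a <= alpha j) ->
  inverse_op A K ->
  (forall j, (1 <= j <= m)%nat -> self_adjoint (B j)) ->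
  (forall j, (1 <= j <= m)%nat -> forall w, dom A w -> dom (B j) w) ->
  (forall j, (1 <= j <= m)%nat -> dominates A (B j)) ->
  exists (M N : nat -> H -> H),
    (forall j x, (1 <= j <= m)%nat -> M j x = B j (K x)) /\
    (forall j, (1 <= j <= m)%nat -> lin (N j) /\ (exists C, 0 < C /\ bnd (N j) C) /\
       forall x, N j (K x) = K (M j x)) /\
    (exists Nb, 0 <= Nb /\
      lip_ker T a Nb (fun t x => vsum (fun j => beta kappa (alpha j) t [*] M j x) m)) /\
    (forall j, (1 <= j <= m)%nat -> exists Nj, 0 <= Nj /\
      lip_ker T a Nj (fun t x => beta kappa (alpha j) t [*] N j x)) /\
    (exists Nt, 0 <= Nt /\
      lip_ker T a Nt (fun t x => vsum (fun j => beta kappa (alpha j) t [*] N j x) m)).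
Proof.
  intros hk hT ha hal hmin hK hBs hBd hB.
  assert (c : forall j, exists Nj : H -> H, (1 <= j <= m)%nat ->
    lin Nj /\ (exists C, 0 < C /\ bnd Nj C) /\ forall x, Nj (K x) = K (B j (K x))).
  { intros j; destruct (excluded_middle_informative (1 <= j <= m)%nat) as [hj |]; [| now exists K].
    destruct (dominated_bounds A K (B j) hK (hB j hj)) as [C [hC [b1 b2]]].
    assert (l := BK_lin A K (B j) hK (proj1 (hBs j hj)) (hBd j hj)).
    assert (lK := inv_lin A K hK).
    destruct (extension A K hK (fun x => K (B j (K x))) C hC) as [Nj [n1 [n2 n3]]]; auto.
    - destruct l as [l1 l2]; split; intros.
      + now rewrite l1, (proj1 lK).
      + now rewrite l2, (proj2 lK).
    - exists Nj; intros _; split; [auto | split; [now exists C | auto]]. }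
  destruct (choice _ c) as [N hN]; clear c.
  assert (kb : forall (L : nat -> H -> H),
    (forall j, (1 <= j <= m)%nat -> lin (L j) /\ exists C, 0 < C /\ bnd (L j) C) ->
    forall j, (1 <= j <= m)%nat -> exists Nj, 0 <= Nj /\
      lip_ker T a Nj (fun t x => beta kappa (alpha j) t [*] L j x)).
  { intros L hL j hj; destruct (hL j hj) as [lL [C [hC bC]]].
    destruct (hal j hj) as [a1 a2]; assert (a3 := hmin j hj).
    destruct (beta_kernel_bound kappa (alpha j) a T hk ltac:(lra) a2 hT) as [Nj [hNj [q1 q2]]].
    exists (Nj * C); split; [apply Rmult_le_pos; lra |].
    apply lip_ker_scalar; auto; lra. }
  assert (hM : forall j, (1 <= j <= m)%nat ->
    lin (fun x => B j (K x)) /\ exists C, 0 < C /\ bnd (fun x => B j (K x)) C).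
  { intros j hj; split; [apply (BK_lin A); auto; now apply hBs |].
    destruct (dominated_bounds A K (B j) hK (hB j hj)) as [C [hC [b1 b2]]]; now exists C. }
  assert (hN' : forall j, (1 <= j <= m)%nat -> lin (N j) /\ exists C, 0 < C /\ bnd (N j) C).
  { intros j hj; destruct (hN j hj) as [n1 [n2 n3]]; auto. }
  exists (fun j x => B j (K x)), N; split; [auto | split; [auto | split; [| split]]].
  - apply (lip_ker_vsum T a (fun j t x => beta kappa (alpha j) t [*] B j (K x))).
    apply (kb (fun j x => B j (K x))); auto.
  - now apply kb.
  - apply (lip_ker_vsum T a (fun j t x => beta kappa (alpha j) t [*] N j x)); now apply kb.
Qed.

Theorem theorem4
  (H : Hilbert) (m : nat) (kappa T : R) (alpha : nat -> R) (alpha_min : R)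
  (A : operator H) (B : nat -> operator H) (E : R -> H -> H)
  (f g g1 g2 e1 u : R -> H) (u0 : H)
  (hm : (1 <= m)%nat)
  (hkappa : 0 <= kappa)
  (halpha : forall j, (1 <= j <= m)%nat -> 0 < alpha j < 1)
  (hmin_attained : exists j, (1 <= j <= m)%nat /\ alpha_min = alpha j)
  (hmin_le : forall j, (1 <= j <= m)%nat -> alpha_min <= alpha j)
  (hT : 0 < T)
  (hA_sa : self_adjoint A)
  (hA_pos : positive_definite A)
  (hA_cpt : has_compact_inverse A)
  (hB_sa : forall j, (1 <= j <= m)%nat -> self_adjoint (B j))
  (hB_dom : forall j, (1 <= j <= m)%nat -> forall w, dom A w -> dom (B j) w)
  (hB : forall j, (1 <= j <= m)%nat -> dominates A (B j))
  (hE : semigroup_generated_by (opp_op A) E)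
  (hu0 : dom A u0)
  (hu0_neq0 : u0 <> zero)
  (hf0 : filterlim f (at_right 0) (locally (f 0)))
  (hu : is_solution m kappa alpha A B f u0 u)
  (hg : forall t, g t = scal (exp (kappa * t)) (f t))
  (hg1 : forall t, 0 < t <= T -> is_derive_on T g t (g1 t))
  (hg2 : forall t, 0 < t <= T -> is_derive_on T g1 t (g2 t))
  (he1 : forall t, 0 < t <= T ->
           is_derive (fun s => E s (minus (A u0) (g 0))) t (e1 t))
  (hbound : exists C : R, 0 < C /\ forall t, 0 < t <= T ->
     norm (minus (A u0) (g 0)) + norm (g t) <= C /\
     norm (e1 t) + norm (g1 t) + t * norm (g2 t)
       <= C * Rpower t (alpha_min - 1)) :
  exists (u1 u2 : R -> H) (C : R), 0 < C /\ forall t, 0 < t <= T ->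
    is_derive_on T u t (u1 t) /\ is_derive_on T u1 t (u2 t) /\
    dom A (u1 t) /\
    norm (u2 t) + norm (A (u1 t))
      <= C * exp (- (kappa * t)) * Rpower t (alpha_min - 1) * qnorm A 2 u0.
Proof.
  assert (ha : 0 < alpha_min < 1) by (destruct hmin_attained as [j [hj ->]]; auto).
  set (a := alpha_min) in *.
  destruct (inverse_exists A hA_sa hA_pos hA_cpt) as [K hK].
  assert (sg := generated_semigroup A K E hK hE).
  assert (lK := inv_lin A K hK). destruct (inv_bnd A K hK) as [CK [hCK bK]].
  set (a0 := A u0). assert (Ka0 : K a0 = u0) by now apply (inv_l A K hK).
  assert (g0 : g 0 = f 0).
  { change (g 0 = f 0); rewrite hg, Rmult_0_r, exp_0.
    change (1 [*] f 0 = f 0); vring. }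
  destruct hbound as [C [hC bd]].
  assert (bC : forall t, oc 0 T t -> vnorm (g t) <= C /\ vnorm (e1 t) <= C * rp t (a - 1) /\
    vnorm (g1 t) <= C * rp t (a - 1) /\ vnorm (g2 t) <= C * rp t (a - 2)).
  { intros t ht; assert (ht' := ht); unfold oc in ht'.
    destruct (bd t ht) as [b1 b2]; rewrite <- rp_eq in b2 by lra.
    change (vnorm (a0 [-] g 0) + vnorm (g t) <= C) in b1.
    change (vnorm (e1 t) + vnorm (g1 t) + t * vnorm (g2 t) <= C * rp t (a - 1)) in b2.
    assert (n1 := vnorm_ge0 _ (a0 [-] g 0)). assert (n2 := vnorm_ge0 _ (e1 t)).
    assert (n3 := vnorm_ge0 _ (g1 t)).
    assert (n4 : 0 <= t * vnorm (g2 t)) by (apply Rmult_le_pos; [lra | apply vnorm_ge0]).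
    repeat split; try lra.
    apply Rmult_le_reg_l with t; [lra |].
    replace (t * (C * rp t (a - 2))) with (C * (rp t 1 * rp t (a - 2))) by (rewrite rp_1; lra).
    rewrite <- rp_add by lra; replace (1 + (a - 2)) with (a - 1) by ring; lra. }
  destruct (damped_source T kappa a C g g1 g2) as [fd [Nf [hNf f1s]]];
    try (intros; apply bC; auto); auto; try lra.
  set (f1 := fun t => exp (- kappa * t) [*] (g1 t [-] (kappa [*] g t))) in *.
  assert (ef : forall t, f t = exp (- kappa * t) [*] g t).
  { intros t; rewrite hg; change (f t = exp (- kappa * t) [*] (exp (kappa * t) [*] f t)).
    replace (exp (- kappa * t) [*] (exp (kappa * t) [*] f t))
      with ((exp (- kappa * t) * exp (kappa * t)) [*] f t) by vring.
    rewrite <- exp_plus; replace (- kappa * t + kappa * t) with 0 by ring.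
    rewrite exp_0; vring. }
  destruct (memory_kernels m kappa T a alpha A B K) as [M [N [eM [hN [[Nb [hNb bl]] [btj [Nt [hNt btl]]]]]]]];
    auto; try lra.
  set (b := fun t x => vsum (fun j => beta kappa (alpha j) t [*] M j x) m) in *.
  set (bt := fun t x => vsum (fun j => beta kappa (alpha j) t [*] N j x) m) in *.
  destruct hu as [hu00 [huc hud]].
  assert (uc : forall t, cc 0 T t -> vcont (cc 0 T) u t).
  { intros t ht; destruct (Req_dec t 0) as [-> | n].
    - intros e he; destruct (proj1 (at_right_eps u u0) huc e he) as [d [hd Hd]].
      exists d; split; auto; intros s hs hs0; unfold cc in hs; rewrite hu00.
      destruct (Req_dec s 0) as [-> | ns].
      + rewrite hu00; replace (u0 [-] u0) with (v0 : H) by vring; rewrite vnorm_0; lra.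
      + apply Hd; rewrite Rminus_0_r, Rabs_pos_eq in hs0; lra.
    - unfold cc in ht; destruct (hud t ltac:(lra)) as [_ [du [_ [D _]]]].
      now apply (is_derive_vcont _ _ _ du). }
  destruct (bounded_src T u uc) as [Mu [hMu us]].
  (* The equation is put in the bounded form of [solution_unique]: after applying [K], each improper
     integral of B_j u becomes a convolution of [u] with the kernel beta_j N_j. *)
  assert (sol : forall t, exists du, oc 0 T t ->
    is_derive u t du /\ K du [+] u t [+] conv bt u t = K (f t)).
  { intros t; destruct (excluded_middle_informative (oc 0 T t)) as [ht | nt]; [| now exists v0].
    assert (ht' := ht); unfold oc in ht'.
    destruct (hud t ltac:(lra)) as [dA [du [I [D [hI eq]]]]].
    exists du; intros _; split; auto.
    rewrite sum_n_m_vsum in eq; change (du [+] A (u t) [+] vsum I m = f t) in eq.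
    rewrite <- eq, !(proj1 lK), (inv_l A K hK) by auto; f_equal.
    rewrite (vsum_lin K) by auto.
    apply conv_unique; [lra |].
    apply (NI_vsum (fun j s => beta kappa (alpha j) (t - s) [*] N j (u s))); [lra |].
    intros j hj; destruct (btj j hj) as [Nj [hNj lj]].
    assert (kj := lip_ker_ker T a Nj _ ltac:(lra) hNj lj).
    assert (S := conv_spec T a Nj 1 Mu _ u t ltac:(lra) ltac:(lra) hNj hMu kj us ht).
    replace (K (I j)) with (conv (fun t x => beta kappa (alpha j) t [*] N j x) u t); auto.
    symmetry.
    apply (improper_integral_lin K CK
      (fun s => beta kappa (alpha j) (t - s) [*] B j (u s)) (fun s => beta kappa (alpha j) (t - s) [*] N j (u s)) t);
      auto; try lra.
    - exact (hI j hj).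
    - intros s hs; unfold oo in hs; rewrite (proj2 lK); f_equal.
      destruct (hud s ltac:(lra)) as [ds _].
      destruct (hN j hj) as [_ [_ nK]].
      rewrite <- (inv_l A K hK (u s) ds), nK, eM by auto; auto.
    - apply (conv_integrand_cont T a Nj 1 Mu (fun t x => beta kappa (alpha j) t [*] N j x) u t);
        auto; lra. }
  destruct (choice _ sol) as [du hdu].
  destruct (orbit_regular A K E hK sg (f 0 [-] a0)) as [Q hQ].
  (* The orbits of f(0) - A u0 and of A u0 - g(0) are opposite, with derivatives [- Q] and [e1];
     hence the assumed bound on E'(t)(A u0 - g(0)) is the bound on [Q]. *)
  assert (eQ : forall t, oc 0 T t -> Q t = e1 t).
  { intros t ht; assert (ht' := ht); unfold oc in ht'.
    destruct (hQ t ltac:(lra)) as [_ [q _]].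
    assert (D := is_derive_rder _ t (e1 t) (he1 t ht)).
    assert (D' : rder (fun s => E s (f 0 [-] a0)) t (vopp (e1 t))).
    { apply (rder_ext_loc (fun s => vopp (E s (a0 [-] f 0))) _ _ _ 1); [lra | |].
      - intros s hs; replace (f 0 [-] a0) with ((-1) [*] (a0 [-] f 0)) by vring.
        rewrite (proj2 (sg_lin K E sg s ltac:(lra))); vring.
      - apply rder_opp; rewrite <- g0; exact D. }
    replace (Q t) with (vopp (vopp (Q t))) by vring.
    rewrite (rder_unique _ t _ _ q D'); vring. }
  assert (Qs : src T a C Q).
  { split; intros t ht; assert (ht' := ht); unfold oc in ht'.
    - rewrite eQ by auto; now apply bC.
    - apply (vcont_sub (fun s => 0 < s)); [unfold oc; intros; lra |]; apply hQ; lra. }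
  destruct (regularity A K E T hK sg hT a Nb Nt Nf C b bt f f1 Q (f 0) a0)
    with (u := u) (du := du) as [W [V [Nw [hNw [Ws [Vs [yc [ud yd]]]]]]]]; auto; try lra.
  { intros t x ht; unfold b, bt; rewrite (vsum_lin K) by auto.
    apply vsum_ext; intros j hj; destruct (hN j hj) as [_ [_ nK]].
    now rewrite (proj2 lK), nK. }
  { intros t ht; apply (vcont_ext _ (fun s => exp (- kappa * s) [*] g s)); auto.
    apply vcont_scal.
    - apply rcont_of_continuity, derivable_continuous_pt.
      exists (- kappa * exp (- kappa * t)); apply derivable_exp_scal.
    - apply (is_derive_on_vcont T g t (g1 t)); auto. }
  { intros t ht; apply (rder_ext_loc (fun s => exp (- kappa * s) [*] g s) _ _ _ 1); [lra | auto |].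
    now apply fd. }
  { intros e he; destruct (proj1 (at_right_eps f (f 0)) hf0 e he) as [d [hd Hd]].
    exists d; split; auto; intros t ht htd; apply Hd; unfold oc in ht; lra. }
  { intros t ht; apply hQ; unfold oc in ht; lra. }
  { intros t ht; apply hQ; unfold oo in ht; lra. }
  { congruence. }
  { intros t ht; apply is_derive_rder, hdu; unfold oo, oc in *; lra. }
  { intros t ht; now apply hdu. }
  (* A u0 = 0 would force u0 = K (A u0) = 0; a positive norm allows the division in the constant
     below. *)
  assert (na0 : 0 < vnorm a0).
  { apply norm_gt_0; intros e; apply hu0_neq0; rewrite <- Ka0.
    change (a0 = v0) in e; rewrite e; now apply lin_0. }
  (* Twice [Nw] bounds the two norms together and the 1 makes the constant positive; exp(kappa T)
     compensates exp(-kappa t) on (0, T], and the division offsets the factor |A u0| in the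
     conclusion. *)
  exists (fun t => K (W t)), V, ((2 * Nw + 1) * exp (kappa * T) / vnorm a0).
  assert (eT := exp_pos (kappa * T)).
  split; [apply Rdiv_lt_0_compat; auto; apply Rmult_lt_0_compat; lra |].
  intros t ht; split; [| split; [| split]].
  - apply (is_derive_on_of_rder T u (fun t => K (W t))); auto.
    intros s hs; now apply us.
  - apply (is_derive_on_of_rder T (fun t => K (W t)) V); auto.
    intros s hs; now apply Vs.
  - apply (inv_dom A K hK).
  - rewrite (inv_r A K hK), <- rp_eq by lra.
    change (vnorm (V t) + vnorm (W t)
      <= (2 * Nw + 1) * exp (kappa * T) / vnorm a0 * exp (- (kappa * t)) * rp t (a - 1) * vnorm a0).
    assert (B1 := proj1 Vs t ht). assert (B2 := proj1 Ws t ht).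
    assert (p := rp_ge0 t (a - 1)).
    replace ((2 * Nw + 1) * exp (kappa * T) / vnorm a0 * exp (- (kappa * t)) * rp t (a - 1) * vnorm a0)
      with ((2 * Nw + 1) * rp t (a - 1) * (exp (kappa * T) * exp (- (kappa * t)))) by (field; lra).
    rewrite <- exp_plus.
    assert (1 <= exp (kappa * T + - (kappa * t))).
    { rewrite <- exp_0; apply exp_mono.
      assert (kappa * t <= kappa * T) by (apply Rmult_le_compat_l; lra). lra. }
    assert (q : 0 <= (2 * Nw + 1) * rp t (a - 1)) by (apply Rmult_le_pos; lra).
    apply Rle_trans with ((2 * Nw + 1) * rp t (a - 1) * 1); [lra |].
    now apply Rmult_le_compat_l.
Qed.
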